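(* If $v=(v^1,v^2,v^3,v^4)$ satisfies $g_{13}+g_{24}=g_{14}=0$, then the solution $\varphi(z,t)=A(t)v(z)$ of the two-dimensional incompressible Euler equations is given by $$A=\begin{pmatrix} t&1&0&0\\ 0&0&1&t\end{pmatrix},$$ where $v=\big(z_1,\;z_2,\;z_2f_1'(z_1)+f_2(z_1),\;f_1(z_1)\big)$ with $-z_2f_1''-f_2'\neq0$. Moreover $$\det(d\varphi)=-z_2f_1''-f_2'\qquad\text{and}\qquad \zeta=\frac{(f_1')^2}{z_2f_1''+f_2'}.$$
   Context: Here $A(t)\in\mathbb{R}^{2\times4}$ depends only on time, $v:D\to\mathbb{R}^4$ depends only on $z=(z_1,z_2)\in D\subset\mathbb{R}^2$, $f_1,f_2$ are functions of one variable, and $g_{ij}=\det(\nabla v^i,\nabla v^j)$ with $\nabla$ the gradient in $z$. $d\varphi$ is the $2\times2$ Jacobian matrix with respect to $z$ only. $\varphi$ is a solution if the velocity field $u(x,t)$ determined (locally) by $\partial_t\varphi(z,t)=u(\varphi(z,t),t)$ satisfies, with some pressure $p$, the equations $u_t+(u\cdot\nabla)u+\nabla p=0$ and $\nabla\cdot u=0$. $\zeta$ denotes the vorticity in the $z$ coordinates, $\zeta=\hat\zeta\circ\varphi^t$ with $\varphi^t=\varphi(\cdot,t)$ and $\hat\zeta=\partial_{x_1}u^2-\partial_{x_2}u^1$. ''The solution is given by'' is understood up to the following: a (local) change of the coordinates $z$; rewriting $Av=(AH^{-1})(Hv)$ with a constant invertible matrix $H$ that preserves the form of the constraints; and multiplying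 $\varphi$ from the left by a rotation or reflection matrix whose angle is $c_1t+c_0$ with constants $c_0,c_1$. Cases in which $\varphi$ can be written in the same form with fewer than four columns of $A$ (up to a purely time-dependent translation) are left aside, and $\det(d\varphi)\neq0$ is required.
   Formalization: The printed vorticity is false (for f1=0, f2=z1 it gives 0, but ζ=−1); proved instead is ζ=−(1+(f1')²)/(z2f1''+f2'). The normal form is obtained near points of an open dense subset of D, and cases with fewer columns are excluded on every open subset of D. *)

(* Defs.v *)
From mathcomp Require Import all_boot all_order all_algebra.
From mathcomp Require Import all_classical all_reals all_analysis.

Set Implicit Arguments.
Unset Strict Implicit.
Unset Printing Implicit Defensive.

Import Order.TTheory GRing.Theory Num.Theory.
Import numFieldNormedType.Exports.

Local Open Scope classical_set_scope.
Local Open Scope ring_scope.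

(* C^n on an open set E.  Asking for the directional derivatives in every
   direction w (and not only along a basis) avoids choosing a basis of V. *)
Fixpoint Ck (R : realType) (V W : normedModType R) (n : nat)
    (E : set V) (f : V -> W) : Prop :=
  match n with
  | 0%N => forall x, E x -> {for x, continuous f}
  | m.+1 => (forall x, E x -> differentiable f x) /\
            (forall w : V, Ck m E (fun x => 'D_w f x))
  end.

Section Euler.
Variable R : realType.

Local Notation plane := 'cV[R]_2.

(* All indices are 0-based: z_1, z_2 are z 0 0, z 1 0 and v^1, ..., v^4 are
   v z 0 0, ..., v z 3 0. *)

Definition pd (k : 'I_2) (f : plane -> R) (z : plane) : R :=
  'D_(delta_mx k 0) f z.

Definition jacmx (n : nat) (w : plane -> 'cV[R]_n) (z : plane) : 'M[R]_(n, 2) :=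
  \matrix_(i < n, k < 2) pd k (fun y => w y i 0) z.

(* det(grad w^i, grad w^j); g_{13} is gdet w 0 2, and so on. *)
Definition gdet (w : plane -> 'cV[R]_4) (i j : 'I_4) (z : plane) : R :=
  \det (\matrix_(k < 2, l < 2)
          pd k (fun y => w y (if l == 0 then i else j) 0) z).

Definition constraint (w : plane -> 'cV[R]_4) (z : plane) : Prop :=
  gdet w 0 2 z + gdet w 1 3 z = 0 /\ gdet w 0 3 z = 0.

Definition preserves_constraint (H : 'M[R]_4) : Prop :=
  forall (w : plane -> 'cV[R]_4) (z : plane),
    differentiable w z -> constraint w z ->
    constraint (fun y => H *m w y) z.

Definition motion (A : R -> 'M[R]_(2, 4)) (v : plane -> 'cV[R]_4)
    (z : plane) (t : R) : plane := A t *m v z.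

(* u is a velocity field of phi near (z0, t0): it is C^1 near the point
   (phi(z0, t0), t0) and d/dt phi(z, t) = u(phi(z, t), t) for (z, t) near
   (z0, t0).  It need only exist locally, as phi(., t) may fail to be
   injective. *)
Definition local_velocity (phi : plane -> R -> plane) (z0 : plane) (t0 : R)
    (u : plane -> R -> plane) : Prop :=
  (exists O : set (plane * R),
     [/\ open O, O (phi z0 t0, t0) & Ck 1 O (fun q => u q.1 q.2)]) /\
  (\forall q \near (z0, t0),
     derivable (phi q.1) q.2 1 /\ 'D_1 (phi q.1) q.2 = u (phi q.1 q.2) q.2).

Definition euler_at (u : plane -> R -> plane) (p : plane -> R -> R)
    (x : plane) (t : R) : Prop :=
  [/\ differentiable (fun y => p y t) x,
      (forall i : 'I_2,
         'D_1 (fun s => u x s i 0) t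
         + \sum_(j < 2) u x t j 0 * pd j (fun y => u y t i 0) x
         + pd i (fun y => p y t) x = 0) &
      \sum_(i < 2) pd i (fun y => u y t i 0) x = 0].

Definition is_solution (D : set plane) (I : set R)
    (phi : plane -> R -> plane) : Prop :=
  forall (z0 : plane) (t0 : R), D z0 -> I t0 ->
    exists (u : plane -> R -> plane) (p : plane -> R -> R),
      local_velocity phi z0 t0 u /\
      \forall q \near (phi z0 t0, t0), euler_at u p q.1 q.2.

Definition vorticity (u : plane -> R -> plane) (x : plane) (t : R) : R :=
  pd 0 (fun y => u y t 1 0) x - pd 1 (fun y => u y t 0 0) x.

(* phi is of the form B w + c with fewer than four columns in B; k.+1 is the
   number of columns (no column at all is the case of one zero column). *)
Definition fewer_columns (U : set plane) (I : set R)
    (phi : plane -> R -> plane) : Prop :=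
  exists k : nat, (k.+1 < 4)%N /\
  exists (B : R -> 'M[R]_(2, k.+1)) (w : plane -> 'cV[R]_k.+1) (c : R -> plane),
    [/\ Ck 2 I B, Ck 2 U w, Ck 2 I c &
        forall z t, U z -> I t -> phi z t = B t *m w z + c t].

(* Rotation (b = false) or reflection (b = true) matrix of angle a. *)
Definition rotrefl (b : bool) (a : R) : 'M[R]_2 :=
  \matrix_(i < 2, j < 2)
    nth 0 (nth [::] [:: [:: cos a; - ((-1) ^+ b * sin a)];
                        [:: sin a; (-1) ^+ b * cos a]] i) j.

(* Psi is a C^2 diffeomorphism of the open set W onto the open set Psi @` W. *)
Definition coordinate_change (W : set plane) (Psi : plane -> plane) : Prop :=
  [/\ open W, open (Psi @` W), Ck 2 W Psi &
      exists Theta : plane -> plane,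
        Ck 2 (Psi @` W) Theta /\ forall y, W y -> Theta (Psi y) = y].

Definition A_normal (t : R) : 'M[R]_(2, 4) :=
  \matrix_(i < 2, j < 4)
    nth 0 (nth [::] [:: [:: t; 1; 0; 0];
                        [:: 0; 0; 1; t]] i) j.

Definition v_normal (f1 f2 : R -> R) (z : plane) : 'cV[R]_4 :=
  \col_(i < 4)
    nth 0 [:: z 0 0; z 1 0; z 1 0 * derive1 f1 (z 0 0) + f2 (z 0 0); f1 (z 0 0)] i.

Definition det_normal (f1 f2 : R -> R) (z : plane) : R :=
  - z 1 0 * derive1 (derive1 f1) (z 0 0) - derive1 f2 (z 0 0).

Definition admissible (W : set plane) (f1 f2 : R -> R) : Prop :=
  let E := [set z 0 0 | z in W] in
  [/\ Ck 2 E f1, Ck 1 E f2 & forall z, W z -> det_normal f1 f2 z != 0].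

End Euler.

(* Main.v *)
From HB Require Import structures.
Require Import Defs.
From mathcomp Require Import all_boot all_order all_algebra.
From mathcomp Require Import all_classical all_reals all_analysis.
From mathcomp Require Import ring lra.
Import Order.TTheory GRing.Theory Num.Theory.
Import numFieldNormedType.Exports.
Local Open Scope classical_set_scope.
Local Open Scope ring_scope.

(** With [g_ij] the 2-forms of [v] and [p_ij], [q_ij = A_i'.A_j - A_j'.A_i] the
    minors and Wronskians of the columns of [A], incompressibility says
    [sum p_ij' g_ij = 0], and the existence of a pressure says
    [sum q_ij' g_ij = 0].  Where [g_12 != 0] the functions [v^1, v^2] are
    coordinates; the constraints then read [v^4 = f1 (z_1)] and
    [v^3 = z_2 f1' (z_1) + f2 (z_1)].  Hence [g_12, g_13, g_23, g_34] satisfy a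
    linear relation only if [f1'' = 0], that is, if [v^4] is affine in [v^1] and
    a column of [A] can be dropped.  So [p_12, p_13 - p_24, p_23, p_34] and the
    corresponding Wronskians are constant in time.

    Cramer's rule writes [A_1 = s A_2 - mu A_3] and
    [A_4 = (s - ka) A_3 - nu A_2], where [s] is a function of time and
    [mu, nu, ka] are constants.  The Wronskian relations make [s'] times the Gram
    matrix of [(A_2, A_3)] constant; as [det (A_2, A_3)] is constant too, [s] is
    affine in time, the Gram matrix is constant, [(A_2, A_3)] is a rotation of a
    constant frame, and the remaining Wronskian says that its angular velocity is
    constant.

    Conversely, the normal form is affine in time, so the fluid particles move
    freely and the pressure vanishes; a velocity field comes from the inverse
    function theorem applied to [(z, t) |-> (phi (z, t), t)]. *)

Set Implicit Arguments.
Unset Strict Implicit.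
Unset Printing Implicit Defensive.

(** * Differentials and the classes C^k *)

Section Differentials.
Context {R : realType}.
Implicit Types U V W : normedModType R.

(** Cramer's rule divides by [det (A_2, A_3)], and that this is nonzero is the delicate point:
    otherwise the Plucker relation makes the minors [p_13] and [p_24] constant, which yields
    constant linear relations between columns of [A] and lets a column be dropped, unless only the
    minor [p_14] survives; but it multiplies [g_14 = 0].

    In normal coordinates and up to a common factor, [g_12, g_13, g_23, g_34] are [1], [f1'],
    [- (z_2 f1'' + f2')] and [- (f1')^2]. Where [f1'' <> 0] the third one varies with [z_2] and
    [f1'] is not locally constant; this is their independence.

    [g_12] may have zeros, but it cannot vanish on an open set, since [v^1] would be constant there.
    So the coordinates exist near the points of an open dense subset, while a single chart is enough
    for the independence and hence for the time part.

    The pressure is only assumed differentiable in space. Pulled back to [z], its derivatives are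
    explicit C^1 expressions in [A] and [v], so its mixed second derivatives exist and agree. *)

Lemma near0_shift V (P : V -> Prop) (x : V) :
  (\forall y \near x, P y) -> \forall h \near (0 : V), P (h + x).
Proof.
move=> Px; have : h + x @[h --> (0 : V)] --> x.
  by rewrite -[X in _ --> X]add0r; apply: cvgD; [exact: cvg_id|exact: cvg_cst].
by move/(_ _ Px).
Qed.

Lemma is_diff_near_le V W (f : V -> W) (x : V) (L : {linear V -> W}) :
  continuous L ->
  (forall e, 0 < e -> \forall h \near (0 : V),
     `|f (h + x) - f x - L h| <= e * `|h|) ->
  is_diff x f L.
Proof.
move=> cL fL.
have fE : f \o shift x = cst (f x) + L +o_ (0 : V) id.
  apply/eqaddoP => e e0; near=> h.
  rewrite [X in `|X|](_ : _ = f (h + x) - f x - L h); last first.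
    by rewrite /= !fctE /= opprD addrA.
  by near: h; exact: fL.
have dL := diff_unique cL fE.
by apply: DiffDef => //; apply/diff_locallyP; rewrite dL; split.
Unshelve. all: by end_near. Qed.

Lemma diff_near_le V W (f : V -> W) (x : V) : differentiable f x ->
  forall e, 0 < e -> \forall h \near (0 : V),
     `|f (h + x) - f x - 'd f x h| <= e * `|h|.
Proof.
move=> /diff_locallyP[_ /eqaddoP fE] e e0; near=> h.
rewrite [X in `|X|](_ : _ = (f \o shift x - (cst (f x) + 'd f x)) h); last first.
  by rewrite /= !fctE /= opprD addrA.
by near: h; exact: fE.
Unshelve. all: by end_near. Qed.

Lemma near_eq_differentiable V W (f g : V -> W) (x : V) :
  (\near x, f x = g x) -> differentiable f x -> differentiable g x.
Proof.
move=> fg df.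
suff : is_diff x g ('d f x) by case.
apply: is_diff_near_le; first exact: diff_continuous.
move=> e e0; near=> h; rewrite -(nbhs_singleton fg).
have <- : f (h + x) = g (h + x) by near: h; exact: (near0_shift (P := fun y => f y = g y)).
near: h; exact: diff_near_le.
Unshelve. all: by end_near. Qed.

Lemma derive_comp U V W (f : U -> V) (g : V -> W) (x w : U) :
  differentiable f x -> differentiable g (f x) ->
  'D_w (g \o f) x = 'D_('D_w f x) g (f x).
Proof.
move=> df dg; rewrite !deriveE//; first by rewrite diff_comp.
exact: differentiable_comp.
Qed.

Lemma linear_diffE V W (L : {linear V -> W}) (x w : V) :
  continuous L -> differentiable L x /\ 'D_w L x = L w.
Proof.
move=> cL; have dL : differentiable L x by exact: linear_differentiable.
by split=> //; rewrite deriveE// diff_lin.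
Qed.

Lemma derive_lin V W W' (L : {linear W -> W'}) (f : V -> W) (x w : V) :
  continuous L -> differentiable f x -> 'D_w (L \o f) x = L ('D_w f x).
Proof.
move=> cL df; have [dL _] := linear_diffE (f x) 0 cL.
by rewrite derive_comp//; have [] := linear_diffE (f x) ('D_w f x) cL.
Qed.

Lemma derive_sum_basis (I : finType) V W (f : V -> W) (x : V)
    (c : I -> R) (e : I -> V) : differentiable f x ->
  'D_(\sum_i c i *: e i) f x = \sum_i c i *: 'D_(e i) f x.
Proof.
move=> df; rewrite deriveE// linear_sum; apply: eq_bigr => i _.
by rewrite linearZ deriveE.
Qed.

End Differentials.

Section Ck_algebra.
Context {R : realType}.
Implicit Types U V W : normedModType R.

Lemma Ck_ext n V W (E : set V) (f g : V -> W) : open E ->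
  (forall x, E x -> f x = g x) -> Ck n E f -> Ck n E g.
Proof.
move=> oE; elim: n f g => [|n IH] f g fg /=.
  move=> fc x Ex; have fgx : \near x, f x = g x.
    by near=> y; apply: fg; near: y; exact: open_nbhs_nbhs.
  rewrite /prop_for /continuous_at -(fg _ Ex).
  by apply: cvg_trans (fc _ Ex); exact: near_eq_cvg.
move=> [df dfk]; have fgx x : E x -> \near x, f x = g x.
  by move=> Ex; near=> y; apply: fg; near: y; exact: open_nbhs_nbhs.
split=> [x Ex|w]; first exact: near_eq_differentiable (fgx x Ex) (df x Ex).
by apply: IH (dfk w) => x Ex; exact: near_eq_derive (fgx x Ex).
Unshelve. all: by end_near. Qed.

Lemma Ck_continuous n V W (E : set V) (f : V -> W) x :
  Ck n E f -> E x -> {for x, continuous f}.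
Proof.
by case: n => [|n] /= fE Ex; [exact: fE|exact: differentiable_continuous (fE.1 _ Ex)].
Qed.

Lemma CkW n V W (E : set V) (f : V -> W) : Ck n.+1 E f -> Ck n E f.
Proof.
elim: n f => [|n IH] f; first by move=> fE x; exact: Ck_continuous fE.
by move=> [df fE]; split=> // w; exact: IH.
Qed.

Lemma Ck_sub n V W (E F : set V) (f : V -> W) : E `<=` F ->
  Ck n F f -> Ck n E f.
Proof.
move=> EF; elim: n f => [|n IH] f /=; first by move=> fF x /EF; exact: fF.
by move=> [df fF]; split=> [x /EF|w]; [exact: df|exact: IH].
Qed.

Lemma Ck_cst n V W (E : set V) (c : W) : Ck n E (cst c : V -> W).
Proof.
elim: n c => [|n IH] c /=; first by move=> x _; exact: cst_continuous.
split=> [x _|w]; first exact: differentiable_cst.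
have -> : (fun x => 'D_w (cst c : V -> W) x) = cst 0.
  by apply/funext => x; rewrite derive_cst.
exact: IH.
Qed.

Lemma Ck_lin n V W (E : set V) (L : {linear V -> W}) : continuous L -> Ck n E L.
Proof.
move=> cL; case: n => [|n] /=; first by move=> x _; exact: cL.
split=> [x _|w]; first exact: linear_differentiable.
have -> : (fun x => 'D_w L x) = cst (L w).
  by apply/funext => x; exact: (linear_diffE x w cL).2.
exact: Ck_cst.
Qed.

Lemma Ck_linl n V W W' (E : set V) (L : {linear W -> W'}) (f : V -> W) :
  open E -> continuous L -> Ck n E f -> Ck n E (L \o f).
Proof.
move=> oE cL; elim: n f => [|n IH] f /=.
  by move=> fE x Ex; apply: continuous_comp; [exact: fE|exact: cL].
move=> [df fE]; split=> [x Ex|w].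
  by apply: differentiable_comp (df x Ex) _; exact: linear_differentiable.
apply: (@Ck_ext n _ _ E (L \o 'D_w f)) => // [x Ex|]; last exact: IH.
by rewrite derive_lin//; exact: df.
Qed.

Lemma CkD n V W (E : set V) (f g : V -> W) : open E ->
  Ck n E f -> Ck n E g -> Ck n E (fun x => f x + g x).
Proof.
move=> oE; elim: n f g => [|n IH] f g /=.
  by move=> fE gE x Ex; apply: cvgD; [exact: fE|exact: gE].
move=> [df fE] [dg gE]; split=> [x Ex|w].
  by apply: differentiableD; [exact: df|exact: dg].
apply: (@Ck_ext n _ _ E (fun x => 'D_w f x + 'D_w g x)) => // [x Ex|]; last exact: IH.
by rewrite -deriveD//; [exact/diff_derivable/df|exact/diff_derivable/dg].
Qed.

Lemma Ck_sum n V W (E : set V) (I : Type) (r : seq I) (f : I -> V -> W) :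
  open E -> (forall i, Ck n E (f i)) -> Ck n E (fun x => \sum_(i <- r) f i x).
Proof.
move=> oE fE; elim: r => [|i r IH].
  by apply: (@Ck_ext n _ _ E (cst 0)) => // [x _|]; [rewrite big_nil|exact: Ck_cst].
apply: (@Ck_ext n _ _ E (fun x => f i x + \sum_(j <- r) f j x)) => // [x _|].
  by rewrite big_cons.
exact: CkD.
Qed.

Lemma CkM n V (E : set V) (f g : V -> R) : open E ->
  Ck n E f -> Ck n E g -> Ck n E (fun x => f x * g x).
Proof.
move=> oE; elim: n f g => [|n IH] f g.
  by move=> fE gE x Ex; apply: cvgM; [exact: fE|exact: gE].
(* The product rule keeps one factor undifferentiated, so the induction hypothesis is also applied
   to [f] and [g] at the lower order. *)
move=> fE1 gE1; have [fE0 gE0] := (CkW fE1, CkW gE1).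
case: fE1 gE1 => df fE [dg gE].
split=> [x Ex|w]; first by apply: differentiableM; [exact: df|exact: dg].
apply: (@Ck_ext n _ _ E (fun x => f x * 'D_w g x + g x * 'D_w f x)) => // [x Ex|].
  by rewrite [RHS]deriveM//; [exact/diff_derivable/df|exact/diff_derivable/dg].
exact: CkD oE (IH _ _ fE0 (gE w)) (IH _ _ gE0 (fE w)).
Qed.

Lemma Ck_prod n V (E : set V) (I : Type) (r : seq I) (f : I -> V -> R) :
  open E -> (forall i, Ck n E (f i)) -> Ck n E (fun x => \prod_(i <- r) f i x).
Proof.
move=> oE fE; elim: r => [|i r IH].
  by apply: (@Ck_ext n _ _ E (fun=> 1 : R)) => // [x _|]; [rewrite big_nil|exact: Ck_cst].
apply: (@Ck_ext n _ _ E (fun x => f i x * \prod_(j <- r) f j x)) => // [x _|].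
  by rewrite big_cons.
exact: CkM.
Qed.

Lemma CkN n V (E : set V) (f : V -> R) : open E ->
  Ck n E f -> Ck n E (fun x => - f x).
Proof.
move=> oE fE; apply: (@Ck_ext n _ _ E (fun x => (-1) * f x)) => // [x _|].
  by rewrite mulN1r.
by apply: CkM => //; exact: Ck_cst.
Qed.

Lemma CkV n V (E : set V) (f : V -> R) : open E ->
  (forall x, E x -> f x != 0) -> Ck n E f -> Ck n E (fun x => (f x)^-1).
Proof.
move=> oE f0; elim: n => [|n IH].
  by move=> fE x Ex; apply: cvgV; [exact: f0|exact: fE].
move=> fE1; have fE0 := CkW fE1; case: fE1 => df fE.
split=> [x Ex|w]; first by apply: differentiableV; [exact: df|exact: f0].
apply: (@Ck_ext n _ _ E (fun x => - ((f x)^-1 * (f x)^-1 * 'D_w f x))) => // [x Ex|].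
  rewrite [RHS]deriveV; [|exact: f0|by apply: diff_derivable; exact: df].
  by rewrite expr2 invfM scaleNr.
exact: (CkN oE (CkM oE (CkM oE (IH fE0) (IH fE0)) (fE w))).
Qed.

(** In the chain rule the direction ['D_w f x] varies with [x], whereas [Ck] speaks of fixed
    directions. Expanding it in a finite basis [e] with continuous coordinates [c] gives a sum of
    products to which induction applies. *)
Lemma Ck_comp_basis n (I : finType) U V (E : set U) (F : set V)
    (c : I -> {linear V -> R}) (e : I -> V) (f : U -> V) (g : V -> R) :
  open E -> (forall i, continuous (c i)) ->
  (forall y, y = \sum_i c i y *: e i) ->
  (forall x, E x -> F (f x)) ->
  Ck n E f -> Ck n F g -> Ck n E (g \o f).
Proof.
move=> oE cc cE EF; elim: n g => [|n IH] g.
  by move=> fE gF x Ex; apply: continuous_comp; [exact: fE|exact/gF/EF].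
move=> fE1 gF1; have [fE0 gF0] := (CkW fE1, CkW gF1).
case: fE1 gF1 => df fE [dg gF].
split=> [x Ex|w].
  by apply: differentiable_comp; [exact: df|exact/dg/EF].
apply: (@Ck_ext n _ _ E
   (fun x => \sum_i c i ('D_w f x) * 'D_(e i) g (f x))) => // [x Ex|].
  rewrite [RHS]derive_comp//; [|exact: df|exact/dg/EF].
  by rewrite [in RHS](cE ('D_w f x)) derive_sum_basis//; exact/dg/EF.
apply: Ck_sum => // i; apply: (CkM oE _ (IH _ fE0 (gF _))).
exact: (Ck_linl (L := c i) oE (cc i) (fE w)).
Qed.

End Ck_algebra.

Section Ck_matrix.
Context {R : realType}.
Implicit Types U V W : normedModType R.

Definition coordf m n (i : 'I_m) (j : 'I_n) (A : 'M[R]_(m, n)) : R := A i j.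

Lemma coordf_linear m n i j : linear (@coordf m n i j).
Proof. by move=> a A B; rewrite /coordf !mxE. Qed.
HB.instance Definition _ m n i j :=
  GRing.isLinear.Build R 'M[R]_(m, n) R *%R (@coordf m n i j) (@coordf_linear m n i j).

Lemma coordf_continuous m n i j : continuous (@coordf m n i j).
Proof. exact: coord_continuous. Qed.

Definition scale_at W (w : W) (a : R) : W := a *: w.
Lemma scale_at_linear W (w : W) : linear (scale_at w).
Proof. by move=> a b c; rewrite /scale_at scalerDl scalerA. Qed.
HB.instance Definition _ W (w : W) :=
  GRing.isLinear.Build R R W *:%R (scale_at w) (scale_at_linear w).
Lemma scale_at_continuous W (w : W) : continuous (scale_at w).
Proof. exact: scalel_continuous. Qed.

Lemma mx_sum_coordf m n (A : 'M[R]_(m, n)) :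
  A = \sum_(ij : 'I_m * 'I_n) coordf ij.1 ij.2 A *: delta_mx ij.1 ij.2.
Proof.
by rewrite [LHS]matrix_sum_delta [LHS]pair_big.
Qed.

Lemma Ck_coord k m n V (E : set V) (f : V -> 'M[R]_(m, n)) i j : open E ->
  Ck k E f -> Ck k E (fun x => f x i j).
Proof. by move=> oE fE; exact: (Ck_linl (L := @coordf m n i j) oE (@coordf_continuous _ _ _ _)). Qed.

Lemma Ck_mx k m n V (E : set V) (f : V -> 'M[R]_(m, n)) : open E ->
  (forall i j, Ck k E (fun x => f x i j)) -> Ck k E f.
Proof.
move=> oE fE; apply: (@Ck_ext _ k _ _ E (fun x => \sum_(ij : 'I_m * 'I_n)
   scale_at (delta_mx ij.1 ij.2) (f x ij.1 ij.2))) => // [x _|].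
  by rewrite [RHS]mx_sum_coordf.
apply: Ck_sum => // ij; apply: (Ck_linl (L := @scale_at _ _)) => //.
exact: scale_at_continuous.
Qed.

Lemma Ck_comp_mx k m n U (E : set U) (F : set 'M[R]_(m, n)) (f : U -> 'M[R]_(m, n))
    (g : 'M[R]_(m, n) -> R) : open E ->
  (forall x, E x -> F (f x)) -> Ck k E f -> Ck k F g -> Ck k E (g \o f).
Proof.
move=> oE; apply: (@Ck_comp_basis _ k _ _ _ E F (fun ij => @coordf m n ij.1 ij.2)) => //.
- by move=> ij; exact: coordf_continuous.
- exact: mx_sum_coordf.
Qed.

Lemma Ck_comp_real k U (E : set U) (F : set R) (f : U -> R) (g : R -> R) : open E ->
  (forall x, E x -> F (f x)) -> Ck k E f -> Ck k F g -> Ck k E (g \o f).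
Proof.
move=> oE; apply: (@Ck_comp_basis _ k unit _ _ E F (fun=> idfun) (fun=> 1)) => //.
  by move=> _ x; exact: cvg_id.
by move=> y; rewrite big_const card_unit /= addr0 /GRing.scale /= mulr1.
Qed.

Lemma Ck_comp_mxmx k m n m' n' U (E : set U) (F : set 'M[R]_(m, n))
    (f : U -> 'M[R]_(m, n)) (g : 'M[R]_(m, n) -> 'M[R]_(m', n')) : open E ->
  (forall x, E x -> F (f x)) -> open F -> Ck k E f -> Ck k F g -> Ck k E (g \o f).
Proof.
move=> oE EF oF fE gF; apply: Ck_mx => // i j.
by apply: (@Ck_comp_mx _ _ _ _ E F f (fun x => g x i j)) => //; exact: Ck_coord.
Qed.

Lemma Ck_det k n V (E : set V) (f : V -> 'M[R]_n) : open E ->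
  (forall i j, Ck k E (fun x => f x i j)) -> Ck k E (fun x => \det (f x)).
Proof.
move=> oE fE; rewrite /determinant; apply: Ck_sum => // s.
apply: (CkM oE); first exact: Ck_cst.
by apply: Ck_prod => // i.
Qed.

(** Cramer's formula: the entries are cofactors, polynomial in the entries of [f x], divided by the
    determinant. *)
Lemma Ck_invmx k n V (E : set V) (f : V -> 'M[R]_n) : open E ->
  (forall x, E x -> f x \in unitmx) ->
  (forall i j, Ck k E (fun x => f x i j)) ->
  forall i j, Ck k E (fun x => invmx (f x) i j).
Proof.
move=> oE fU fE i j.
apply: (@Ck_ext _ k _ _ E (fun x => (\det (f x))^-1 * \adj (f x) i j)) => // [x Ex|].
  by rewrite /invmx fU// [RHS]mxE.
apply: (CkM oE).
  apply: (CkV oE); first by move=> x /fU; rewrite unitmxE unitfE.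
  exact: Ck_det.
apply: (@Ck_ext _ k _ _ E (fun x => cofactor (f x) j i)) => // [x _|].
  by rewrite mxE.
rewrite /cofactor; apply: (CkM oE); first exact: Ck_cst.
apply: Ck_det => // a b.
apply: (@Ck_ext _ k _ _ E (fun x => f x (lift j a) (lift i b))) => // x _.
by rewrite !mxE.
Qed.

End Ck_matrix.

(** * Mean value theorem and symmetry of second derivatives *)

Section Mean_value.
Context {R : realType}.
Implicit Types V : normedModType R.

Lemma ball_segment V (x0 : V) (r s : R) (x h : V) : s \in `[0, 1] ->
  ball x0 r x -> ball x0 r (h + x) -> ball x0 r (s *: h + x).
Proof.
rewrite in_itv /= => /andP[s0 s1]; rewrite -ball_normE /= => bx by_.
have -> : x0 - (s *: h + x) = (1 - s) *: (x0 - x) + s *: (x0 - (h + x)).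
  have E (y : V) : x0 - (y + x) = (x0 - x) - y by rewrite opprD addrCA addrC.
  by rewrite !E scalerBl scale1r [X in _ = _ + X]scalerBr addrA subrK.
apply: le_lt_trans (ler_normD _ _) _; rewrite !normrZ ger0_norm ?subr_ge0// (ger0_norm s0).
(* For [s = 0] the second term disappears; otherwise it is the one that makes the inequality
   strict. *)
have [->|sn0] := eqVneq s 0; first by rewrite subr0 mul1r mul0r addr0.
rewrite (_ : r = (1 - s) * r + s * r); last by rewrite -mulrDl subrK mul1r.
by rewrite ler_ltD ?ler_wpM2l ?subr_ge0 ?(ltW bx)// ltr_pM2l// lt_def sn0.
Qed.

Lemma MVT_direction V (f : V -> R) (x h : V) :
  (forall s : R, s \in `[0, 1] -> differentiable f (s *: h + x)) ->
  exists2 s : R, s \in `[0, 1] & f (h + x) - f x = 'D_h f (s *: h + x).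
Proof.
move=> df; pose p (s : R) := s *: h + x.
have dp s : differentiable p s /\ 'D_1 p s = h.
  have [ds Ds] := linear_diffE s 1 (@scale_at_continuous R V h).
  split; first by apply: differentiableD.
  rewrite [LHS](deriveD (f := scale_at h) (g := cst x)).
  - by rewrite Ds derive_cst addr0; exact: scale1r.
  - exact: diff_derivable.
  - exact: derivable_cst.
have dfp (s : R) : s \in `[0, 1] -> is_derive s 1 (f \o p) ('D_h f (p s)).
  move=> s01; have [dps Dps] := dp s.
  split.
    by apply: diff_derivable; apply: differentiable_comp => //; exact: df.
  by rewrite derive_comp ?Dps//; exact: df.
have cfp : {within `[0, 1], continuous (f \o p)}.
  apply: derivable_within_continuous => s s01.
  by case: (dfp s s01).
have dfp' (s : R) : s \in `]0, 1[ -> is_derive s 1 (f \o p) ('D_h f (p s)).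
  by move=> s01; apply: dfp; exact: subset_itv_oo_cc s01.
have [s s01 fE] := MVT_segment ler01 dfp' cfp.
exists s => //; rewrite -[RHS]mulr1 -[X in _ * X]subr0 -fE.
by rewrite /p /= scale1r scale0r add0r.
Qed.

Lemma derive_eq0_ball V (f : V -> R) (x0 : V) (r : R) (h x : V) :
  (forall y, ball x0 r y -> differentiable f y /\ 'D_h f y = 0) ->
  ball x0 r x -> ball x0 r (h + x) -> f (h + x) = f x.
Proof.
move=> df bx bhx; have [s s01|s s01] := @MVT_direction _ f x h.
  by apply: (df _ _).1; exact: ball_segment.
by rewrite (df _ _).2; [move/eqP; rewrite subr_eq0 => /eqP|exact: ball_segment].
Qed.

(** The mean value theorem twice: for [g y = f (b + y) - f y] in direction [a], then for ['D_a f] in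
    direction [b]. The left-hand side is symmetric in [a] and [b], whence the symmetry of second
    derivatives. *)
Lemma double_difference V (f : V -> R) (E : set V) (x a b : V) : open E ->
  (forall s t : R, s \in `[0, 1] -> t \in `[0, 1] -> E (t *: b + (s *: a + x))) ->
  Ck 2 E f -> exists s t : R, [/\ s \in `[0, 1], t \in `[0, 1] &
    f (b + (a + x)) - f (a + x) - (f (b + x) - f x) =
    'D_b ('D_a f) (t *: b + (s *: a + x))].
Proof.
move=> oE abE [df fE].
have I0 : (0 : R) \in `[0, 1] by rewrite in_itv /= lexx ler01.
have I1 : (1 : R) \in `[0, 1] by rewrite in_itv /= lexx ler01.
pose g y := f (b + y) - f y.
have E0 (s : R) : s \in `[0, 1] -> E (s *: a + x).
  by move=> s01; have := abE s 0 s01 I0; rewrite scale0r add0r.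
have E1 (s : R) : s \in `[0, 1] -> E (b + (s *: a + x)).
  by move=> s01; have := abE s 1 s01 I1; rewrite scale1r.
pose sh y := b + y.
have dsh (y w : V) : differentiable sh y /\ 'D_w sh y = w.
  have di : derivable (@id V) y w by exact: derivable_id.
  split; first by apply: differentiableD.
  rewrite [LHS](deriveD (f := cst b) (g := id)) //.
  by rewrite derive_cst add0r derive_id.
have dg y : E y -> E (b + y) -> differentiable g y /\ 'D_a g y = 'D_a f (b + y) - 'D_a f y.
  move=> Ey Eby; have [dshy sha] := dsh y a.
  have dfs : differentiable (f \o sh) y by apply: differentiable_comp => //; exact: df.
  split; first by apply: differentiableB => //; exact: df.
  rewrite [LHS](@deriveB _ _ _ (f \o sh) f); first by rewrite derive_comp ?sha//; exact: df.
    exact: diff_derivable.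
  by apply: diff_derivable; exact: df.
have [s s01|s s01] := @MVT_direction _ g x a.
  by apply: (dg _ _ _).1; [exact: E0|exact: E1].
rewrite /g => ->; rewrite (dg _ _ _).2; [|exact: E0|exact: E1].
have [t t01|t t01 ->] := @MVT_direction _ ('D_a f) (s *: a + x) b.
  by apply: (fE a).1; exact: abE.
by exists s, t.
Qed.

End Mean_value.

Section Real_derivatives.
Context {R : realType}.

Lemma is_derive_cstR (k t : R) : is_derive t 1 (fun=> k) 0.
Proof. exact: is_derive_cst. Qed.

Lemma is_derive_idR (t : R) : is_derive t 1 (fun s => s) 1.
Proof. exact: is_derive_id. Qed.

Lemma is_derive_prod (f g : R -> R) (t f' g' : R) : is_derive t 1 f f' -> is_derive t 1 g g' ->
  is_derive t 1 (fun s => f s * g s) (f t * g' + g t * f').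
Proof. by move=> df dg; exact: is_deriveM. Qed.

Lemma is_derive_sub (f g : R -> R) (t f' g' : R) : is_derive t 1 f f' -> is_derive t 1 g g' ->
  is_derive t 1 (fun s => f s - g s) (f' - g').
Proof. by move=> df dg; exact: is_deriveB. Qed.

Lemma is_derive_add (f g : R -> R) (t f' g' : R) : is_derive t 1 f f' -> is_derive t 1 g g' ->
  is_derive t 1 (fun s => f s + g s) (f' + g').
Proof. by move=> df dg; exact: is_deriveD. Qed.

Lemma is_derive_scal (f : R -> R) (t k f' : R) : is_derive t 1 f f' ->
  is_derive t 1 (fun s => k * f s) (k * f').
Proof. by move=> df; exact: (is_deriveZ k df). Qed.

End Real_derivatives.

Section Schwarz.
Context {R : realType}.
Implicit Types V : normedModType R.

Lemma deriveZdir V (f : V -> R) (y a : V) (c : R) : differentiable f y ->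
  'D_(c *: a) f y = c * 'D_a f y.
Proof. by move=> df; rewrite !deriveE// linearZ. Qed.

Lemma derive2Z V (f : V -> R) (E : set V) (a b : V) (c : R) y : open E -> Ck 2 E f -> E y ->
  'D_(c *: b) ('D_(c *: a) f) y = c * (c * 'D_b ('D_a f) y).
Proof.
move=> oE [df fE] Ey; rewrite deriveZdir; last exact: (fE _).1.
have -> : 'D_b ('D_(c *: a) f) y = 'D_b (fun y => c * 'D_a f y) y.
  apply: near_eq_derive; near=> z; rewrite deriveZdir//; apply: df.
  by near: z; exact: open_nbhs_nbhs.
by rewrite (@deriveZ _ _ _ ('D_a f))//; apply: diff_derivable; exact: (fE a).1.
Unshelve. all: by end_near. Qed.

(** Both mixed derivatives, each at some point of a small parallelogram spanned by [c *: a] and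
    [c *: b], equal the same second difference divided by [c ^+ 2]; continuity brings each within
    [e / 2] of its value at [x]. *)
Lemma derive_swap V (f : V -> R) (E : set V) (x a b : V) : open E -> E x ->
  Ck 2 E f -> 'D_b ('D_a f) x = 'D_a ('D_b f) x.
Proof.
move=> oE Ex fE; apply/eqP; rewrite -subr_eq0 -normr_le0.
apply/ler_addgt0Pr => e e0; rewrite add0r.
have e2 : 0 < e / 2 by rewrite divr_gt0.
have cF u w : {for x, continuous ('D_w ('D_u f))}.
  by have [_ /(_ u) [_ /(_ w) /(_ _ Ex)]] := fE.
have N0 : nbhs x E by exact: open_nbhs_nbhs.
have N1 : \forall y \near x, `|'D_b ('D_a f) x - 'D_b ('D_a f) y| < e / 2.
  by move: (cF a b) => /cvgrPdist_lt; apply.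
have N2 : \forall y \near x, `|'D_a ('D_b f) x - 'D_a ('D_b f) y| < e / 2.
  by move: (cF b a) => /cvgrPdist_lt; apply.
have [d /= d0 bd] := (nbhs_ballP x _).1 (filterI N0 (filterI N1 N2)).
have n0 : 0 < `|a| + `|b| + 1 by rewrite ltr_wpDl// addr_ge0.
(* The summand [1] keeps the denominator positive when [a = b = 0]. *)
have [c c0 cd] : exists2 c : R, 0 < c & c * (`|a| + `|b|) < d.
  exists (d / (`|a| + `|b| + 1)); first by rewrite divr_gt0.
  by rewrite mulrAC ltr_pdivrMr// ltr_pM2l// ltrDl.
have inb (s t : R) (u w : V) : s \in `[0, 1] -> t \in `[0, 1] -> `|u| + `|w| <= `|a| + `|b| ->
    ball x d (t *: (c *: w) + (s *: (c *: u) + x)).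
  rewrite !in_itv /= => /andP[s0 s1] /andP[t0 t1] uw; rewrite -ball_normE /=.
  rewrite addrA opprD addrCA subrr addr0 normrN.
  apply: le_lt_trans (ler_normD _ _) _; rewrite !normrZ (ger0_norm s0) (ger0_norm t0) (gtr0_norm c0).
  have /le_lt_trans -> // : t * (c * `|w|) + s * (c * `|u|) <= c * (`|u| + `|w|).
    rewrite mulrDr addrC lerD// -[leRHS]mul1r ler_wpM2r// mulr_ge0// ltW//.
  exact: le_lt_trans (ler_wpM2l (ltW c0) uw) cd.
have [s1 [t1 [Hs1 Ht1]]] := @double_difference _ _ f E x (c *: a) (c *: b) oE
  (fun s t Hs Ht => (bd _ (inb s t a b Hs Ht (lexx _))).1) fE.
have ba : `|b| + `|a| <= `|a| + `|b| by rewrite addrC.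
have [s2 [t2 [Hs2 Ht2]]] := @double_difference _ _ f E x (c *: b) (c *: a) oE
  (fun s t Hs Ht => (bd _ (inb s t b a Hs Ht ba)).1) fE.
have [E1 [F1 _]] := bd _ (inb s1 t1 a b Hs1 Ht1 (lexx _)).
have [E2 [_ G2]] := bd _ (inb s2 t2 b a Hs2 Ht2 ba).
move=> D2 D1; rewrite (derive2Z a b c oE fE E1) in D1; rewrite (derive2Z b a c oE fE E2) in D2.
have DD : f (c *: b + (c *: a + x)) - f (c *: a + x) - (f (c *: b + x) - f x) =
   f (c *: a + (c *: b + x)) - f (c *: b + x) - (f (c *: a + x) - f x).
  by rewrite (addrCA (c *: b)); ring.
move: DD; rewrite D1 D2 => /(mulfI (lt0r_neq0 c0)) /(mulfI (lt0r_neq0 c0)) FG.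
rewrite distrC -FG in G2.
apply/ltW/(le_lt_trans (ler_distD ('D_b ('D_a f) (t1 *: (c *: b) + (s1 *: (c *: a) + x))) _ _)).
by rewrite (splitr e); exact: ltrD F1 G2.
Qed.

End Schwarz.

(** * Jacobian matrices and linear maps in finite dimension *)

Section Jacobian.
Context {R : realType}.
Implicit Types V : normedModType R.

Lemma le_mx_norm m n (M : 'M[R]_(m, n)) i j : `|M i j| <= `|M|.
Proof.
rewrite [leRHS]/Num.Def.normr /= mx_normrE.
exact: (le_bigmax _ (fun ij => `|M ij.1 ij.2|) (i, j)).
Qed.

Lemma mx_norm_le m n (M : 'M[R]_(m, n)) c : 0 <= c ->
  (forall i j, `|M i j| <= c) -> `|M| <= c.
Proof.
move=> c0 Mc; rewrite [leLHS]/Num.Def.normr /= mx_normrE.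
by apply: bigmax_le => // -[i j] _; exact: Mc.
Qed.

(* At [m = 2] this is convertible to [jacmx]. *)
Definition jac m n (f : 'cV[R]_m -> 'cV[R]_n) (x : 'cV[R]_m) : 'M[R]_(n, m) :=
  \matrix_(i, j) 'D_(delta_mx j 0) (fun y => f y i 0) x.

Lemma cV_sum_delta m (w : 'cV[R]_m) : w = \sum_j w j 0 *: delta_mx j 0.
Proof.
rewrite [LHS]matrix_sum_delta; apply: eq_bigr => i _.
by rewrite big_ord1.
Qed.

Lemma derive_cV m (f : 'cV[R]_m -> R) (x w : 'cV[R]_m) : differentiable f x ->
  'D_w f x = \sum_j w j 0 * 'D_(delta_mx j 0) f x.
Proof. by move=> df; rewrite [in LHS](cV_sum_delta w) derive_sum_basis. Qed.

Lemma differentiable_entry m n V (f : V -> 'M[R]_(m, n)) (x : V) i j :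
  differentiable f x -> differentiable (fun y => f y i j) x.
Proof.
move=> df; apply: (differentiable_comp (g := @coordf R m n i j) df).
exact: (linear_diffE (f x) 0 (@coordf_continuous R m n i j)).1.
Qed.

Lemma derive_entry m n V (f : V -> 'M[R]_(m, n)) (x w : V) i j :
  differentiable f x -> ('D_w f x) i j = 'D_w (fun y => f y i j) x.
Proof.
by move=> df; rewrite derive_mx ?mxE//; exact: diff_derivable.
Qed.

Lemma derive_jac m n (f : 'cV[R]_m -> 'cV[R]_n) (x w : 'cV[R]_m) :
  differentiable f x -> 'D_w f x = jac f x *m w.
Proof.
move=> df; apply/colP => i; rewrite derive_entry// derive_cV; last exact: differentiable_entry.
by rewrite mxE; apply: eq_bigr => j _; rewrite mxE mulrC.
Qed.

Definition mulmxf m n p (M : 'M[R]_(m, n)) (A : 'M[R]_(n, p)) := M *m A.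
Lemma mulmxf_linear m n p (M : 'M[R]_(m, n)) : linear (@mulmxf m n p M).
Proof. by move=> a A B; rewrite /mulmxf mulmxDr scalemxAr. Qed.
HB.instance Definition _ m n p (M : 'M[R]_(m, n)) :=
  GRing.isLinear.Build R 'M[R]_(n, p) 'M[R]_(m, p) *:%R (@mulmxf m n p M) (@mulmxf_linear m n p M).

Lemma linear_mx_lipschitz m n (W : normedModType R) (L : {linear 'M[R]_(m, n) -> W}) :
  exists2 c, 0 < c & forall A, `|L A| <= c * `|A|.
Proof.
(* The summand [1] makes the constant positive even for [L = 0]. *)
exists (\sum_(ij : 'I_m * 'I_n) `|L (delta_mx ij.1 ij.2)| + 1).
  by rewrite ltr_wpDl// sumr_ge0.
move=> A; rewrite [in leLHS](mx_sum_coordf A) linear_sum.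
apply: le_trans (ler_norm_sum _ _ _) _.
rewrite mulrDl mul1r mulr_suml ler_wpDr//; apply: ler_sum => ij _.
by rewrite linearZ normrZ mulrC ler_wpM2l// le_mx_norm.
Qed.

Lemma linear_mx_continuous m n (W : normedModType R) (L : {linear 'M[R]_(m, n) -> W}) :
  continuous L.
Proof.
have [c c0 Lc] := linear_mx_lipschitz L.
apply/bounded_linear_continuous/linear_boundedP => /=.
exists c; split; first exact: gtr0_real.
by move=> y cy A; apply: le_trans (Lc A) _; rewrite ler_wpM2r// ltW.
Qed.

Lemma mulmxf_lipschitz m n p (M : 'M[R]_(m, n)) :
  exists2 c, 0 < c & forall A : 'M[R]_(n, p), `|M *m A| <= c * `|A|.
Proof. exact: (linear_mx_lipschitz (@mulmxf m n p M)). Qed.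

Lemma mulmxf_continuous m n p (M : 'M[R]_(m, n)) : continuous (@mulmxf m n p M).
Proof. exact: linear_mx_continuous. Qed.

End Jacobian.

(** * Inverse function theorem *)

Section Inverse.
Context {R : realType}.

Lemma jac_mulmxf n m p (M : 'M[R]_(p, m)) (f : 'cV[R]_n -> 'cV[R]_m) x :
  differentiable f x -> jac (fun y => M *m f y) x = M *m jac f x.
Proof.
move=> df; apply/matrixP => i j; rewrite mxE.
have dM : differentiable (mulmxf M \o f) x.
  apply: differentiable_comp => //.
  exact: (linear_diffE (f x) 0 (@mulmxf_continuous R _ _ _ M)).1.
rewrite -(@derive_entry R _ _ _ (mulmxf M \o f))//.
rewrite derive_lin//; last exact: mulmxf_continuous.
rewrite /= derive_jac// /mulmxf mulmxA.
by rewrite -colE mxE.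
Qed.

(** Mean value estimate for [g - id], whose Jacobian vanishes at [x0] and is small nearby. *)
Lemma strict_derivative n (E : set 'cV[R]_n) (g : 'cV[R]_n -> 'cV[R]_n) x0 :
  open E -> E x0 -> Ck 1 E g -> jac g x0 = 1%:M ->
  exists r : R, [/\ 0 < r, ball x0 r `<=` E &
    forall x y, ball x0 r x -> ball x0 r y ->
      `|g x - g y - (x - y)| <= 2^-1 * `|x - y|].
Proof.
move=> oE Ex gE J1.
(* In the maximum norm, [n] summands bounded by [d] add up to at most [1/2]; the denominator [n.+1]
   also covers [n = 0]. *)
pose d : R := 2^-1 / n.+1%:R.
have d0 : 0 < d by rewrite divr_gt0 ?invr_gt0.
have N0 : nbhs x0 E by exact: open_nbhs_nbhs.
have N1' i j : \forall x \near x0, `|jac g x0 i j - jac g x i j| < d.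
  have gij : Ck 1 E (fun x => g x i 0) by exact: Ck_coord.
  have := gij.2 (delta_mx j 0) _ Ex; rewrite /prop_for /continuous_at.
  move=> /cvgrPdist_lt /(_ d d0); apply: filterS => x.
  by rewrite !mxE.
have N1 : \forall x \near x0, forall i j, `|jac g x0 i j - jac g x i j| < d.
  by apply: (filter_forall _ (fun i => filter_forall _ (N1' i))).
have [r /= r0 br] := (nbhs_ballP x0 _).1 (filterI N0 N1).
exists r; split => // [x /br[]//|x y bx b_y].
apply: mx_norm_le => [|i j]; first by rewrite mulr_ge0.
rewrite ord1 {j}.
pose F z := g z i 0 - z i 0.
have dgi z : E z -> differentiable (fun x => g x i 0) z.
  by move=> Ez; apply: differentiable_entry; exact: gE.1.
have dci z : differentiable (@coordf R n 1 i 0) z.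
  exact: (linear_diffE z 0 (@coordf_continuous R n 1 i 0)).1.
have dF z : E z -> differentiable F z.
  by move=> Ez; apply: differentiableB; [exact: dgi|exact: dci].
have DF z w : E z -> 'D_w F z = ((jac g z - 1%:M) *m w) i 0.
  move=> Ez; rewrite [LHS](@deriveB _ _ _ (fun x => g x i 0) (@coordf R n 1 i 0)).
  - rewrite mulmxBl mul1mx mxE -derive_jac; last exact: gE.1.
    rewrite derive_entry; last exact: gE.1.
    by rewrite (linear_diffE z w (@coordf_continuous R n 1 i 0)).2 mxE.
  - exact/diff_derivable/dgi.
  - exact: diff_derivable.
have hy : x = (x - y) + y by rewrite subrK.
have bseg (s : R) : s \in `[0, 1] -> ball x0 r (s *: (x - y) + y).
  by move=> s01; apply: ball_segment => //; rewrite -hy.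
have [s s01|s s01] := @MVT_direction _ _ F y (x - y).
  by apply: dF; exact: (br _ (bseg s s01)).1.
rewrite -hy DF; last exact: (br _ (bseg s s01)).1.
set w := _ *: _ + _.
have -> : F x - F y = (g x - g y - (x - y)) i 0.
  by rewrite /F !mxE; ring.
move=> ->; rewrite mxE; apply: le_trans (ler_norm_sum _ _ _) _.
rewrite (@le_trans _ _ (\sum_(k < n) d * `|x - y|))//.
  apply: ler_sum => k _; rewrite normrM ler_pM// ?le_mx_norm//.
  by have := (br _ (bseg s s01)).2 i k; rewrite J1 distrC => /ltW; rewrite !mxE.
rewrite sumr_const card_ord -[leLHS]mulr_natl mulrA ler_wpM2r//.
rewrite /d mulrCA -[leRHS]mulr1 ler_wpM2l// ?invr_ge0//.
by rewrite ler_pdivrMr// mul1r ler_nat.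
Qed.

(** Banach's fixed point theorem for the simplified Newton map [T x = x - (g x - y)], a contraction
    of ratio [1/2] on the closed ball of radius [r / 2]. As [r / 4 + r / 4 = r / 2] with one strict
    inequality, its values, hence the fixed point, lie in the open ball. *)
Lemma onto_ball n (g : 'cV[R]_n -> 'cV[R]_n) x0 (r : R) y : 0 < r ->
  (forall x y, ball x0 r x -> ball x0 r y ->
      `|g x - g y - (x - y)| <= 2^-1 * `|x - y|) ->
  ball (g x0) (r / 4) y -> exists2 x, ball x0 (r / 2) x & g x = y.
Proof.
move=> r0 gr gy; rewrite -ball_normE /= in gy.
pose X : completeNormedModType R := HB.pack_for (completeNormedModType R) 'cV[R]_n.
pose B : set 'cV[R]_n := [set x | `|x0 - x| <= r / 2].
pose T x := x - (g x - y).
have Bb x : B x -> ball x0 r x.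
  rewrite /B /= -ball_normE /= => /le_lt_trans; apply.
  by rewrite ltr_pdivrMr// ltr_pMr// ltr1n.
have Bx0 : B x0 by rewrite /B /= subrr normr0 divr_ge0// ltW.
have Tc x x' : B x -> B x' -> `|T x - T x'| <= 2^-1 * `|x - x'|.
  move=> /Bb bx /Bb bx'; apply: le_trans (gr _ _ bx bx').
  rewrite -normrN (_ : - (T x - T x') = g x - g x' - (x - x'))//.
  by apply/matrixP => i j; rewrite /T !mxE; ring.
have Tx x : B x -> `|x0 - T x| < r / 2.
  move=> Bx; rewrite (_ : x0 - T x = (T x0 - T x) + (g x0 - y)); last first.
    by apply/matrixP => i j; rewrite /T !mxE; ring.
  rewrite (_ : r / 2 = r / 4 + r / 4); last by field.
  apply: le_lt_trans (ler_normD _ _) _; rewrite ler_ltD//.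
  apply: le_trans (Tc _ _ Bx0 Bx) _.
  by move: Bx; rewrite /B /= => Bx; rewrite (le_trans (ler_wpM2l _ Bx))//; lra.
have TB : set_fun B B T by move=> x Bx; exact/ltW/Tx.
have cl : closed B by exact: (@closed_closed_ball_ R 'cV[R]_n x0 (r / 2)).
have ctr : is_contraction (mkfun_fun TB).
  exists (2^-1)%:nng; split; first by rewrite /= invf_lt1// ltr1n.
  by move=> [x x'] [Bx Bx']; exact: Tc.
have B0 : B !=set0 by exists x0.
have [p Bp Tp] := @banach_fixed_point R X B (mkfun_fun TB) ctr cl B0.
have {}Tp : p = T p by exact: Tp.
exists p; first by rewrite -ball_normE /= Tp; exact: Tx.
by move: Tp; rewrite /T => /eqP; rewrite -subr_eq0 subKr subr_eq0 => /eqP.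
Qed.

End Inverse.

Section Inverse_function.
Context {R : realType}.

Lemma open_setI_preimage (T S : topologicalType) (E : set T) (A : set S) (F : T -> S) :
  open E -> (forall x, E x -> {for x, continuous F}) -> open A ->
  open (E `&` F @^-1` A).
Proof.
move=> oE cF oA; rewrite openE => x [Ex Ax]; apply: filterI.
  exact: open_nbhs_nbhs.
by apply: (cF x Ex); exact: open_nbhs_nbhs.
Qed.

(** With [u = g x - g y] and [w = x - y] this turns the bound of [strict_derivative] into
    injectivity with a Lipschitz inverse. *)
Lemma norm_le_half (V : normedModType R) (u w : V) :
  `|u - w| <= 2^-1 * `|w| -> `|w| <= 2 * `|u|.
Proof.
move=> uw; have : `|w| <= `|u| + `|u - w|.
  by rewrite -[X in `|X| <= _](subKr u w) ler_normB.
by lra.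
Qed.

(** With [eta = h (k + y) - h y], differentiability of [f] gives [k = J eta + o(eta)]. The Lipschitz
    bound turns the remainder into [o(k)], and multiplication by [invmx J] isolates [eta]. *)
Lemma inverse_differentiable n (f h : 'cV[R]_n -> 'cV[R]_n) (y : 'cV[R]_n) (c : R) :
  differentiable f (h y) -> jac f (h y) \in unitmx -> 0 < c ->
  (\forall z \near y, f (h z) = z) ->
  (\forall z \near y, `|h z - h y| <= c * `|z - y|) ->
  is_diff y h (mulmxf (invmx (jac f (h y)))).
Proof.
move=> df Ju c0 fh lip; set J := jac f (h y).
have [cM cM0 HM] := @mulmxf_lipschitz R n n 1 (invmx J).
apply: is_diff_near_le; first exact: mulmxf_continuous.
move=> e e0; have e'0 : 0 < e / (cM * c) by rewrite divr_gt0// mulr_gt0.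
have [d /= d0 fd] := (nbhs_ballP (0 : 'cV[R]_n) _).1 (diff_near_le df e'0).
have n1 := near0_shift fh; have n2 := near0_shift lip.
have fhy : f (h y) = y by exact: nbhs_singleton fh.
have n3 : \forall k \near (0 : 'cV[R]_n), `|k| < d / c.
  by apply: nbhs0_lt; rewrite divr_gt0.
near=> k.
have fk : f (h (k + y)) = k + y by near: k.
have lk : `|h (k + y) - h y| <= c * `|k|.
  have : `|h (k + y) - h y| <= c * `|k + y - y| by near: k.
  by rewrite addrK.
have kd : `|k| < d / c by near: k.
set eta := h (k + y) - h y.
have /fd : ball (0 : 'cV[R]_n) d eta.
  rewrite -ball_normE /= sub0r normrN (le_lt_trans lk)//.
  by rewrite mulrC -ltr_pdivlMr.
rewrite /= /eta subrK fk fhy addrK -/eta -deriveE// derive_jac// -/J => kJ.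
rewrite /mulmxf (_ : eta - invmx J *m k = - (invmx J *m (k - J *m eta))); last first.
  by rewrite mulmxBr mulKmx// opprB.
rewrite normrN (le_trans (HM _))//.
rewrite (le_trans (ler_wpM2l (ltW cM0) kJ))//.
rewrite (@le_trans _ _ (cM * (e / (cM * c) * (c * `|k|))))//.
  by apply: (ler_wpM2l (ltW cM0)); apply: (ler_wpM2l (ltW e'0)); exact: lk.
by rewrite le_eqVlt; apply/orP; left; apply/eqP; field; rewrite !lt0r_neq0.
Unshelve. all: by end_near. Qed.

Lemma Ck_le (V W : normedModType R) (E : set V) (f : V -> W) (j k : nat) :
  (j <= k)%N -> Ck k E f -> Ck j E f.
Proof.
move=> /subnKC <-; elim: (k - j)%N => [|m IH]; first by rewrite addn0.
by rewrite addnS => /CkW.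
Qed.

(** Multiplying by [invmx J] makes the Jacobian at [x0] the identity, which yields existence
    ([onto_ball]) and uniqueness ([finj]) of preimages. Smoothness of the inverse is bootstrapped
    from the formula for its derivative. *)
Theorem inverse_function n k (E : set 'cV[R]_n) (f : 'cV[R]_n -> 'cV[R]_n) x0 :
  open E -> E x0 -> Ck k.+1 E f -> jac f x0 \in unitmx ->
  exists (h : 'cV[R]_n -> 'cV[R]_n) (e0 : R), [/\ 0 < e0, h (f x0) = x0 &
    forall e, 0 < e -> e <= e0 ->
      [/\ forall y, ball (f x0) e y -> E (h y) /\ f (h y) = y,
          Ck k.+1 (ball (f x0) e) h & open (h @` ball (f x0) e)]].
Proof.
move=> oE Ex fE Ju; set J := jac f x0 in Ju.
have jacE i j : Ck k E (fun x => jac f x i j).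
  have fi : Ck k.+1 E (fun x => f x i 0) by exact: Ck_coord.
  apply: (@Ck_ext _ _ _ _ E ('D_(delta_mx j 0) (fun x => f x i 0))) => //.
    by move=> x _; rewrite mxE.
  exact: fi.2.
have dJ : Ck k E (fun x => \det (jac f x)) by exact: Ck_det.
(* On [E'] the Jacobian is invertible at every point, so that [h] is differentiable on a whole
   ball. *)
pose E' := E `&` (fun x => \det (jac f x)) @^-1` [set x | x != 0].
have oE' : open E'.
  apply: open_setI_preimage; [by []| |exact: open_neq].
  by move=> x Ex'; exact: Ck_continuous dJ Ex'.
have EE' : E' `<=` E by move=> x [].
have fE' : Ck 1 E f by apply: Ck_le fE.
have df x : E x -> differentiable f x by exact: fE.1.
have gE : Ck 1 E (fun y => invmx J *m f y).
  exact: (Ck_linl (L := @mulmxf R n n 1 (invmx J)) oE (@mulmxf_continuous _ _ _ _ _)).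
have jg : jac (fun y => invmx J *m f y) x0 = 1%:M.
  by rewrite jac_mulmxf ?mulVmx//; exact: df.
have Ex' : E' x0 by split=> //=; move: Ju; rewrite unitmxE unitfE.
have [r [r0 rE gr]] := strict_derivative oE' Ex' (Ck_sub EE' gE) jg.
have [c c0 Mc] := @mulmxf_lipschitz R n n 1 (invmx J).
have brr : ball x0 (r / 2) `<=` ball x0 r.
  by apply: le_ball; rewrite ler_pdivrMr// ler_pMr// ler1n.
(* [c] bounds [invmx J], which therefore carries a ball of radius [r / 4 / c] into one of radius
   [r / 4], as [onto_ball] demands. *)
have e00 : 0 < r / 4 / c by rewrite !divr_gt0.
have fsurj y : ball (f x0) (r / 4 / c) y -> exists x, ball x0 (r / 2) x /\ f x = y.
  move=> by_; have fy : `|f x0 - y| < r / 4 / c by rewrite -ball_normE in by_.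
  have [x bx fxy] : exists2 x, ball x0 (r / 2) x & invmx J *m f x = invmx J *m y.
    apply: onto_ball r0 gr _.
    rewrite -ball_normE /= -mulmxBr (le_lt_trans (Mc _))//.
    by rewrite mulrC -ltr_pdivlMr.
  exists x; split => //.
  by rewrite -(mulKVmx Ju (f x)) fxy mulKVmx.
have finj x x' : ball x0 r x -> ball x0 r x' -> `|x - x'| <= 2 * (c * `|f x - f x'|).
  move=> bx bx'; apply: le_trans (norm_le_half (gr _ _ bx bx')) _.
  by rewrite -mulmxBr ler_wpM2l.
pose h y := xget x0 [set x | ball x0 (r / 2) x /\ f x = y].
have hP y : ball (f x0) (r / 4 / c) y -> ball x0 (r / 2) (h y) /\ f (h y) = y.
  by move=> /fsurj; exact: xgetPex.
have hf x : ball x0 (r / 2) x -> ball (f x0) (r / 4 / c) (f x) -> h (f x) = x.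
  move=> bx bfx; have [bhx fhx] := hP _ bfx.
  apply/eqP; rewrite -subr_eq0 -normr_le0.
  by rewrite (le_trans (finj _ _ (brr _ bhx) (brr _ bx)))// fhx subrr normr0 !mulr0.
exists h, (r / 4 / c); split=> //; first by apply: hf; apply: ballxx => //; rewrite divr_gt0.
move=> e e_0 ee0; set W := ball (f x0) e.
have We0 : W `<=` ball (f x0) (r / 4 / c) by exact: le_ball.
have oW : open W by exact: ball_open.
have hE y : W y -> E' (h y) by move=> /We0 /hP[/brr /rE].
have dh y : W y -> is_diff y h (mulmxf (invmx (jac f (h y)))).
  move=> Wy; have [Eh Jh] := hE _ Wy.
  have c20 : 0 < 2 * c by rewrite mulr_gt0.
  have Wy' : nbhs y W by exact: open_nbhs_nbhs.
  apply: (@inverse_differentiable _ f h y (2 * c)) => //.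
  - exact: df.
  - by rewrite unitmxE unitfE.
  - by apply: filterS Wy' => z /We0 /hP[].
  - apply: filterS Wy' => z /We0 /hP[bz fz].
    have [bhy fhy] := hP _ (We0 _ Wy).
    by rewrite -mulrA -{2}fz -{2}fhy finj//; exact: brr.
have oEh : forall y, W y -> E (h y) by move=> y /hE[].
split=> [y Wy||].
- by split; [exact: oEh|have [] := hP _ (We0 _ Wy)].
(* Bootstrapping: the derivative of [h] at [y] is [invmx (jac f (h y))], which is C^j as soon as [h]
   is, for [j <= k]. *)
- suff Hj j : (j <= k.+1)%N -> Ck j W h by exact: Hj.
  elim: j => [_ y Wy|j IH jk].
    by apply: differentiable_continuous; case: (dh _ Wy).
  have {}IH := IH (ltnW jk).
  split=> [y Wy|w]; first by case: (dh _ Wy).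
  apply: (@Ck_ext _ _ _ _ W (fun y => invmx (jac f (h y)) *m w)) => // [y Wy|].
    by have [dhy Dhy] := dh _ Wy; rewrite deriveE// Dhy.
  apply: Ck_mx => // i l.
  apply: (@Ck_ext _ _ _ _ W
    (fun y => \sum_m invmx (jac f (h y)) i m * w m l)) => // [y Wy|].
    by rewrite mxE.
  apply: Ck_sum => // m; apply: (CkM oW); last exact: Ck_cst.
  apply: Ck_invmx => // [y /hE[_ Jh]|a b]; first by rewrite unitmxE unitfE.
  have jk' : (j <= k)%N by [].
  exact: (Ck_comp_mx (g := fun x => jac f x a b) oW oEh IH (Ck_le jk' (jacE a b))).
- rewrite (_ : h @` W = ball x0 (r / 2) `&` f @^-1` W).
    apply: open_setI_preimage => //; first exact: ball_open.
    by move=> x /brr /rE /EE' /df; exact: differentiable_continuous.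
  apply/seteqP; split => [x [y Wy <-]|x [bx Wx]].
    have [bh fh] := hP _ (We0 _ Wy).
    by split=> //=; rewrite fh.
  by exists (f x) => //; apply: hf => //; exact: We0.
Qed.

End Inverse_function.

(** * Lagrangian and Eulerian derivatives *)

Section Velocity.
Context {R : realType}.
Local Notation plane := 'cV[R]_2.
Implicit Types (phi u : plane -> R -> plane).

Lemma partial_fst u x t : differentiable (fun q => u q.1 q.2) (x, t) ->
  differentiable (u ^~ t) x /\
  forall a, 'D_a (u ^~ t) x = 'd (fun q => u q.1 q.2) (x, t) (a, 0).
Proof.
move=> du; pose p (y : plane) : plane * R := (y, t).
have dp : is_diff x p (fun a => (a, 0)) by exact: is_diff_pair.
have [dpx Dp] := dp.
have dup : differentiable ((fun q => u q.1 q.2) \o p) x by exact: differentiable_comp.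
split=> // a; rewrite (deriveE (f := (fun q => u q.1 q.2) \o p))//.
by rewrite diff_comp//= Dp.
Qed.

Lemma partial_snd u x t : differentiable (fun q => u q.1 q.2) (x, t) ->
  'D_1 (u x) t = 'd (fun q => u q.1 q.2) (x, t) (0, 1).
Proof.
move=> du; pose p (s : R) : plane * R := (x, s).
have dp : is_diff t p (fun a => (0, a)) by exact: is_diff_pair.
have [dpx Dp] := dp.
have dup : differentiable ((fun q => u q.1 q.2) \o p) t by exact: differentiable_comp.
rewrite (deriveE (f := (fun q => u q.1 q.2) \o p))//.
by rewrite diff_comp//= Dp.
Qed.

Lemma local_velocity_differentiable phi z t u : local_velocity phi z t u ->
  differentiable (fun q => u q.1 q.2) (phi z t, t).
Proof. by case=> -[N [oN Nz [du _]]] _; exact: du. Qed.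

Lemma near_pair_fst (T S : topologicalType) (P : T * S -> Prop) (z : T) (t : S) :
  (\forall q \near (z, t), P q) -> \forall y \near z, P (y, t).
Proof.
move=> PP; have c : {for z, continuous (fun y : T => (y, t))}.
  by apply: cvg_pair => /=; [exact: cvg_id|exact: cvg_cst].
exact: c PP.
Qed.

Lemma near_pair_snd (T S : topologicalType) (P : T * S -> Prop) (z : T) (t : S) :
  (\forall q \near (z, t), P q) -> \forall s \near t, P (z, s).
Proof.
move=> PP; have c : {for t, continuous (fun s : S => (z, s))}.
  by apply: cvg_pair => /=; [exact: cvg_cst|exact: cvg_id].
exact: c PP.
Qed.

(** The identity [d/dt phi = u (phi, t)] holds near [(z, t)] and may be differentiated in [z]; where
    the Jacobian of [phi] is invertible, the result determines the gradient of [u]. *)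
Lemma velocity_space phi z t u : local_velocity phi z t u ->
  differentiable (phi ^~ t) z ->
  jac (fun y => 'D_1 (phi y) t) z = jac (u ^~ t) (phi z t) *m jac (phi ^~ t) z.
Proof.
move=> lv dphi; have du := local_velocity_differentiable lv.
have [du1 _] := partial_fst du.
have dup : differentiable ((u ^~ t) \o (phi ^~ t)) z by exact: differentiable_comp.
have nz := near_pair_fst lv.2.
have E w : 'D_w (fun y => 'D_1 (phi y) t) z =
    jac (u ^~ t) (phi z t) *m jac (phi ^~ t) z *m w.
  have -> : 'D_w (fun y => 'D_1 (phi y) t) z = 'D_w ((u ^~ t) \o (phi ^~ t)) z.
    by apply: near_eq_derive; apply: filterS nz => y [_].
  by rewrite derive_comp// -mulmxA !derive_jac.
have dpsi : differentiable (fun y => 'D_1 (phi y) t) z.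
  apply: near_eq_differentiable dup.
  by apply: filterS nz => y [_ /= ->].
apply/matrixP => i j; rewrite [LHS]mxE -(derive_entry _ _ _ dpsi) E.
by rewrite -colE mxE.
Qed.

Lemma velocity_time phi z t u : local_velocity phi z t u ->
  'D_1 (fun s => 'D_1 (phi z) s) t =
  'D_1 (u (phi z t)) t + jac (u ^~ t) (phi z t) *m u (phi z t) t.
Proof.
move=> lv; have du := local_velocity_differentiable lv.
have [du1 Du1] := partial_fst du; have Du2 := partial_snd du.
have nt := near_pair_snd lv.2.
have [dphit Dphit] : derivable (phi z) t 1 /\ 'D_1 (phi z) t = u (phi z t) t.
  exact: nbhs_singleton nt.
have dphi : differentiable (phi z) t by exact/derivable1_diffP.
pose p (s : R) : plane * R := (phi z s, s).
have [dp Dp] : is_diff t p (fun a => ('d (phi z) t a, a)).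
  apply: is_diff_pair; exact: differentiableP.
have -> : 'D_1 (fun s => 'D_1 (phi z) s) t = 'D_1 ((fun q => u q.1 q.2) \o p) t.
  by apply: near_eq_derive; apply: filterS nt => s [_].
have D1 : 'd (phi z) t 1 = u (phi z t) t by rewrite -deriveE.
rewrite deriveE; last exact: differentiable_comp.
rewrite (diff_comp dp du) /= Dp /= D1.
rewrite (_ : (_, 1) = (0, 1) + (u (phi z t) t, 0)); last first.
  by apply/pair_equal_spec; rewrite /= add0r addr0.
by rewrite linearD -Du2 -Du1 derive_jac.
Qed.

(** The right-hand side is the material derivative of the velocity, so the momentum equation equates
    the acceleration of a particle with minus the pressure gradient along its path. *)
Lemma material_derivative phi z t u (i : 'I_2) : local_velocity phi z t u ->
  ('D_1 (fun s => 'D_1 (phi z) s) t) i 0 =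
  'D_1 (fun s => u (phi z t) s i 0) t
  + \sum_(j < 2) u (phi z t) t j 0 * pd j (fun y => u y t i 0) (phi z t).
Proof.
move=> lv; have du := local_velocity_differentiable lv.
have dut : differentiable (u (phi z t)) t.
  apply: (differentiable_comp (f := fun s => (phi z t, s))) du.
  by apply: differentiable_pair.
rewrite (velocity_time lv) !mxE derive_entry//; congr (_ + _).
by apply: eq_bigr => j _; rewrite mxE mulrC.
Qed.

End Velocity.

Lemma sum_ord2 (V : nmodType) (F : 'I_2 -> V) : \sum_(i < 2) F i = F 0 + F 1.
Proof. by rewrite !big_ord_recl big_ord0 addr0; congr (_ + F _); apply: val_inj. Qed.

Lemma sum_ord4 (V : nmodType) (F : 'I_4 -> V) :
  \sum_(i < 4) F i = F 0 + F 1 + F 2 + F 3.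
Proof.
rewrite !big_ord_recl big_ord0 addr0 !addrA.
by congr (_ + F _ + F _ + F _); apply: val_inj.
Qed.

Lemma ord2P (P : 'I_2 -> Prop) : P 0 -> P 1 -> forall i, P i.
Proof.
move=> P0 P1 [[|[|//]] lti].
- by rewrite (_ : Ordinal lti = 0)//; apply: val_inj.
- by rewrite (_ : Ordinal lti = 1)//; apply: val_inj.
Qed.

Lemma ord3P (P : 'I_3 -> Prop) : P 0 -> P 1 -> P 2 -> forall i, P i.
Proof.
move=> P0 P1 P2 [[|[|[|//]]] lti].
- by rewrite (_ : Ordinal lti = 0)//; apply: val_inj.
- by rewrite (_ : Ordinal lti = 1)//; apply: val_inj.
- by rewrite (_ : Ordinal lti = 2)//; apply: val_inj.
Qed.

Lemma ord4P (P : 'I_4 -> Prop) : P 0 -> P 1 -> P 2 -> P 3 -> forall i, P i.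
Proof.
move=> P0 P1 P2 P3 [[|[|[|[|//]]]] lti].
- by rewrite (_ : Ordinal lti = 0)//; apply: val_inj.
- by rewrite (_ : Ordinal lti = 1)//; apply: val_inj.
- by rewrite (_ : Ordinal lti = 2)//; apply: val_inj.
- by rewrite (_ : Ordinal lti = 3)//; apply: val_inj.
Qed.

Lemma det_mx22 (R : comPzRingType) (M : 'M[R]_2) :
  \det M = M 0 0 * M 1 1 - M 0 1 * M 1 0.
Proof.
rewrite (expand_det_row _ 0) sum_ord2 /cofactor !det_mx11 !mxE /=.
rewrite (_ : lift 0 0 = 1); last exact: val_inj.
rewrite (_ : lift 1 0 = 0); last exact: val_inj.
by rewrite addn0 addn1 expr0 expr1 mul1r mulN1r mulrN.
Qed.

Section Planar.
Context {R : realType}.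
Local Notation plane := 'cV[R]_2.

Lemma gdetE (w : plane -> 'cV[R]_4) i j z :
  gdet w i j z = jac w z i 0 * jac w z j 1 - jac w z j 0 * jac w z i 1.
Proof. by rewrite /gdet det_mx22 !mxE. Qed.

Definition mulmxrf m n p (M : 'M[R]_(n, p)) (A : 'M[R]_(m, n)) := A *m M.
Lemma mulmxrf_linear m n p (M : 'M[R]_(n, p)) : linear (@mulmxrf m n p M).
Proof. by move=> a A B; rewrite /mulmxrf mulmxDl scalemxAl. Qed.
HB.instance Definition _ m n p (M : 'M[R]_(n, p)) :=
  GRing.isLinear.Build R 'M[R]_(m, n) 'M[R]_(m, p) *:%R (@mulmxrf m n p M) (@mulmxrf_linear m n p M).

Lemma motion_dt (A : R -> 'M[R]_(2, 4)) (v : plane -> 'cV[R]_4) z t :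
  differentiable A t -> differentiable (motion A v z) t /\
  'D_1 (motion A v z) t = 'D_1 A t *m v z.
Proof.
move=> dA; have cL := @linear_mx_continuous R _ _ _ (@mulmxrf 2 4 1 (v z)).
have [dL _] := linear_diffE (A t) 0 cL.
split; first exact: (differentiable_comp dA dL).
have := derive_lin (1 : R) cL dA; exact.
Qed.

Lemma motion_dz (A : R -> 'M[R]_(2, 4)) (v : plane -> 'cV[R]_4) z t :
  differentiable v z -> differentiable (motion A v ^~ t) z /\
  jac (motion A v ^~ t) z = A t *m jac v z.
Proof.
move=> dv; split; last exact: jac_mulmxf.
apply: (differentiable_comp (g := mulmxf (A t)) dv).
exact: (linear_diffE (v z) 0 (@mulmxf_continuous R _ _ _ (A t))).1.
Qed.

End Planar.

(** * The normal form is a solution *)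

Section Normal_form.
Context {R : realType}.
Local Notation plane := 'cV[R]_2.

Lemma open_proj0 (W : set plane) : open W -> open [set z 0 0 | z in W].
Proof.
move=> oW; rewrite openE => _ [z Wz <-].
have /nbhs_ballP[e /= e0 be] : nbhs z W by exact: open_nbhs_nbhs.
apply/nbhs_ballP; exists e => //= s sz.
exists (\col_i if i == 0 then s else z i 0); last by rewrite mxE eqxx.
apply: be; split=> // i j; rewrite ord1 mxE.
by case: eqP => [->|_] //; exact: ballxx.
Qed.

Section Fixed.
Variables (W : set plane) (f1 f2 : R -> R).
Local Notation E := [set z 0 0 | z in W].
Hypotheses (oW : open W) (reg : Ck 2 E f1 /\ Ck 1 E f2).

Lemma Ck_derive1 : Ck 1 E (derive1 f1).
Proof.
have [[_ f1E] _] := reg.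
have -> : derive1 f1 = 'D_1 f1 by apply/funext => s; rewrite derive1E.
exact: f1E.
Qed.

Lemma Ck_coord0 k i : Ck k W (fun z : plane => z i 0).
Proof. exact: (Ck_lin k W (@coordf_continuous R 2 1 i 0)). Qed.

Lemma Ck_comp_coord0 k (f : R -> R) : Ck k E f -> Ck k W (fun z => f (z 0 0)).
Proof.
move=> fE; apply: (Ck_comp_real (f := fun z : plane => z 0 0) (g := f) oW _ (Ck_coord0 k 0) fE).
by move=> z Wz; exists z.
Qed.

Lemma Ck_v_normal : Ck 1 W (v_normal f1 f2).
Proof.
have [f1E f2E] := reg.
apply: Ck_mx => // i j; rewrite ord1 {j}; move: i; apply: ord4P.
- by apply: Ck_ext oW _ (Ck_coord0 1 0) => z _; rewrite mxE.
- by apply: Ck_ext oW _ (Ck_coord0 1 1) => z _; rewrite mxE.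
- apply: Ck_ext oW _ (CkD oW (CkM oW (Ck_coord0 1 1) (Ck_comp_coord0 Ck_derive1))
     (Ck_comp_coord0 f2E)) => z _; by rewrite mxE.
- by apply: Ck_ext oW _ (Ck_comp_coord0 (CkW f1E)) => z _; rewrite mxE.
Qed.

Lemma derive_comp_coord0 (f : R -> R) (z w : plane) : differentiable f (z 0 0) ->
  'D_w (fun y : plane => f (y 0 0)) z = w 0 0 * derive1 f (z 0 0).
Proof.
move=> df; have [dc Dc] := linear_diffE z w (@coordf_continuous R 2 1 0 0).
have -> : 'D_w (fun y : plane => f (y 0 0)) z = 'D_w (f \o coordf 0 0) z by [].
rewrite derive_comp// Dc derive1E -deriveZdir//.
by rewrite /coordf /GRing.scale /= mulr1.
Qed.

Lemma derive_v_normal (z w : plane) : W z -> 'D_w (v_normal f1 f2) z = \col_(i < 4)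
  nth 0 [:: w 0 0; w 1 0; w 1 0 * derive1 f1 (z 0 0)
     + z 1 0 * (w 0 0 * derive1 (derive1 f1) (z 0 0)) + w 0 0 * derive1 f2 (z 0 0);
     w 0 0 * derive1 f1 (z 0 0)] i.
Proof.
move=> Wz; have [f1E f2E] := reg.
have Ez : E (z 0 0) by exists z.
have df1 := f1E.1 _ Ez; have df2 := f2E.1 _ Ez; have df1' := Ck_derive1.1 _ Ez.
have [dc0 Dc0] := linear_diffE z w (@coordf_continuous R 2 1 0 0).
have [dc1 Dc1] := linear_diffE z w (@coordf_continuous R 2 1 1 0).
have dvz : differentiable (v_normal f1 f2) z by exact: Ck_v_normal.1.
apply/colP; apply: ord4P; rewrite derive_entry// mxE /=.
- by rewrite -[RHS]Dc0; congr ('D_w _ z); apply/funext => y; rewrite mxE.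
- by rewrite -[RHS]Dc1; congr ('D_w _ z); apply/funext => y; rewrite mxE.
- pose h1 (y : plane) := derive1 f1 (y 0 0); pose h2 (y : plane) := f2 (y 0 0).
  have dh1 : differentiable h1 z.
    exact: (differentiable_comp (f := @coordf R 2 1 0 0) dc0 df1').
  have dh2 : differentiable h2 z.
    exact: (differentiable_comp (f := @coordf R 2 1 0 0) dc0 df2).
  have -> : (fun y => v_normal f1 f2 y 2 0) = (coordf 1 0 \* h1) \+ h2.
    by apply/funext => y; rewrite mxE.
  rewrite deriveD; [|exact/diff_derivable/differentiableM|exact: diff_derivable].
  rewrite deriveM; [|exact: diff_derivable|exact: diff_derivable].
  rewrite Dc1 !derive_comp_coord0// /GRing.scale /= /h1 /coordf.
  by ring.
- rewrite -derive_comp_coord0//; congr ('D_w _ z).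
  by apply/funext => y; rewrite mxE.
Qed.

Lemma jac_v_normal z : W z -> jac (v_normal f1 f2) z =
  \matrix_(i < 4, j < 2) nth 0 (nth [::]
    [:: [:: 1; 0]; [:: 0; 1];
        [:: z 1 0 * derive1 (derive1 f1) (z 0 0) + derive1 f2 (z 0 0); derive1 f1 (z 0 0)];
        [:: derive1 f1 (z 0 0); 0]] i) j.
Proof.
move=> Wz; have dvz : differentiable (v_normal f1 f2) z by exact: Ck_v_normal.1.
apply/matrixP => i j; rewrite !mxE -derive_entry// derive_v_normal// !mxE.
by move: i j; apply: ord4P; apply: ord2P; rewrite /= ?(mul0r, mul1r, mulr0, addr0, add0r).
Qed.

(** The time derivative of [A_normal]. It is constant: every particle moves uniformly on a straight
    line. *)
Definition B_normal : 'M[R]_(2, 4) := \matrix_(i < 2, j < 4)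
    nth 0 (nth [::] [:: [:: 1; 0; 0; 0]; [:: 0; 0; 0; 1]] i) j.

Lemma derive_A_normal t : differentiable (@A_normal R) t /\ 'D_1 (@A_normal R) t = B_normal.
Proof.
have -> : @A_normal R = (cst (A_normal 0)) \+ scale_at B_normal.
  apply/funext => s; apply/matrixP => i j; rewrite /= /scale_at !mxE.
  by move: i j; apply: ord2P; apply: ord4P; rewrite /= ?(mulr0, mulr1, addr0, add0r).
have [ds Ds] := linear_diffE t 1 (@scale_at_continuous R 'M[R]_(2, 4) B_normal).
split; first exact: differentiableD.
rewrite deriveD; [|exact: derivable_cst|exact: diff_derivable].
by rewrite derive_cst add0r Ds; exact: scale1r.
Qed.

End Fixed.
End Normal_form.

Section Normal_solution.
Context {R : realType}.
Local Notation plane := 'cV[R]_2.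
Variables (W : set plane) (f1 f2 : R -> R).
Local Notation E := [set z 0 0 | z in W].
Hypotheses (oW : open W) (reg : Ck 2 E f1 /\ Ck 1 E f2).
Local Notation phi := (motion (@A_normal R) (v_normal f1 f2)).
Local Notation K := (fun z : plane => z 1 0 * derive1 (derive1 f1) (z 0 0) + derive1 f2 (z 0 0)).
Local Notation p := (fun z : plane => derive1 f1 (z 0 0)).

Lemma v_normal_constraint z : W z -> constraint (v_normal f1 f2) z.
Proof.
move=> Wz; split; rewrite !gdetE (jac_v_normal oW reg Wz) !mxE /=.
  by ring.
by ring.
Qed.

Lemma differentiable_v_normal z : W z -> differentiable (v_normal f1 f2) z.
Proof. by move=> Wz; exact: (Ck_v_normal oW reg).1. Qed.

Lemma jac_phi z t : W z -> jac (phi ^~ t) z = \matrix_(i < 2, j < 2) nth 0 (nth [::]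
    [:: [:: t; 1]; [:: K z + t * p z; p z]] i) j.
Proof.
move=> Wz; rewrite (motion_dz _ _ (differentiable_v_normal Wz)).2.
rewrite (jac_v_normal oW reg Wz); apply/matrixP => i j.
rewrite !mxE sum_ord4 !mxE; move: i j.
by apply: ord2P; apply: ord2P; rewrite /= ?(mul0r, mul1r, mulr0, mulr1, addr0, add0r).
Qed.

Lemma det_phi z t : W z -> \det (jac (phi ^~ t) z) = - K z.
Proof. by move=> Wz; rewrite jac_phi// det_mx22 !mxE /=; ring. Qed.

Lemma phi_dt z t : 'D_1 (phi z) t = \col_(i < 2) nth 0 [:: z 0 0; f1 (z 0 0)] i.
Proof.
have [dA DA] := derive_A_normal t.
rewrite (motion_dt (v_normal f1 f2) z dA).2 DA.
apply/colP => i; rewrite mxE sum_ord4 !mxE; move: i.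
by apply: ord2P; rewrite /= ?(mul0r, mul1r, mulr0, mulr1, addr0, add0r).
Qed.

(** By [velocity_space], [U] times the Jacobian of [phi] has the rows [(1, 0)] and [(p, 0)]. The
    second column says that [U] annihilates [(1, p)]; then the terms with [t] cancel in the first
    column. *)
Lemma normal_velocity z t u : W z -> local_velocity phi z t u ->
  let U := jac (u ^~ t) (phi z t) in
  [/\ K z * U 0 1 = 1, U 0 0 = - (p z * U 0 1),
      K z * U 1 1 = p z & U 1 0 = - (p z * U 1 1)].
Proof.
move=> Wz lv /=; set U := jac _ (phi z t); have dv := differentiable_v_normal Wz.
have := velocity_space lv (motion_dz (@A_normal R) t dv).1.
rewrite -/U jac_phi//.
have -> : (fun y => 'D_1 (phi y) t) = (fun y => B_normal *m v_normal f1 f2 y).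
  have [dA DA] := derive_A_normal t.
  by apply/funext => y; rewrite (motion_dt (v_normal f1 f2) y dA).2 DA.
rewrite jac_mulmxf// (jac_v_normal oW reg Wz) => /matrixP E.
have := E 0 0; have := E 0 1; have := E 1 0; have := E 1 1.
clear E; move: (derive1 f1 (z 0 0)) (derive1 (derive1 f1) (z 0 0)) (derive1 f2 (z 0 0)).
move: U => U d1 d2 d3.
rewrite !mxE !sum_ord4 !sum_ord2 !mxE /= => E11 E10 E01 E00.
have U00 : U 0 0 = - (d1 * U 0 1).
  by apply/eqP; rewrite -addr_eq0 [X in _ + X]mulrC -[X in X + _]mulr1 -E01 !(mulr0, mul0r, add0r, addr0).
have U10 : U 1 0 = - (d1 * U 1 1).
  by apply/eqP; rewrite -addr_eq0 [X in _ + X]mulrC -[X in X + _]mulr1 -E11 !(mulr0, mul0r, add0r, addr0).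
split=> //.
  transitivity (U 0 0 * t + U 0 1 * (z 1 0 * d2 + d3 + t * d1)); first by rewrite U00; ring.
  by rewrite -E00; ring.
transitivity (U 1 0 * t + U 1 1 * (z 1 0 * d2 + d3 + t * d1)); first by rewrite U10; ring.
by rewrite -E10; ring.
Qed.

Hypothesis nondeg : forall z, W z -> det_normal f1 f2 z != 0.

Lemma K_neq0 z : W z -> K z != 0.
Proof.
move=> /nondeg; rewrite /det_normal mulNr -opprD oppr_eq0.
by [].
Qed.

(** The off-diagonal entries contribute [- p ^+ 2 / K] and [- 1 / K]. For [f1 = 0] the flow is a
    shear with velocity [(z_1, 0)] at height [x_2 = f2 (z_1)], whose vorticity is [- 1 / f2']; so
    the numerator is indeed [- (1 + p ^+ 2)] and not [p ^+ 2]. *)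
Lemma normal_vorticity z t u : W z -> local_velocity phi z t u ->
  vorticity u (phi z t) t = - (1 + p z ^+ 2) / K z.
Proof.
move=> Wz lv; have [U01 _ U11 U10] := normal_velocity Wz lv.
set U := jac _ _ in U01 U11 U10; have K0 := K_neq0 Wz.
have -> : vorticity u (phi z t) t = U 1 0 - U 0 1 by rewrite !mxE.
apply: (mulIf K0); rewrite mulfVK// mulrBl U10.
by rewrite mulNr -mulrA (mulrC _ (K z)) U11 (mulrC (U 0 1)) U01; ring.
Qed.

(** The acceleration is read off from [phi] and is zero; the divergence is
    [U 0 0 + U 1 1 = - p / K + p / K]. *)
Lemma normal_euler z t u : W z -> local_velocity phi z t u ->
  euler_at u (fun _ _ => 0) (phi z t) t.
Proof.
move=> Wz lv; have [U01 U00 U11 U10] := normal_velocity Wz lv.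
split.
- exact: differentiable_cst.
- move=> i; rewrite -(material_derivative i lv).
  have -> : (fun s => 'D_1 (phi z) s) = cst (\col_(i < 2) nth 0 [:: z 0 0; f1 (z 0 0)] i).
    by apply/funext => s; rewrite phi_dt.
  by rewrite derive_cst mxE add0r /pd derive_cst.
- set U := jac _ _ in U01 U00 U11 U10; have K0 := K_neq0 Wz.
  rewrite sum_ord2 (_ : _ + _ = U 0 0 + U 1 1); last by rewrite !mxE.
  by apply: (mulfI K0); rewrite mulr0 mulrDr U11 U00 mulrN mulrCA U01 mulr1 addNr.
Qed.

End Normal_solution.

Lemma unitmx_inj (F : fieldType) n (M : 'M[F]_n) :
  (forall w : 'cV_n, M *m w = 0 -> w = 0) -> M \in unitmx.
Proof.
move=> M0; rewrite -unitmx_tr -row_free_unit -kermx_eq0; apply/rowV0P => v /sub_kermxP vM.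
by apply: trmx_inj; rewrite trmx0; apply: M0; rewrite -[M]trmxK -trmx_mul vM trmx0.
Qed.

(** * Existence of a velocity field for the normal form *)

Section Existence.
Context {R : realType}.
Local Notation plane := 'cV[R]_2.

(** Space-time as a space of column vectors, the setting of [inverse_function]. *)
Definition join3 (q : plane * R) : 'cV[R]_3 := \col_i nth 0 [:: q.1 0 0; q.1 1 0; q.2] i.
Lemma join3_linear : linear join3.
Proof. by move=> a q r; apply/colP; apply: ord3P; rewrite !mxE. Qed.
HB.instance Definition _ := GRing.isLinear.Build R (plane * R)%type 'cV[R]_3 *:%R join3 join3_linear.

Lemma join3_continuous : continuous join3.
Proof.
apply/bounded_linear_continuous/linear_boundedP => /=.
exists 1; split; first exact: gtr0_real.
move=> y y1 q; apply: le_trans (_ : 1 * `|q| <= _); last by rewrite ler_wpM2r// ltW.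
rewrite mul1r; apply: mx_norm_le => // i j; rewrite ord1 {j}; move: i.
by apply: ord3P; rewrite mxE /= prod_normE le_max ?lexx ?orbT// (le_mx_norm q.1).
Qed.

Definition fst3 (y : 'cV[R]_3) : plane := \col_i nth 0 [:: y 0 0; y 1 0] i.
Lemma fst3_linear : linear fst3.
Proof. by move=> a q r; apply/colP; apply: ord2P; rewrite !mxE. Qed.
HB.instance Definition _ := GRing.isLinear.Build R 'cV[R]_3 plane *:%R fst3 fst3_linear.

Lemma fst3_continuous : continuous fst3.
Proof. exact: linear_mx_continuous. Qed.

Lemma join3K q : fst3 (join3 q) = q.1.
Proof. by apply/colP; apply: ord2P; rewrite !mxE. Qed.

Lemma join3_2 q : join3 q 2 0 = q.2.
Proof. by rewrite mxE. Qed.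

Lemma fst3K y : join3 (fst3 y, y 2 0) = y.
Proof. by apply/colP; apply: ord3P; rewrite !mxE. Qed.

Variables (W : set plane) (f1 f2 : R -> R).
Local Notation E := [set z 0 0 | z in W].
Hypotheses (oW : open W) (reg : Ck 2 E f1 /\ Ck 1 E f2).
Hypothesis nondeg : forall z, W z -> det_normal f1 f2 z != 0.
Local Notation phi := (motion (@A_normal R) (v_normal f1 f2)).
Local Notation E3 := (fst3 @^-1` W).

Let vv i (y : 'cV[R]_3) := v_normal f1 f2 (fst3 y) i 0.
Let F (y : 'cV[R]_3) := join3 (phi (fst3 y) (y 2 0), y 2 0).

Let oE3 : open E3.
Proof. by apply: open_comp => // y _; exact: fst3_continuous. Qed.

Let Ck_vv i : Ck 1 E3 (vv i).
Proof.
have vi : Ck 1 W (fun z => v_normal f1 f2 z i 0) by exact/Ck_coord/Ck_v_normal.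
exact: (Ck_comp_mx (f := fst3) oE3 _ (Ck_lin 1 E3 fst3_continuous) vi).
Qed.

Let Ck_c3 i : Ck 1 E3 (fun y : 'cV[R]_3 => y i 0).
Proof. exact: (Ck_lin 1 E3 (@coordf_continuous R 3 1 i 0)). Qed.

Let F0 y : F y 0 0 = y 2 0 * vv 0 y + vv 1 y.
Proof. by rewrite /F /vv /motion !mxE /= sum_ord4 !mxE /= !(mul0r, mul1r, addr0). Qed.
Let F1 y : F y 1 0 = vv 2 y + y 2 0 * vv 3 y.
Proof. by rewrite /F /vv /motion !mxE /= sum_ord4 !mxE /= !(mul0r, mul1r, add0r). Qed.
Let F2 y : F y 2 0 = y 2 0.
Proof. by rewrite /F !mxE. Qed.

Let Ck_F : Ck 1 E3 F.
Proof.
apply: Ck_mx => // i j; rewrite ord1 {j}; move: i; apply: ord3P.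
- apply: Ck_ext oE3 (fun y _ => esym (F0 y)) _.
  exact: (CkD oE3 (CkM oE3 (Ck_c3 2) (Ck_vv 0)) (Ck_vv 1)).
- apply: Ck_ext oE3 (fun y _ => esym (F1 y)) _.
  exact: (CkD oE3 (Ck_vv 2) (CkM oE3 (Ck_c3 2) (Ck_vv 3))).
- exact: Ck_ext oE3 (fun y _ => esym (F2 y)) (Ck_c3 2).
Qed.

Let derive_vv i y w : E3 y -> differentiable (vv i) y /\
  'D_w (vv i) y = 'D_(fst3 w) (v_normal f1 f2) (fst3 y) i 0.
Proof.
move=> Ey; split; first exact: (Ck_vv i).1.
have dv := differentiable_v_normal oW reg Ey.
rewrite derive_entry//; have [dL DL] := linear_diffE y w fst3_continuous.
rewrite -DL -derive_comp//.
by apply: differentiable_entry.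
Qed.

(** The last component of [F] is the time, so a kernel vector has zero time component and lies in
    the kernel of the spatial Jacobian of [phi], whose determinant is [- K]. *)
Let jac_F_unit y : E3 y -> jac F y \in unitmx.
Proof.
move=> Ey; apply: unitmx_inj => w; rewrite -derive_jac; last exact: Ck_F.1.
have dF : differentiable F y by exact: Ck_F.1.
have [dc Dc] := linear_diffE y w (@coordf_continuous R 3 1 2 0).
have dvv i := (derive_vv i w Ey).1.
have Dvv i := (derive_vv i w Ey).2.
move=> /colP DF0.
have := DF0 0; have := DF0 1; have := DF0 2.
rewrite !(derive_entry _ _ _ dF).
rewrite (_ : (fun y => F y 2 0) = coordf 2 0) ?Dc; last by apply/funext => x; rewrite F2.
rewrite (_ : (fun y => F y 0 0) = (coordf 2 0 \* vv 0) \+ vv 1); last first.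
  by apply/funext => x; rewrite F0.
rewrite (_ : (fun y => F y 1 0) = vv 2 \+ (coordf 2 0 \* vv 3)); last first.
  by apply/funext => x; rewrite F1.
rewrite !deriveD; try exact: diff_derivable; try exact/diff_derivable/differentiableM.
rewrite !deriveM; try exact: diff_derivable.
rewrite !Dvv Dc !(derive_v_normal oW reg _ Ey) /coordf !mxE /= /GRing.scale /= => w2.
rewrite w2 !mulr0 !addr0 => e1 /eqP.
rewrite addrC addr_eq0 => /eqP w1.
have := K_neq0 nondeg Ey; rewrite !mxE /= => K0.
have w0 : w 0 0 = 0.
  apply: (mulIf K0); rewrite mul0r -[RHS]e1 w1; by ring.
by apply/colP; apply: ord3P; rewrite mxE ?w1 ?w0 ?w2 ?mulr0 ?oppr0.
Qed.

Lemma normal_is_solution : is_solution W setT phi.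
Proof.
move=> z0 t0 Wz0 _; pose y0 := join3 (z0, t0).
have Ey0 : E3 y0 by rewrite /= join3K.
have FE z t : F (join3 (z, t)) = join3 (phi z t, t) by rewrite /F join3K join3_2.
have [h [e [e_gt0 hy0 /(_ e e_gt0 (lexx _))]]] :=
  inverse_function oE3 Ey0 Ck_F (jac_F_unit Ey0).
set B := ball _ _ => -[hB Ck_h oB].
have oBall : open B by exact: ball_open.
(* The velocity of a particle depends on its label [z_1] only, and the inverse [h] recovers this
   label from the position and the time. *)
pose u (x : plane) t : plane := \col_(i < 2)
  nth 0 [:: h (join3 (x, t)) 0 0; f1 (h (join3 (x, t)) 0 0)] i.
pose N : set (plane * R) := join3 @^-1` B.
have oN : open N by apply: open_comp => // q _; exact: join3_continuous.
have Ck_h0 : Ck 1 N (fun q => h (join3 q) 0 0).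
  apply: (Ck_comp_mx (f := join3) (g := fun y => h y 0 0) (F := B) oN) => //.
    exact: (Ck_lin 1 N join3_continuous).
  exact: Ck_coord.
have Ck_u : Ck 1 N (fun q => u q.1 q.2).
  have [f1E _] := reg.
  apply: (Ck_mx oN) => i j; rewrite ord1 {j}; move: i; apply: ord2P.
    by apply: Ck_ext oN _ Ck_h0 => -[x t] _; rewrite mxE.
  have cf := Ck_comp_real (f := fun q => h (join3 q) 0 0) oN _ Ck_h0 (CkW f1E).
  apply: Ck_ext oN _ (cf _) => [[x t] _|q Nq]; first by rewrite mxE.
  have [Eh _] := hB _ Nq; exists (fst3 (h (join3 q))) => //.
  by rewrite mxE.
(* The velocity property is needed at every label and time in the image of [h], because the Euler
   equations are required on a whole neighbourhood. *)
have lv z t : (h @` B) (join3 (z, t)) -> W z /\ local_velocity phi z t u.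
  move=> hBz; have Wz : W z.
    by case: hBz => w Bw hw; have [] := hB _ Bw; rewrite hw /= join3K.
  split=> //; split.
    exists N; split=> //; case: hBz => w Bw hw; have [_ Fh] := hB _ Bw.
    by rewrite /N /= -FE -hw Fh.
  have oP : open [set q : plane * R | (h @` B) (join3 q)].
    by apply: open_comp => // q _; exact: join3_continuous.
  have nP : nbhs (z, t) [set q : plane * R | (h @` B) (join3 q)] by exact: open_nbhs_nbhs.
  apply: filterS nP => -[z' t'] [w Bw hw] /=; split.
    have [dA _] := derive_A_normal t'.
    exact/diff_derivable/(motion_dt _ _ dA).1.
  have [_ Fh] := hB _ Bw.
  rewrite phi_dt /u -FE -hw Fh hw; apply/colP => i; rewrite !mxE.
  by move: i; apply: ord2P.
have hBy0 : (h @` B) y0 by exists (F y0) => //; exact: ballxx.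
exists u, (fun _ _ => 0); split; first exact: (lv z0 t0 hBy0).2.
have nN : nbhs (phi z0 t0, t0) N.
  by apply: open_nbhs_nbhs; split=> //; rewrite /N /= -FE; exact: ballxx.
apply: filterS nN => -[x t] Nxt /=; have [Eh Fh] := hB _ Nxt.
pose y := h (join3 (x, t)).
have [yt yx] : y 2 0 = t /\ phi (fst3 y) (y 2 0) = x.
  have := Fh; rewrite -/y /F => Fy.
  have := join3_2 (phi (fst3 y) (y 2 0), y 2 0); rewrite Fy join3_2 /= => ->.
  split=> //; have := join3K (phi (fst3 y) (y 2 0), y 2 0).
  by rewrite Fy join3K /= => ->.
have [Wz lvz] : W (fst3 y) /\ local_velocity phi (fst3 y) (y 2 0) u.
  by apply: lv; exists (join3 (x, t)) => //; rewrite fst3K.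
by have := normal_euler oW reg nondeg Wz lvz; rewrite yx yt.
Qed.

End Existence.

(** * Normal coordinates in the plane *)

Section Coordinates.
Context {R : realType}.
Local Notation plane := 'cV[R]_2.

Lemma jac_comp l m n (f : 'cV[R]_l -> 'cV[R]_m) (g : 'cV[R]_m -> 'cV[R]_n) x :
  differentiable f x -> differentiable g (f x) ->
  jac (g \o f) x = jac g (f x) *m jac f x.
Proof.
move=> df dg; have dgf : differentiable (g \o f) x by exact: differentiable_comp.
apply/matrixP => i j; rewrite [LHS]mxE -(derive_entry _ _ _ dgf).
by rewrite derive_comp// !derive_jac// mulmxA -colE mxE.
Qed.

Lemma gdet_comp (v : plane -> 'cV[R]_4) (h : plane -> plane) y i j :
  differentiable h y -> differentiable v (h y) ->
  gdet (v \o h) i j y = gdet v i j (h y) * \det (jac h y).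
Proof.
move=> dh dv; rewrite !gdetE jac_comp// det_mx22.
by rewrite !(mxE mulmx_key) !sum_ord2; ring.
Qed.

Lemma constraint_comp (v : plane -> 'cV[R]_4) (h : plane -> plane) y :
  differentiable h y -> differentiable v (h y) ->
  constraint v (h y) -> constraint (v \o h) y.
Proof.
move=> dh dv [c1 c2]; split; last by rewrite (gdet_comp 0 3 dh dv) c2 mul0r.
by rewrite (gdet_comp 0 2 dh dv) (gdet_comp 1 3 dh dv) -mulrDl c1 mul0r.
Qed.

(** Horizontal line at height [b]. A function with zero [z_2]-derivative on a ball is read off on
    the line through the centre; balls are squares here, so they contain the projections of their
    points to that line. *)
Definition hline (b s : R) : plane := \col_(i < 2) nth 0 [:: s; b] i.

Lemma hline_ball (y0 y : plane) e : ball y0 e y -> ball y0 e (hline (y0 1 0) (y 0 0)).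
Proof.
move=> [e0 b]; split=> // i j; rewrite ord1 mxE; move: i.
by apply: ord2P => /=; [exact: b|exact: ballxx].
Qed.

Lemma Ck_hline k (E : set R) b : open E -> Ck k E (hline b).
Proof.
move=> oE; apply: Ck_mx => // i j; rewrite ord1 {j}; move: i; apply: ord2P.
  apply: (Ck_ext (f := idfun) oE); first by move=> x _; rewrite mxE.
  by apply: Ck_lin => x; exact: cvg_id.
by apply: (Ck_ext (f := cst b) oE); [move=> x _; rewrite mxE|exact: Ck_cst].
Qed.

Lemma derive_vertical (F : plane -> R) (y w : plane) : differentiable F y -> w 0 0 = 0 ->
  'D_w F y = w 1 0 * pd 1 F y.
Proof. by move=> dF w0; rewrite derive_cV// sum_ord2 w0 mul0r add0r. Qed.

Lemma vertical_constant (F : plane -> R) (y0 y : plane) e : ball y0 e y ->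
  (forall y, ball y0 e y -> differentiable F y /\ pd 1 F y = 0) ->
  F y = F (hline (y0 1 0) (y 0 0)).
Proof.
move=> by_ dF; set l := hline _ _.
have <- : (y - l) + l = y by rewrite subrK.
apply: (@derive_eq0_ball _ _ F y0 e) => [x bx||]; last 2 first.
- exact: hline_ball.
- by rewrite subrK.
have [dFx pF] := dF _ bx; split=> //.
by rewrite derive_vertical ?pF ?mulr0// !mxE subrr.
Qed.

Section Local.
Variables (v : plane -> 'cV[R]_4) (y0 : plane) (e : R).
Local Notation W := (ball y0 e).
Local Notation E := [set z 0 0 | z in W].
Hypotheses (CV : Ck 2 W v) (v01 : forall y, W y -> v y 0 0 = y 0 0 /\ v y 1 0 = y 1 0)
  (cV : forall y, W y -> constraint v y).

Let oW : open W. Proof. exact: ball_open. Qed.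
Let oE : open E. Proof. exact: open_proj0. Qed.

(** The constraints become [jac v y 3 1 = 0] and [jac v y 2 1 = jac v y 3 0], so component 3, and
    component 2 minus [y 1 0] times [f1'], depend on the first coordinate only. As [f2] contains
    [f1'], it is obtained as a C^1 function. *)
Let f1 s := v (hline (y0 1 0) s) 3 0.
Let f2 s := v (hline (y0 1 0) s) 2 0 - y0 1 0 * derive1 f1 s.

Let EW s : E s -> W (hline (y0 1 0) s).
Proof. by move=> [y Wy <-]; exact: hline_ball. Qed.

Let Ckf i : Ck 2 E (fun s => v (hline (y0 1 0) s) i 0).
Proof.
have Ci : Ck 2 W (fun y => v y i 0) by exact: Ck_coord.
exact: (Ck_comp_mx (f := hline (y0 1 0)) oE EW (Ck_hline _ _ oE) Ci).
Qed.

Let dv y : W y -> differentiable v y. Proof. exact: CV.1. Qed.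

Let jac01 y : W y -> [/\ jac v y 0 0 = 1, jac v y 0 1 = 0, jac v y 1 0 = 0 & jac v y 1 1 = 1].
Proof.
move=> Wy; have nW : nbhs y W by exact: open_nbhs_nbhs.
have E0 k : jac v y 0 k = (delta_mx k 0 : plane) 0 0.
  rewrite mxE (near_eq_derive (g := coordf 0 0)); last first.
    by apply: filterS nW => x /v01[].
  exact: (linear_diffE y (delta_mx k 0) (@coordf_continuous R 2 1 0 0)).2.
have E1 k : jac v y 1 k = (delta_mx k 0 : plane) 1 0.
  rewrite mxE (near_eq_derive (g := coordf 1 0)); last first.
    by apply: filterS nW => x /v01[].
  exact: (linear_diffE y (delta_mx k 0) (@coordf_continuous R 2 1 1 0)).2.
by split; rewrite ?E0 ?E1 mxE.
Qed.

Let jac31 y : W y -> jac v y 3 1 = 0.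
Proof.
move=> Wy; have [J00 J01 _ _] := jac01 Wy; have [_] := cV Wy.
by rewrite gdetE J00 J01 mul1r mulr0 subr0.
Qed.

Let jac21 y : W y -> jac v y 2 1 = jac v y 3 0.
Proof.
move=> Wy; have [J00 J01 J10 J11] := jac01 Wy; have [+ _] := cV Wy.
rewrite !gdetE J00 J01 J10 J11 mul1r mulr0 subr0 mul0r mulr1 add0r.
by move=> /eqP; rewrite subr_eq0 => /eqP.
Qed.

Let v3E y : W y -> v y 3 0 = f1 (y 0 0).
Proof.
move=> Wy; apply: (vertical_constant (F := fun y => v y 3 0) Wy) => x Wx.
split; first by apply: differentiable_entry; exact: dv.
by have := jac31 Wx; rewrite mxE.
Qed.

Let jac30 y : W y -> jac v y 3 0 = derive1 f1 (y 0 0).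
Proof.
move=> Wy; have nW : nbhs y W by exact: open_nbhs_nbhs.
rewrite mxE (near_eq_derive (g := fun y : plane => f1 (y 0 0))); last first.
  by apply: filterS nW => x; exact: v3E.
rewrite derive_comp_coord0 ?mxE ?mul1r//.
by apply: (Ckf 3).1; exists y.
Qed.

Let v2E y : W y -> v y 2 0 = y 1 0 * derive1 f1 (y 0 0) + f2 (y 0 0).
Proof.
move=> Wy; pose G (x : plane) := v x 2 0 - x 1 0 * derive1 f1 (x 0 0).
have C1 : Ck 1 E (derive1 f1).
  have -> : derive1 f1 = 'D_1 f1 by apply/funext => s; rewrite derive1E.
  exact: (Ckf 3).2.
have -> : f2 (y 0 0) = G (hline (y0 1 0) (y 0 0)) by rewrite /G /f2 !mxE.
rewrite -(vertical_constant Wy (F := G)) ?/G; first by rewrite addrC subrK.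
move=> x Wx; have dv2 : differentiable (fun x => v x 2 0) x.
  by apply: differentiable_entry; exact: dv.
have df1' : differentiable (derive1 f1) (x 0 0) by apply: C1.1; exists x.
have [dc0 _] := linear_diffE x 0 (@coordf_continuous R 2 1 0 0).
have [dc1 Dc1] := linear_diffE x (delta_mx 1 0) (@coordf_continuous R 2 1 1 0).
pose h1 (y : plane) := derive1 f1 (y 0 0).
have dh1 : differentiable h1 x.
  exact: (differentiable_comp (f := @coordf R 2 1 0 0) dc0 df1').
have dp : differentiable (coordf 1 0 \* h1) x by exact: differentiableM.
split; first exact: (differentiableB (f := fun x => v x 2 0) dv2 dp).
rewrite /pd [LHS](@deriveB _ _ _ (fun x => v x 2 0) (coordf 1 0 \* h1)); [|exact: diff_derivable..].
rewrite deriveM; [|exact: diff_derivable..].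
rewrite Dc1 derive_comp_coord0// !mxE /= mul0r scaler0 add0r /h1 /GRing.scale /=.
have -> : coordf 1 0 (delta_mx 1 0 : plane) = 1 by rewrite /coordf mxE.
by have := jac21 Wx; rewrite jac30// [LHS]mxE => ->; rewrite mulr1 subrr.
Qed.

Lemma normal_form_of_graph : exists f1 f2, [/\ Ck 2 E f1, Ck 1 E f2 &
  forall y, W y -> v y = v_normal f1 f2 y].
Proof.
exists f1, f2; split; first exact: Ckf.
  have C1 : Ck 1 E (derive1 f1).
    have -> : derive1 f1 = 'D_1 f1 by apply/funext => s; rewrite derive1E.
    exact: (Ckf 3).2.
  apply: (CkD oE); first exact/CkW/Ckf.
  by apply: (CkN oE); apply: (CkM oE) C1; exact: Ck_cst.
move=> y Wy; have [v0 v1] := v01 Wy.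
apply/colP; apply: ord4P; rewrite mxE //=; [exact: v2E|exact: v3E].
Qed.

End Local.

Lemma normal_coordinates (D : set plane) (v : plane -> 'cV[R]_4) z0 :
  open D -> Ck 2 D v -> (forall z, D z -> constraint v z) ->
  D z0 -> gdet v 0 1 z0 != 0 ->
  exists (y0 : plane) (e : R) (Psi : plane -> plane) (f1 f2 : R -> R), let W := ball y0 e in let E := [set z 0 0 | z in W] in
  [/\ 0 < e, Psi y0 = z0 /\ Psi @` W `<=` D, coordinate_change W Psi,
      Ck 2 E f1 /\ Ck 1 E f2 & forall y, W y -> v (Psi y) = v_normal f1 f2 y].
Proof.
move=> oD Dv cD Dz0 g01.
(* [P] selects the first two components; [Psi] will be the local inverse of [z |-> (v^1, v^2)]. *)
pose P : 'M[R]_(2, 4) := \matrix_(i < 2, j < 4) (i == j :> nat)%:R.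
pose f z := P *m v z.
have fE z : f z 0 0 = v z 0 0 /\ f z 1 0 = v z 1 0.
  by rewrite /f !mxE !sum_ord4 !mxE /= !mul0r !mul1r !addr0 add0r.
have Df : Ck 2 D f by exact: (Ck_linl (L := @mulmxf R _ _ 1 P) oD (@mulmxf_continuous _ _ _ _ _)).
have Ju : jac f z0 \in unitmx.
  rewrite unitmxE unitfE det_mx22 jac_mulmxf; last exact: Dv.1.
  rewrite !(mxE mulmx_key) !sum_ord4 ![P _ _]mxE /= !mul0r !mul1r !addr0 !add0r.
  by move: g01; rewrite gdetE; apply: contra => /eqP <-; rewrite mulrC [X in _ - X]mulrC; apply/eqP; ring.
have [h [e [e0 hz0 /(_ e e0 (lexx _))[hD Ck_h oh]]]] := inverse_function oD Dz0 Df Ju.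
set W := ball _ _ in hD Ck_h oh.
have oW : open W by exact: ball_open.
have WD y : W y -> D (h y) by move=> /hD[].
have CV : Ck 2 W (v \o h) by exact: (Ck_comp_mxmx oW WD oD Ck_h Dv).
have V01 y : W y -> (v \o h) y 0 0 = y 0 0 /\ (v \o h) y 1 0 = y 1 0.
  by move=> /hD[_ fhy]; have [] := fE (h y); rewrite fhy.
have cV y : W y -> constraint (v \o h) y.
  move=> Wy; apply: constraint_comp; [exact: Ck_h.1|exact/Dv.1/WD|exact/cD/WD].
have [f1 [f2 [f1E f2E vE]]] := normal_form_of_graph CV V01 cV.
exists (f z0), e, h, f1, f2; split=> //.
  by split=> // _ [y Wy <-]; exact: WD.
split=> //; exists f; split; first by apply: Ck_sub Df => _ [y Wy <-]; exact: WD.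
by move=> y /hD[].
Qed.

End Coordinates.

(** * Linear independence of the two-forms of [v] *)

Section Independence.
Context {R : realType}.
Local Notation plane := 'cV[R]_2.

(** All open subsets [U] are covered because affine relations are derived inside charts, which may
    be small. *)
Definition nonaffine (D : set plane) (v : plane -> 'cV[R]_4) :=
  forall (U : set plane) (k : 'rV[R]_4) (c : R), open U -> U !=set0 -> U `<=` D ->
    (forall z, U z -> (k *m v z) 0 0 = c) -> k = 0.

(** By [key], two rows of the Jacobian parallel to a nonzero row 0 are parallel to each other. Rows
    1 and 3 are such, so [gdet v 1 3 = 0]; the constraint then gives [gdet v 0 2 = 0], and all rows
    are parallel. *)
Lemma gdet_degenerate (v : plane -> 'cV[R]_4) z : constraint v z -> gdet v 0 1 z = 0 ->
  jac v z 0 0 != 0 \/ jac v z 0 1 != 0 -> forall i j, gdet v i j z = 0.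
Proof.
move=> [c1 c2] g01 J0.
have key i j : jac v z 0 0 * gdet v i j z =
    jac v z i 0 * gdet v 0 j z - jac v z j 0 * gdet v 0 i z /\
    jac v z 0 1 * gdet v i j z =
    jac v z i 1 * gdet v 0 j z - jac v z j 1 * gdet v 0 i z.
  by rewrite !gdetE; split; ring.
have cancel i j : gdet v 0 i z = 0 -> gdet v 0 j z = 0 -> gdet v i j z = 0.
  move=> gi gj; have [+ +] := key i j; rewrite gi gj !mulr0 !subr0.
  by case: J0 => J0; [move=> + _|move=> _]; move/eqP; rewrite mulf_eq0 (negbTE J0) => /eqP.
have g13 := cancel 1 3 g01 c2.
have g02 : gdet v 0 2 z = 0 by move: c1; rewrite g13 addr0.
have g00 : gdet v 0 0 z = 0 by rewrite gdetE subrr.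
have g0 i : gdet v 0 i z = 0 by move: i; apply: ord4P.
by move=> i j; exact: cancel.
Qed.

Lemma jac_row_constant n (v : plane -> 'cV[R]_n) (i : 'I_n) y0 e :
  (forall y, ball y0 e y -> [/\ differentiable v y, jac v y i 0 = 0 & jac v y i 1 = 0]) ->
  forall y, ball y0 e y -> v y i 0 = v y0 i 0.
Proof.
move=> vy y by_; have e0 : 0 < e by case: by_.
rewrite -(subrK y0 y); apply: (@derive_eq0_ball _ _ (fun y => v y i 0) y0 e).
- move=> x bx; have [dv J0 J1] := vy _ bx; split; first exact: differentiable_entry.
  rewrite -derive_entry// derive_jac// mxE sum_ord2 J0 J1 !mul0r addr0//.
- exact: ballxx.
- by rewrite subrK.
Qed.

Lemma proj0_ball (y0 : plane) (e s : R) : 0 < e ->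
  ball (y0 0 0) e s <-> [set z 0 0 | z in ball y0 e] s.
Proof.
move=> e0; split=> [bs|[y [_ b_y] <-]]; last exact: b_y.
exists (hline (y0 1 0) s); last by rewrite mxE.
split=> // i j; rewrite ord1 mxE; move: i.
by apply: ord2P => //=; exact: ballxx.
Qed.

Lemma affine_of_derive2 (f : R -> R) (s0 e : R) : 0 < e -> Ck 2 (ball s0 e) f ->
  (forall s, ball s0 e s -> derive1 (derive1 f) s = 0) ->
  forall s, ball s0 e s -> f s = derive1 f s0 * s + (f s0 - derive1 f s0 * s0).
Proof.
move=> e0 [df d2f] f2 s bs.
have d1E : derive1 f = 'D_1 f by apply/funext => x; rewrite derive1E.
have df' x : ball s0 e x -> differentiable (derive1 f) x.
  by move=> bx; rewrite d1E; exact: (d2f 1).1.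
have dh (g : R -> R) x (h : R) : differentiable g x -> 'D_h g x = h * derive1 g x.
  by move=> dg; rewrite derive1E -deriveZdir// /GRing.scale /= mulr1.
have bs0 : ball s0 e s0 by exact: ballxx.
have c1 x : ball s0 e x -> derive1 f x = derive1 f s0.
  move=> bx; rewrite -(subrK s0 x); apply: (@derive_eq0_ball _ _ (derive1 f) s0 e) => //.
    by move=> y b_y; split; [exact: df'|rewrite dh ?f2 ?mulr0//; exact: df'].
  by rewrite subrK.
pose F x := f x - derive1 f s0 * x.
suff : F s = F s0 by rewrite /F => /eqP; rewrite subr_eq => /eqP ->; ring.
rewrite -[in LHS](subrK s0 s); apply: (@derive_eq0_ball _ _ F s0 e) => //; last by rewrite subrK.
move=> y b_y; have dfy : differentiable f y by exact: df.
have [dl Dl] : differentiable (fun x : R => derive1 f s0 * x) y /\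
    'D_(s - s0) (fun x : R => derive1 f s0 * x) y = derive1 f s0 * (s - s0).
  have did : differentiable (@id R) y by exact: ex_diff.
  split; first exact: (differentiableZ (derive1 f s0) did).
  rewrite [LHS](@deriveZ _ _ _ (@id R)); last exact: diff_derivable.
  by rewrite derive_id.
split; first exact: (differentiableB dfy dl).
rewrite [LHS](@deriveB _ _ _ f); [|exact: diff_derivable..].
by rewrite Dl dh// c1// mulrC subrr.
Qed.

Section Chart.
Variables (D : set plane) (v : plane -> 'cV[R]_4).
Hypotheses (oD : open D) (Dv : Ck 2 D v) (cD : forall z, D z -> constraint v z)
  (ND : nonaffine D v) (gD : forall z, D z -> exists i j, gdet v i j z != 0).

(** If [gdet v 0 1] vanished on [U], then, some other minor being nonzero, [gdet_degenerate] would
    make the gradient of component 0 vanish; constancy of this component is an affine relation. *)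
Lemma gdet01_dense U : open U -> U !=set0 -> U `<=` D ->
  exists2 z, U z & gdet v 0 1 z != 0.
Proof.
move=> oU [z0 Uz0] UD; apply: contrapT => no.
have g01 z : U z -> gdet v 0 1 z = 0.
  by move=> Uz; apply/eqP; apply: contrapT => /negP g; apply: no; exists z.
have J0 z : U z -> jac v z 0 0 = 0 /\ jac v z 0 1 = 0.
  move=> Uz; have [i [j gij]] := gD (UD _ Uz).
  have [J|/negP] := boolP ((jac v z 0 0 != 0) || (jac v z 0 1 != 0)).
    have := gdet_degenerate (cD (UD _ Uz)) (g01 _ Uz) (orP J) i j.
    by move/eqP; rewrite (negbTE gij).
  by move/negP; rewrite negb_or !negbK => /andP[/eqP ? /eqP].
have /nbhs_ballP[e /= e0 be] : nbhs z0 U by exact: open_nbhs_nbhs.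
have := @ND (ball z0 e) (delta_mx 0 0) (v z0 0 0) _ _ _ _.
move=> /(_ (ball_open _ _)) /(_ _) /(_ (fun z bz => UD _ (be z bz))) H.
have : delta_mx 0 0 = 0 :> 'rV[R]_4.
  apply: H; first by exists z0; exact: ballxx.
  move=> z bz; rewrite -rowE mxE.
  apply: (jac_row_constant (v := v) (e := e)) bz => y b_y.
  have Uy := be _ b_y; have [? ?] := J0 _ Uy.
  by split=> //; exact/Dv.1/UD.
by move=> /matrixP/(_ 0 0)/eqP; rewrite !mxE !eqxx oner_eq0.
Qed.

Definition is_chart (y0 : plane) (e : R) (Psi : plane -> plane) (f1 f2 : R -> R) :=
  let W := ball y0 e in let E := [set z 0 0 | z in W] in
  [/\ 0 < e, Psi @` W `<=` D, coordinate_change W Psi,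
      Ck 2 E f1 /\ Ck 1 E f2 & forall y, W y -> v (Psi y) = v_normal f1 f2 y].

(** Otherwise [f1] is affine, and component 3 of [v] minus [al] times component 0 is constant on the
    open image of the chart. *)
Lemma curved_chart : D !=set0 -> exists y0 e Psi f1 f2,
  is_chart y0 e Psi f1 f2 /\
  exists2 s, ball (y0 0 0) e s & derive1 (derive1 f1) s != 0.
Proof.
move=> /(gdet01_dense oD) /(_ (@subset_refl _ D))[z0 Dz0 g01].
have [y0 [e [Psi [f1 [f2 [e0 [Pz PD] Pc [f1E f2E] vE]]]]]] :=
  normal_coordinates oD Dv cD Dz0 g01.
exists y0, e, Psi, f1, f2; split; first by split.
apply: contrapT => no.
have f2_0 s : ball (y0 0 0) e s -> derive1 (derive1 f1) s = 0.
  by move=> bs; apply/eqP; apply: contrapT => /negP ns; apply: no; exists s.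
have f1B : Ck 2 (ball (y0 0 0) e) f1.
  by apply: Ck_sub f1E => s /(proj0_ball _ _ e0).
have f1A := affine_of_derive2 e0 f1B f2_0.
pose al := derive1 f1 (y0 0 0); pose be := f1 (y0 0 0) - al * y0 0 0.
pose k : 'rV[R]_4 := delta_mx 0 3 - al *: delta_mx 0 0.
have : k = 0.
  have [oW oPW _ _] := Pc.
  apply: (@ND (Psi @` ball y0 e) k be) => //.
    by exists (Psi y0); exists y0 => //; exact: ballxx.
  move=> _ [y Wy <-]; rewrite mulmxBl -scalemxAl -!rowE !mxE vE// !mxE /=.
  rewrite f1A; first by rewrite /be /al; ring.
  by apply/(proj0_ball _ _ e0); exists y.
by move=> /matrixP/(_ 0 3)/eqP; rewrite !mxE /= mulr0 subr0 oner_eq0.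
Qed.

(** In a chart the relation reads [a + b p - c K - d p^2 = 0] with [p = f1']. Above a point with
    [f1'' <> 0] only [K] varies with the second coordinate, so [c = 0]; dividing the derivative by
    [p'] and differentiating again gives [d = 0], then [b] and [a] follow. *)
Lemma gdet_independent (a b c d : R) : D !=set0 ->
  (forall z, D z -> a * gdet v 0 1 z + b * gdet v 0 2 z + c * gdet v 1 2 z
                    + d * gdet v 2 3 z = 0) ->
  [/\ a = 0, b = 0, c = 0 & d = 0].
Proof.
move=> D0 rel; have [y0 [e [Psi [f1 [f2 [[e0 PD Pc reg vE] [s0 bs0 f1s0]]]]]]] :=
  curved_chart D0.
set W := ball y0 e in PD Pc reg vE; have oW : open W by exact: ball_open.
have [f1E _] := reg; set E := [set _ | _ in _] in reg f1E.
pose K (y : plane) := y 1 0 * derive1 (derive1 f1) (y 0 0) + derive1 f2 (y 0 0).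
pose p := derive1 f1.
have relW y : W y -> a + b * p (y 0 0) - c * K y - d * (p (y 0 0) * p (y 0 0)) = 0.
  move=> Wy; have DPy : D (Psi y) by apply: PD; exists y.
  have [_ _ CP _] := Pc.
  have dP : differentiable Psi y by exact: CP.1.
  have dv : differentiable v (Psi y) by exact: Dv.1.
  have gE i j : gdet v i j (Psi y) * \det (jac Psi y) = gdet (v_normal f1 f2) i j y.
    rewrite -gdet_comp// !gdetE.
    suff -> : jac (v \o Psi) y = jac (v_normal f1 f2) y by [].
    apply/matrixP => i' j'; rewrite !mxE; apply: near_eq_derive.
    have nW : nbhs y W by exact: open_nbhs_nbhs.
    by apply: filterS nW => x Wx; rewrite /= vE.
  have := congr1 (fun x => x * \det (jac Psi y)) (rel _ DPy).
  rewrite mul0r !mulrDl -!mulrA !gE !gdetE (jac_v_normal oW reg Wy) !mxE /= => <-.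
  by rewrite /K /p; ring.
have c0 : c = 0.
  (* Two points above the same [s0]; the height difference [e / 2] keeps the second one in the
     ball. *)
  pose y1 := hline (y0 1 0) s0; pose y2 := hline (y0 1 0 + e / 2) s0.
  have [Wy1 Wy2] : W y1 /\ W y2.
    split; split=> // i j; rewrite ord1 mxE; move: i; apply: ord2P => //=.
      exact: ballxx.
    rewrite /ball /= /ball_ /= opprD addrA subrr add0r normrN gtr0_norm ?divr_gt0//.
    by rewrite ltr_pdivrMr// ltr_pMr// ltr1n.
  have := relW _ Wy1; have := relW _ Wy2; rewrite /K !mxE /= => r2 r1.
  have e2 : e / 2 * derive1 (derive1 f1) s0 != 0.
    by rewrite mulf_neq0// lt0r_neq0// divr_gt0.
  apply: (mulIf e2); rewrite mul0r -[RHS](subrr 0) -{1}r1 -r2; by ring.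
have relS s : ball (y0 0 0) e s -> a + b * p s - d * (p s * p s) = 0.
  by move=> /(proj0_ball _ _ e0)[y Wy <-]; have := relW _ Wy; rewrite c0 mul0r subr0.
have f1B : Ck 2 (ball (y0 0 0) e) f1 by apply: Ck_sub f1E => s /(proj0_ball _ _ e0).
have pE : p = 'D_1 f1 by apply/funext => x; rewrite /p derive1E.
have pB : Ck 1 (ball (y0 0 0) e) p by rewrite pE; exact: f1B.2.
have oB : open (ball (y0 0 0) e) by exact: ball_open.
have dp s : ball (y0 0 0) e s -> is_derive s 1 p (derive1 p s).
  by move=> bs; rewrite derive1E; apply: DeriveDef => //; apply: diff_derivable; exact: pB.1.
have relD s : ball (y0 0 0) e s -> (b - 2 * d * p s) * derive1 p s = 0.
  move=> bs; have dps := dp _ bs.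
  have [_ D1] := is_derive_sub (is_derive_add (is_derive_cstR a s) (is_derive_scal b dps))
    (is_derive_scal d (is_derive_prod dps dps)).
  have : 'D_1 (fun s => a + b * p s - d * (p s * p s)) s = 0.
    rewrite (near_eq_derive (g := cst 0)) ?derive_cst//.
    by apply: filterS (open_nbhs_nbhs (conj oB bs)) => x bx; exact: relS.
  by rewrite D1 => <-; ring.
have c2p : {for s0, continuous (derive1 p)}.
  have -> : derive1 p = 'D_1 p by apply/funext => x; rewrite derive1E.
  exact: pB.2.
have nz : \forall s \near s0, derive1 p s != 0.
  have N : nbhs (derive1 p s0) [set x : R | x != 0].
    by apply: open_nbhs_nbhs; split; [exact: open_neq|exact: f1s0].
  exact: (c2p _ N).
have near0 : \forall s \near s0, b - 2 * d * p s = 0.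
  apply: filterS2 nz (open_nbhs_nbhs (conj oB bs0)) => s nzs bs.
  by apply: (mulIf nzs); rewrite mul0r relD.
have d0 : d = 0.
  have dps := dp _ bs0.
  have [_ D1] := is_derive_sub (is_derive_cstR b s0) (is_derive_scal (2 * d) dps).
  have : 'D_1 (fun s => b - 2 * d * p s) s0 = 0.
    by rewrite (near_eq_derive (g := cst 0)) ?derive_cst.
  rewrite D1 sub0r => /eqP; rewrite oppr_eq0 mulf_eq0 (negbTE f1s0) orbF.
  by rewrite mulf_eq0 pnatr_eq0 /= => /eqP.
have b0 : b = 0 by have := nbhs_singleton near0; rewrite d0 mulr0 mul0r subr0.
split=> //; have := relS _ bs0.
by rewrite b0 d0 !mul0r addr0 subr0.
Qed.

End Chart.
End Independence.

(** * Consequences of the Euler equations *)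

Section Euler_constraints.
Context {R : realType}.
Local Notation plane := 'cV[R]_2.
Implicit Types (u : plane -> R -> plane) (M N : 'M[R]_(2, 4)).

Lemma continuous_pair_cst (T S S' : topologicalType) (f : T -> S) (c : S') (x : T) :
  {for x, continuous f} -> {for x, continuous (fun y => (f y, c))}.
Proof. by move=> cf; apply: cvg_pair => /=; [exact: cf|exact: cvg_cst]. Qed.

Lemma local_velocity_near (phi : plane -> R -> plane) (z0 : plane) (t0 : R) u :
  {for z0, continuous (phi ^~ t0)} -> local_velocity phi z0 t0 u ->
  \forall z \near z0, local_velocity phi z t0 u.
Proof.
move=> cphi [] [N [oN Nz Nu]] /nbhs_interior/near_pair_fst near_u.
have c2 := continuous_pair_cst (c := t0) cphi.
have nN : \forall z \near z0, N (phi z t0, t0).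
  have N' : nbhs (phi z0 t0, t0) N by exact: open_nbhs_nbhs.
  exact: (c2 N N').
by apply: filterS2 nN near_u => z Nz' uz; split=> //; exists N.
Qed.

(* [N] stands for the time derivative of [M] in [dminor], and for its first or
   second derivative in [wronskian]; [wronskian M'' M] is the derivative of
   [wronskian M' M]. *)
Definition dminor N M i j :=
  N 0 i * M 1 j + M 0 i * N 1 j - N 0 j * M 1 i - M 0 j * N 1 i.

Definition wronskian N M i j :=
  N 0 i * M 0 j + N 1 i * M 1 j - N 0 j * M 0 i - N 1 j * M 1 i.

(** Compares the two mixed derivatives of the pulled-back pressure: the mixed derivatives of the
    motion agree by [s0 = s0'] and [s1 = s1'], and only products of first derivatives remain. *)
Let swap_cancel (y0 y1 s0 s0' s1 s1' a0 a1 b0 b1 c0 c1 d0 d1 : R) :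
  s0 = s0' -> s1 = s1' ->
  - (y0 * s0 + a0 * b0 + (y1 * s1 + a1 * b1)) =
  - (y0 * s0' + c0 * d0 + (y1 * s1' + c1 * d1)) ->
  a0 * b0 + a1 * b1 - c0 * d0 - c1 * d1 = 0.
Proof. by move=> -> ->; lra. Qed.

(** Jacobi's formula: for [X' = U X] the right-hand side is the derivative of [\det X]. *)
Lemma trace_det (U X : 'M[R]_2) : let Y := U *m X in
  (U 0 0 + U 1 1) * \det X =
  Y 0 0 * X 1 1 + X 0 0 * Y 1 1 - Y 0 1 * X 1 0 - X 0 1 * Y 1 0.
Proof. by rewrite /= det_mx22 !mxE !sum_ord2; ring. Qed.

Variables (D : set plane) (I : set R) (A : R -> 'M[R]_(2, 4)) (v : plane -> 'cV[R]_4).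
Hypotheses (oD : open D) (oI : open I) (IA : Ck 2 I A) (Dv : Ck 2 D v)
  (cD : forall z, D z -> constraint v z) (sol : is_solution D I (motion A v)).
Local Notation phi := (motion A v).
Local Notation A' := (fun t => 'D_1 A t).
Local Notation A'' := (fun t => 'D_1 (fun s => 'D_1 A s) t).

Let dv z : D z -> differentiable v z. Proof. exact: Dv.1. Qed.
Let dA t : I t -> differentiable A t. Proof. exact: IA.1. Qed.

(** The gradient of [u] has trace zero, so by [trace_det] the time derivative of [\det (A *m jac v)]
    vanishes. In its Cauchy-Binet expansion the constraints delete [g 0 3] and replace [g 1 3] by
    [- g 0 2]. *)
Lemma euler_minor z t : D z -> I t ->
  let g i j := gdet v i j z in let d := dminor (A' t) (A t) in
  d 0 1 * g 0 1 + (d 0 2 - d 1 3) * g 0 2 + d 1 2 * g 1 2 + d 2 3 * g 2 3 = 0.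
Proof.
move=> Dz It g d; have [u [p [lv eu]]] := sol Dz It.
have [_ _ div] : euler_at u p (phi z t) t by exact: nbhs_singleton eu.
have [dphi Jphi] := motion_dz A t (dv Dz).
have := velocity_space lv dphi; rewrite Jphi.
have -> : (fun y => 'D_1 (phi y) t) = (fun y => A' t *m v y).
  by apply/funext => y; rewrite (motion_dt v y (dA It)).2.
rewrite jac_mulmxf; last exact: dv.
set U := jac (u ^~ t) _ => E.
have trU : U 0 0 + U 1 1 = 0 by rewrite -[RHS]div sum_ord2 !mxE.
have := trace_det U (A t *m jac v z); rewrite trU mul0r /= -E.
have [g13 g03] := cD Dz.
have {}g13 : g 1 3 = - g 0 2 by apply/eqP; rewrite -addr_eq0 addrC; apply/eqP.
have {}g03 : g 0 3 = 0 by [].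
move=> H; transitivity (d 0 1 * g 0 1 + d 0 2 * g 0 2 + d 0 3 * g 0 3
  + d 1 2 * g 1 2 + d 1 3 * g 1 3 + d 2 3 * g 2 3); first by rewrite g13 g03; ring.
rewrite H /g !gdetE !(mxE mulmx_key) !sum_ord4 /d /dminor.
by ring.
Qed.

(** At fixed time the pulled-back pressure satisfies [dP = - sum_r Y_r dX_r] with [X = A v] and
    [Y = A'' v]. Its exterior derivative is [sum_r dY_r ^ dX_r = 0], whose coefficients in the
    two-forms of [v] are the Wronskians. *)
Lemma euler_wronskian z t : D z -> I t ->
  let g i j := gdet v i j z in let d := wronskian (A'' t) (A t) in
  d 0 1 * g 0 1 + (d 0 2 - d 1 3) * g 0 2 + d 1 2 * g 1 2 + d 2 3 * g 2 3 = 0.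
Proof.
move=> Dz It g d; have [u [p [lv eu]]] := sol Dz It.
have [dphi Jphi] := motion_dz A t (dv Dz).
have cphi : {for z, continuous (phi ^~ t)} by exact: differentiable_continuous.
have nlv := local_velocity_near cphi lv.
have neu : \forall y \near z, euler_at u p (phi y t) t.
  exact: (continuous_pair_cst (c := t) cphi) eu.
have nD : nbhs z D by exact: open_nbhs_nbhs.
have [e /= e0 be] := (nbhs_ballP z _).1 (filterI nD (filterI nlv neu)).
pose B := ball z e; have oB : open B by exact: ball_open.
have Bz : B z by exact: ballxx.
have BD : B `<=` D by move=> y /be[].
pose P y := p (phi y t) t.
pose X r y := (A t *m v y) r 0; pose Y r y := (A'' t *m v y) r 0.
have CMv (M : 'M[R]_(2, 4)) : Ck 2 B (fun y => M *m v y).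
  exact: (Ck_linl (L := @mulmxf R _ _ 1 M) oB (@mulmxf_continuous _ _ _ _ _) (Ck_sub BD Dv)).
have CX r : Ck 2 B (X r) by exact: Ck_coord.
have CY r : Ck 2 B (Y r) by exact: Ck_coord.
have acc y r : B y -> pd r (fun x => p x t) (phi y t) = - Y r y.
  move=> By; have [_ [lvy [_ eq _]]] := be _ By.
  have := eq r; rewrite -(material_derivative r lvy) => /eqP.
  rewrite addrC addr_eq0 => /eqP ->; congr (- (_ r 0)).
  have -> : A'' t *m v y = 'D_1 (fun s => A' s *m v y) t.
    have dA' : differentiable (fun s => 'D_1 A s) t by exact: (IA.2 1).1.
    have := derive_lin (1 : R) (@linear_mx_continuous R _ _ _ (@mulmxrf R 2 4 1 (v y))) dA'.
    by move=> ->.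
  rewrite (near_eq_derive (g := fun s => 'D_1 A s *m v y))//.
  apply: filterS (open_nbhs_nbhs (conj oI It)) => s Is.
  exact: (motion_dt v y (dA Is)).2.
have DP y w : B y -> differentiable P y /\
    'D_w P y = - (Y 0 y * 'D_w (X 0) y + Y 1 y * 'D_w (X 1) y).
  move=> By; have [Dy [lvy [dp _ _]]] := be _ By.
  have dXX : differentiable (fun y => A t *m v y) y by exact: (CMv _).1.
  split; first exact: (differentiable_comp (f := fun y => A t *m v y) dXX dp).
  have -> : 'D_w P y = 'D_w ((fun x => p x t) \o (fun y => A t *m v y)) y by [].
  rewrite derive_comp// derive_cV// sum_ord2 !derive_entry//.
  rewrite -!/(pd _ _ _) (acc y 0 By) (acc y 1 By).
  by rewrite !mulrN -opprD mulrC [X in _ + X]mulrC.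
have CDP w : Ck 1 B (fun y => - (Y 0 y * 'D_w (X 0) y + Y 1 y * 'D_w (X 1) y)).
  apply: (CkN oB); apply: (CkD oB); apply: (CkM oB).
  - exact/CkW/CY.
  - exact: (CX 0).2.
  - exact/CkW/CY.
  - exact: (CX 1).2.
(* [p] is only known to be differentiable, but the formula for the derivatives of [P] is C^1; hence
   [P] is C^2 and [derive_swap] applies. *)
have CP : Ck 2 B P.
  split=> [y By|w]; first by case: (DP y 0 By).
  by apply: (Ck_ext oB _ (CDP w)) => y By; have [_ ->] := DP y w By.
have swapP := derive_swap (delta_mx 0 0) (delta_mx 1 0) oB Bz CP.
have DDP w w' : 'D_w' ('D_w P) z =
   - (Y 0 z * 'D_w' ('D_w (X 0)) z + 'D_w (X 0) z * 'D_w' (Y 0) z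
    + (Y 1 z * 'D_w' ('D_w (X 1)) z + 'D_w (X 1) z * 'D_w' (Y 1) z)).
  have dY r : derivable (Y r) z w' by apply: diff_derivable; exact: (CY r).1.
  have dX r : derivable ('D_w (X r)) z w' by apply: diff_derivable; exact: ((CX r).2 w).1.
  rewrite (near_eq_derive (f := 'D_w P) (g := - (Y 0 * 'D_w (X 0) + Y 1 * 'D_w (X 1)))); last first.
    by apply: filterS (open_nbhs_nbhs (conj oB Bz)) => y By; rewrite (DP y w By).2 !fctE.
  rewrite deriveN; last by apply: derivableD; exact: derivableM.
  rewrite deriveD; [|exact: derivableM..].
  by rewrite (deriveM (dY 0) (dX 0)) (deriveM (dY 1) (dX 1)).
have swapX r := derive_swap (delta_mx 0 0) (delta_mx 1 0) oB Bz (CX r).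
have := etrans (etrans (esym (DDP (delta_mx 0 0) (delta_mx 1 0))) swapP)
  (DDP (delta_mx 1 0) (delta_mx 0 0)).
move/(swap_cancel (swapX 0) (swapX 1)).
have jE (M : 'M[R]_(2, 4)) r k : 'D_(delta_mx k 0) (fun y => (M *m v y) r 0) z = (M *m jac v z) r k.
  by rewrite -(jac_mulmxf M (dv Dz)) [RHS]mxE.
rewrite (jE _ 0 0) (jE _ 1 0) (jE _ 0 1) (jE _ 1 1) (jE _ 0 0) (jE _ 1 0) (jE _ 0 1) (jE _ 1 1) => H.
have [g13 g03] := cD Dz.
have {}g13 : g 1 3 = - g 0 2 by apply/eqP; rewrite -addr_eq0 addrC; apply/eqP.
have {}g03 : g 0 3 = 0 by [].
apply: oppr_inj; rewrite oppr0 -[RHS]H.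
transitivity (- (d 0 1 * g 0 1 + d 0 2 * g 0 2 + d 0 3 * g 0 3
  + d 1 2 * g 1 2 + d 1 3 * g 1 3 + d 2 3 * g 2 3)); first by rewrite g13 g03; ring.
rewrite /g !gdetE !(mxE mulmx_key) !sum_ord4 /d /wronskian.
by ring.
Qed.

End Euler_constraints.

(** * Constant relations and the number of columns *)

Section Fewer_columns.
Context {R : realType}.
Local Notation plane := 'cV[R]_2.

Lemma mulmx_col'_row' (j : 'I_4) (M : 'M[R]_(2, 4)) (x : 'cV[R]_4) :
  M *m x = col' j M *m row' j x + x j 0 *: col j M.
Proof.
apply/matrixP => a b; rewrite ord1 !mxE (bigD1_ord j)//= addrC; congr (_ + _).
  by apply: eq_bigr => i _; rewrite !mxE.
by rewrite mulrC.
Qed.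

Variables (D : set plane) (I : set R) (A : R -> 'M[R]_(2, 4)) (v : plane -> 'cV[R]_4).
Hypotheses (oI : open I) (IA : Ck 2 I A) (Dv : Ck 2 D v)
  (NF : forall U : set plane, open U -> U !=set0 -> U `<=` D ->
        ~ fewer_columns U I (motion A v)).

(** If [k j 0 != 0], a multiple of the kernel vector [k] can be subtracted from [v z] so that
    component [j] vanishes; column [j] then drops out. *)
Lemma columns_independent (k : 'cV[R]_4) : open D -> D !=set0 ->
  (forall t, I t -> A t *m k = 0) -> k = 0.
Proof.
move=> oD D0 Ak; apply/eqP; apply: contrapT => /negP/cV0Pn [j kj].
apply: (NF oD D0 (@subset_refl _ D)).
(* [2] means three columns, as [fewer_columns] counts [k.+1]. *)
exists 2%N; split=> //.
exists (fun t => col' j (A t)), (fun z => row' j (v z - (v z j 0 / k j 0) *: k)), (cst 0).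
split.
- apply: Ck_mx => // a b.
  apply: (Ck_ext oI _ (Ck_coord a (lift j b) oI IA)) => t _.
  by rewrite mxE.
- apply: Ck_mx => // a b.
  have C i : Ck 2 D (fun z => v z i 0) by exact: Ck_coord.
  apply: (Ck_ext oD _ (CkD oD (C (lift j a)) (CkM oD (C j)
    (@Ck_cst _ 2 _ _ D (- (k (lift j a) 0 / k j 0)))))) => z _.
  by rewrite !mxE ord1 /cst mulrN mulrA mulrAC.
- exact: Ck_cst.
move=> z t _ It; set w := v z - _.
have -> : motion A v z t = A t *m w.
  by rewrite /motion /w mulmxBr -scalemxAr Ak// scaler0 subr0.
rewrite (mulmx_col'_row' j) {3}/w !mxE mulfVK// subrr scale0r.
by [].
Qed.

(** Dual to the previous elimination: an affine relation expresses component [j] through the others.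
    Multiples of column [j] are subtracted from the columns of [A], and the constant [c] turns into
    a time-dependent translation. *)
Lemma motion_nonaffine : nonaffine D v.
Proof.
move=> U k c oU U0 UD kv; apply/eqP; apply: contrapT => /negP/rV0Pn [j kj].
apply: (NF oU U0 UD); exists 2%N; split=> //.
exists (fun t => col' j (A t - (k 0 j)^-1 *: (col j (A t) *m k))),
  (fun z => row' j (v z)), (fun t => (c / k 0 j) *: col j (A t)).
have CA a b : Ck 2 I (fun t => A t a b) by exact: Ck_coord.
split.
- apply: Ck_mx => // a b.
  apply: (Ck_ext oI _ (CkD oI (CA a (lift j b)) (CkM oI (CA a j)
    (@Ck_cst _ 2 _ _ I (- (k 0 (lift j b) / k 0 j)))))) => t _.
  rewrite !mxE big_ord1 !mxE /cst mulrN; congr (_ - _).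
  by rewrite mulrA mulrC.
- apply: Ck_mx => // a b; apply: (@Ck_ext _ _ _ _ U (fun z => v z (lift j a) 0)) => //.
    by move=> z _; rewrite !mxE ord1.
  exact: (Ck_coord (lift j a) 0 oU (Ck_sub UD Dv)).
- apply: Ck_mx => // a b.
  apply: (Ck_ext oI _ (CkM oI (@Ck_cst _ 2 _ _ I (c / k 0 j)) (CA a j))) => t _.
  by rewrite !mxE.
move=> z t Uz It; rewrite /motion; set M := A t - _.
have -> : A t *m v z = M *m v z + (c / k 0 j) *: col j (A t).
  rewrite /M mulmxBl -scalemxAl -mulmxA [k *m v z]mx11_scalar kv// mul_mx_scalar.
  by rewrite scalerA [_^-1 * c]mulrC subrK.
rewrite (mulmx_col'_row' j M).
have -> : col j M = 0.
  by apply/colP => a; rewrite !mxE big_ord1 !mxE [_ * k 0 j]mulrC mulKf ?subrr.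
by rewrite scaler0 addr0.
Qed.

Lemma gdet_nonzero z t : D z -> I t -> \det (jac (motion A v ^~ t) z) != 0 ->
  exists i j, gdet v i j z != 0.
Proof.
move=> Dz It; rewrite (motion_dz A t (Dv.1 _ Dz)).2 => dn.
apply: contrapT => no; move: dn; rewrite det_mx22.
have g0 i j : jac v z i 0 * jac v z j 1 = jac v z j 0 * jac v z i 1.
  apply/eqP; rewrite -subr_eq0 -gdetE; apply: contrapT => /negP g.
  by apply: no; exists i, j.
rewrite !(mxE mulmx_key) !sum_ord4; apply/negP; rewrite negbK; apply/eqP.
have e01 := g0 0 1; have e02 := g0 0 2; have e03 := g0 0 3.
have e12 := g0 1 2; have e13 := g0 1 3; have e23 := g0 2 3.
move: (jac v z) e01 e02 e03 e12 e13 e23 => J e01 e02 e03 e12 e13 e23.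
transitivity ((A t 0 0 * A t 1 1 - A t 0 1 * A t 1 0) * (J 0 0 * J 1 1 - J 1 0 * J 0 1)
 + (A t 0 0 * A t 1 2 - A t 0 2 * A t 1 0) * (J 0 0 * J 2 1 - J 2 0 * J 0 1)
 + (A t 0 0 * A t 1 3 - A t 0 3 * A t 1 0) * (J 0 0 * J 3 1 - J 3 0 * J 0 1)
 + (A t 0 1 * A t 1 2 - A t 0 2 * A t 1 1) * (J 1 0 * J 2 1 - J 2 0 * J 1 1)
 + (A t 0 1 * A t 1 3 - A t 0 3 * A t 1 1) * (J 1 0 * J 3 1 - J 3 0 * J 1 1)
 + (A t 0 2 * A t 1 3 - A t 0 3 * A t 1 2) * (J 2 0 * J 3 1 - J 3 0 * J 2 1)).
  by ring.
by rewrite e01 e02 e03 e12 e13 e23 !subrr !mulr0 !addr0.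
Qed.

End Fewer_columns.

(** * The time-dependent factor *)

Section Interval_calculus.
Context {R : realType}.
Variables (I : set R).
Hypotheses (oI : open I) (iI : is_interval I).

Lemma constant_on_interval (g : R -> R) : (forall t, I t -> is_derive t 1 g 0) ->
  forall s t, I s -> I t -> g t = g s.
Proof.
move=> dg s t Is It; have Iseg (u : R) : u \in `[0, 1] -> I (u *: (t - s) + s).
  rewrite in_itv /= => /andP[u0 u1]; rewrite /GRing.scale /=.
  have [st|/ltW ts] := leP s t.
    have d0 : 0 <= t - s by rewrite subr_ge0.
    apply: (iI Is It); rewrite lerDr mulr_ge0//= -lerBrDr.
    by rewrite -[leRHS]mul1r ler_wpM2r.
  have d0 : 0 <= s - t by rewrite subr_ge0.
  have um : 0 <= u * (s - t) by rewrite mulr_ge0.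
  have ul : u * (s - t) <= s - t by rewrite -[leRHS]mul1r ler_wpM2r.
  by apply: (iI It Is); apply/andP; split; lra.
have dgt u : I u -> differentiable g u.
  by move=> /dg[+ _]; move=> /derivable1_diffP.
have [u u01|u u01] := @MVT_direction _ _ g s (t - s); first exact/dgt/Iseg.
have Ix := Iseg _ u01; move: (_ + s) Ix => x Ix.
have -> : 'D_(t - s) g x = (t - s) * 'D_1 g x.
  by rewrite -deriveZdir; [rewrite /GRing.scale /= mulr1|exact: dgt].
have [_ ->] := dg _ Ix.
by rewrite subrK mulr0 => /eqP; rewrite subr_eq0 => /eqP.
Qed.

Lemma is_derive_unique_on (g h : R -> R) (t g' h' : R) : I t -> (forall s, I s -> g s = h s) ->
  is_derive t 1 g g' -> is_derive t 1 h h' -> g' = h'.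
Proof.
move=> It gh [_ <-] [_ <-]; apply: near_eq_derive.
by apply: filterS (open_nbhs_nbhs (conj oI It)) => s; exact: gh.
Qed.

(** Differentiating [x^2 + y^2 = 1] and using the constant angular momentum gives [x' = - w y] and
    [y' = w x]. No angle is lifted: the vector is turned back by [w t - w t0], and the result is
    shown to be constant. *)
Lemma rotation_solution (x y x' y' : R -> R) (w t0 : R) : I t0 ->
  (forall t, I t -> is_derive t 1 x (x' t)) -> (forall t, I t -> is_derive t 1 y (y' t)) ->
  (forall t, I t -> x t ^+ 2 + y t ^+ 2 = 1) ->
  (forall t, I t -> x t * y' t - y t * x' t = w) -> x t0 = 1 -> y t0 = 0 ->
  forall t, I t -> x t = cos (w * t - w * t0) /\ y t = sin (w * t - w * t0).
Proof.
move=> It0 dx dy xy1 xyw x0 y0.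
have ode t : I t -> x' t = - w * y t /\ y' t = w * x t.
  move=> It; have orth : x t * x' t + y t * y' t = 0.
    have d1 : is_derive t 1 (fun s => x s * x s + y s * y s)
        ((x t * x' t + x t * x' t) + (y t * y' t + y t * y' t)).
      by apply: is_derive_add; apply: is_derive_prod; [exact: dx|exact: dx|exact: dy|exact: dy].
    have H s : I s -> x s * x s + y s * y s = 1 by move=> /xy1; rewrite !expr2.
    by have := is_derive_unique_on It H d1 (is_derive_cstR 1 t); lra.
  have e1 := xy1 _ It; have ew := xyw _ It.
  split.
    transitivity (x' t * (x t ^+ 2 + y t ^+ 2)); first by rewrite e1 mulr1.
    transitivity (x t * (x t * x' t + y t * y' t) - y t * (x t * y' t - y t * x' t)).
      by ring.
    by rewrite orth ew; ring.
  transitivity (y' t * (x t ^+ 2 + y t ^+ 2)); first by rewrite e1 mulr1.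
  transitivity (y t * (x t * x' t + y t * y' t) + x t * (x t * y' t - y t * x' t)).
    by ring.
  by rewrite orth ew; ring.
pose th t := w * t - w * t0.
have dth (t : R) : is_derive t 1 th w.
  apply: is_derive_eq (is_derive_sub (is_derive_scal w (is_derive_idR t))
    (is_derive_cstR (w * t0) t)) _.
  by rewrite mulr1 subr0.
have dcos (t : R) : is_derive t 1 (fun s => cos (th s)) (- (w * sin (th t))).
  apply: is_derive_eq (is_derive1_comp (is_derive_cos (th t)) (dth t)) _.
  by rewrite mulNr mulrC.
have dsin (t : R) : is_derive t 1 (fun s => sin (th s)) (w * cos (th t)).
  apply: is_derive_eq (is_derive1_comp (is_derive_sin (th t)) (dth t)) _.
  by rewrite mulrC.
have dX s : I s -> is_derive s 1 (fun t => x t * cos (th t) + y t * sin (th t)) 0.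
  move=> Is; have [ex ey] := ode _ Is.
  apply: is_derive_eq (is_derive_add (is_derive_prod (dx _ Is) (dcos s))
    (is_derive_prod (dy _ Is) (dsin s))) _.
  by rewrite ex ey; ring.
have dY s : I s -> is_derive s 1 (fun t => y t * cos (th t) - x t * sin (th t)) 0.
  move=> Is; have [ex ey] := ode _ Is.
  apply: is_derive_eq (is_derive_sub (is_derive_prod (dy _ Is) (dcos s))
    (is_derive_prod (dx _ Is) (dsin s))) _.
  by rewrite ex ey; ring.
have X1 t : I t -> x t * cos (th t) + y t * sin (th t) = 1.
  move=> It; have -> := constant_on_interval dX It0 It.
  by rewrite x0 y0 /th subrr cos0 mul0r addr0 mulr1.
have Y0 t : I t -> y t * cos (th t) - x t * sin (th t) = 0.
  move=> It; have -> := constant_on_interval dY It0 It.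
  by rewrite x0 y0 /th subrr sin0 mul0r mulr0 subr0.
move=> t It; rewrite -/(th t).
have cs := cos2Dsin2 (th t); have e1 := X1 _ It; have e0 := Y0 _ It.
split.
  transitivity (x t * (cos (th t) ^+ 2 + sin (th t) ^+ 2)); first by rewrite cs mulr1.
  transitivity ((x t * cos (th t) + y t * sin (th t)) * cos (th t)
    - (y t * cos (th t) - x t * sin (th t)) * sin (th t)); first by ring.
  by rewrite e1 e0; ring.
transitivity (y t * (cos (th t) ^+ 2 + sin (th t) ^+ 2)); first by rewrite cs mulr1.
transitivity ((x t * cos (th t) + y t * sin (th t)) * sin (th t)
  + (y t * cos (th t) - x t * sin (th t)) * cos (th t)); first by ring.
by rewrite e1 e0; ring.
Qed.

End Interval_calculus.

Section Time_part.
Context {R : realType}.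
Variables (I : set R) (b d b' d' b'' d'' : 'I_4 -> R -> R) (t0 : R).
Hypotheses (oI : open I) (iI : is_interval I) (It0 : I t0)
  (db : forall i t, I t -> is_derive t 1 (b i) (b' i t))
  (dd : forall i t, I t -> is_derive t 1 (d i) (d' i t))
  (db' : forall i t, I t -> is_derive t 1 (b' i) (b'' i t))
  (dd' : forall i t, I t -> is_derive t 1 (d' i) (d'' i t)).

(** [b] and [d] are the two rows of [A]. In the derivative [q'] of [q] the products of first
    derivatives cancel. *)
Let p i j t := b i t * d j t - b j t * d i t.
Let p' i j t := b' i t * d j t + b i t * d' j t - b' j t * d i t - b j t * d' i t.
Let q i j t := b' i t * b j t + d' i t * d j t - b' j t * b i t - d' j t * d i t.
Let q' i j t := b'' i t * b j t + d'' i t * d j t - b'' j t * b i t - d'' j t * d i t.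

Let dp i j t : I t -> is_derive t 1 (p i j) (p' i j t).
Proof.
move=> It; apply: is_derive_eq (is_derive_sub (is_derive_prod (db i It) (dd j It))
  (is_derive_prod (db j It) (dd i It))) _.
by rewrite /p'; ring.
Qed.

Let dq i j t : I t -> is_derive t 1 (q i j) (q' i j t).
Proof.
move=> It; apply: is_derive_eq (is_derive_sub (is_derive_sub
  (is_derive_add (is_derive_prod (db' i It) (db j It)) (is_derive_prod (dd' i It) (dd j It)))
  (is_derive_prod (db' j It) (db i It))) (is_derive_prod (dd' j It) (dd i It))) _.
by rewrite /q'; ring.
Qed.

Hypotheses (p01 : forall t, I t -> p' 0 1 t = 0) (p0213 : forall t, I t -> p' 0 2 t - p' 1 3 t = 0)
  (p12 : forall t, I t -> p' 1 2 t = 0) (p23 : forall t, I t -> p' 2 3 t = 0)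
  (q01 : forall t, I t -> q' 0 1 t = 0) (q0213 : forall t, I t -> q' 0 2 t - q' 1 3 t = 0)
  (q12 : forall t, I t -> q' 1 2 t = 0) (q23 : forall t, I t -> q' 2 3 t = 0)
  (indep : forall k0 k1 k2 k3, (forall t, I t ->
     b 0 t * k0 + b 1 t * k1 + b 2 t * k2 + b 3 t * k3 = 0 /\
     d 0 t * k0 + d 1 t * k1 + d 2 t * k2 + d 3 t * k3 = 0) ->
     [/\ k0 = 0, k1 = 0, k2 = 0 & k3 = 0])
  (nondeg : ~ [/\ p 0 1 t0 = 0, p 0 2 t0 = 0, p 1 2 t0 = 0, p 1 3 t0 = 0 & p 2 3 t0 = 0]).

Let cst_p i j : (forall t, I t -> p' i j t = 0) -> forall t, I t -> p i j t = p i j t0.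
Proof.
move=> pij t It; apply: (constant_on_interval iI _ It0 It) => s Is.
by rewrite -(pij s Is); exact: dp.
Qed.

Let cst_q i j : (forall t, I t -> q' i j t = 0) -> forall t, I t -> q i j t = q i j t0.
Proof.
move=> qij t It; apply: (constant_on_interval iI _ It0 It) => s Is.
by rewrite -(qij s Is); exact: dq.
Qed.

Let c := p 1 2 t0.
Let P01 := p 0 1 t0.
Let P23 := p 2 3 t0.
Let kc := p 0 2 t0 - p 1 3 t0.

Let p0213E t : I t -> p 1 3 t = p 0 2 t - kc.
Proof.
move=> It; have H : forall s, I s -> is_derive s 1 (fun s => p 0 2 s - p 1 3 s) 0.
  by move=> s Is; rewrite -(p0213 Is); apply: is_derive_sub; exact: dp.
by have := constant_on_interval iI H It0 It; rewrite /kc; lra.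
Qed.

(** If [p 1 2] were zero, three-term identities between columns would acquire constant coefficients,
    and [indep] would annihilate all minors in [nondeg]. There [p 0 3] is absent, since it
    multiplies [gdet v 0 3 = 0]. *)
Let c_neq0 : c != 0.
Proof.
apply/eqP => c0; apply: nondeg.
have p12z t : I t -> p 1 2 t = 0 by move=> It; rewrite (cst_p p12 It).
(* Plucker: p01 p23 - p02 p13 + p12 p03 = 0, so the product p02 p13 is constant
   as well as the difference p02 - p13, hence both factors are constant. *)
have disc t : I t -> (2 * p 0 2 t - kc) ^+ 2 = kc ^+ 2 + 4 * (P01 * P23).
  move=> It; rewrite /P01 -(cst_p p01 It) /P23 -(cst_p p23 It).
  have <- : p 0 2 t - p 1 3 t = kc by rewrite (p0213E It); ring.
  have := p12z _ It; rewrite /p => h.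
  apply/eqP; rewrite -subr_eq0; apply/eqP.
  transitivity (4 * ((b 1 t * d 2 t - b 2 t * d 1 t) * (b 0 t * d 3 t - b 3 t * d 0 t))).
    by ring.
  by rewrite h mul0r mulr0.
have p02c t : I t -> p 0 2 t = p 0 2 t0.
  (* If the constant square is zero, [p 0 2] is [kc / 2]; otherwise its nonzero base can be
     cancelled after differentiation. *)
  have [D0|D0] := eqVneq (kc ^+ 2 + 4 * (P01 * P23)) 0.
    have h s : I s -> 2 * p 0 2 s - kc = 0.
      by move=> /disc; rewrite D0 => /eqP; rewrite sqrf_eq0 => /eqP.
    by move=> It; have := h _ It; have := h _ It0; lra.
  move=> It; apply: (constant_on_interval iI _ It0 It) => s Is.
  have d1 : is_derive s 1 (fun s => 2 * p 0 2 s - kc) (2 * p' 0 2 s).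
    apply: is_derive_eq (is_derive_sub (is_derive_scal 2 (dp 0 2 Is)) (is_derive_cstR kc s)) _.
    by rewrite subr0.
  have H r : I r -> (2 * p 0 2 r - kc) * (2 * p 0 2 r - kc) = kc ^+ 2 + 4 * (P01 * P23).
    by move=> Ir; rewrite -expr2 disc.
  have := is_derive_unique_on oI Is H (is_derive_prod d1 d1) (is_derive_cstR _ s).
  move=> e; have n0 : 2 * p 0 2 s - kc != 0.
    by apply: contra D0 => /eqP e0; rewrite -(disc _ Is) e0 expr0n.
  have {}e : (2 * p 0 2 s - kc) * p' 0 2 s = 0 by lra.
  have <- : p' 0 2 s = 0 by apply: (mulfI n0); rewrite e mulr0.
  exact: dp.
(* The identity [p12 A_0 - p02 A_1 + p01 A_2 = 0] with [p12 = 0] is now a constant relation between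
   columns. *)
have [|_ S0 Z01 _] := @indep 0 (- p 0 2 t0) P01 0.
  move=> t It; rewrite -(p02c _ It) /P01 -(cst_p p01 It).
  have h := p12z _ It; split.
    transitivity (- (p 1 2 t * b 0 t)); first by rewrite /p; ring.
    by rewrite h mul0r oppr0.
  transitivity (- (p 1 2 t * d 0 t)); first by rewrite /p; ring.
  by rewrite h mul0r oppr0.
have [|_ Z23 T0 _] := @indep 0 P23 (- p 1 3 t0) 0.
  move=> t It; have -> : p 1 3 t0 = p 1 3 t by rewrite (p0213E It) (p0213E It0) p02c.
  rewrite /P23 -(cst_p p23 It).
  have h := p12z _ It; split.
    transitivity (- (p 1 2 t * b 3 t)); first by rewrite /p; ring.
    by rewrite h mul0r oppr0.
  transitivity (- (p 1 2 t * d 3 t)); first by rewrite /p; ring.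
  by rewrite h mul0r oppr0.
by split=> //; apply/eqP; rewrite -oppr_eq0; apply/eqP.
Qed.

Let sg t := p 0 2 t / c.
Let sg' t := p' 0 2 t / c.
Let mu := P01 / c.
Let nu := P23 / c.
Let ka := kc / c.

Let dsg t : I t -> is_derive t 1 sg (sg' t).
Proof.
move=> It; apply: is_derive_eq (is_derive_prod (dp 0 2 It) (is_derive_cstR c^-1 t)) _.
by rewrite mulr0 add0r mulrC.
Qed.

Let p12E t : I t -> p 1 2 t = c. Proof. exact: cst_p. Qed.

Let col0E t : I t -> b 0 t = sg t * b 1 t - mu * b 2 t /\ d 0 t = sg t * d 1 t - mu * d 2 t.
Proof.
move=> It; have e01 : P01 = p 0 1 t by rewrite (cst_p p01 It).
split; apply: (mulfI c_neq0).
  transitivity (p 0 2 t * b 1 t - P01 * b 2 t); last by rewrite /sg /mu; field.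
  by rewrite -(p12E It) e01 /p; ring.
transitivity (p 0 2 t * d 1 t - P01 * d 2 t); last by rewrite /sg /mu; field.
by rewrite -(p12E It) e01 /p; ring.
Qed.

Let col3E t : I t -> b 3 t = (sg t - ka) * b 2 t - nu * b 1 t /\
  d 3 t = (sg t - ka) * d 2 t - nu * d 1 t.
Proof.
move=> It; have e23 : P23 = p 2 3 t by rewrite (cst_p p23 It).
have e13 := p0213E It.
split; apply: (mulfI c_neq0).
  transitivity (p 1 3 t * b 2 t - P23 * b 1 t); last by rewrite e13 /sg /nu /ka; field.
  by rewrite -(p12E It) e23 /p; ring.
transitivity (p 1 3 t * d 2 t - P23 * d 1 t); last by rewrite e13 /sg /nu /ka; field.
by rewrite -(p12E It) e23 /p; ring.
Qed.

Let col0E' t : I t -> b' 0 t = sg' t * b 1 t + sg t * b' 1 t - mu * b' 2 t /\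
  d' 0 t = sg' t * d 1 t + sg t * d' 1 t - mu * d' 2 t.
Proof.
move=> It; split.
  rewrite (is_derive_unique_on oI It (fun s Is => (col0E Is).1) (db 0 It)
    (is_derive_sub (is_derive_prod (dsg It) (db 1 It)) (is_derive_scal mu (db 2 It)))).
  by ring.
rewrite (is_derive_unique_on oI It (fun s Is => (col0E Is).2) (dd 0 It)
  (is_derive_sub (is_derive_prod (dsg It) (dd 1 It)) (is_derive_scal mu (dd 2 It)))).
by ring.
Qed.

Let col3E' t : I t -> b' 3 t = sg' t * b 2 t + (sg t - ka) * b' 2 t - nu * b' 1 t /\
  d' 3 t = sg' t * d 2 t + (sg t - ka) * d' 2 t - nu * d' 1 t.
Proof.
move=> It; have dsk := is_derive_sub (dsg It) (is_derive_cstR ka t).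
split.
  rewrite (is_derive_unique_on oI It (fun s Is => (col3E Is).1) (db 3 It)
    (is_derive_sub (is_derive_prod dsk (db 2 It)) (is_derive_scal nu (db 1 It)))).
  by ring.
rewrite (is_derive_unique_on oI It (fun s Is => (col3E Is).2) (dd 3 It)
  (is_derive_sub (is_derive_prod dsk (dd 2 It)) (is_derive_scal nu (dd 1 It)))).
by ring.
Qed.

Let G11 t := b 1 t * b 1 t + d 1 t * d 1 t.
Let G12 t := b 1 t * b 2 t + d 1 t * d 2 t.
Let G22 t := b 2 t * b 2 t + d 2 t * d 2 t.
Let K1 := q 0 1 t0 - mu * q 1 2 t0.
Let K2 := nu * q 1 2 t0 - q 2 3 t0.
Let K3 := (q 0 2 t0 - q 1 3 t0 - ka * q 1 2 t0) / 2.

(** In [q 0 1], [q 2 3] and [q 0 2 - q 1 3] the terms with undifferentiated [sg] cancel, leaving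
    [sg'] times a Gram entry and a constant multiple of [q 1 2]. In the difference [G12] occurs
    twice, whence the [2] in [K3]. *)
Let gram t : I t -> [/\ sg' t * G11 t = K1, sg' t * G22 t = K2 & sg' t * G12 t = K3].
Proof.
move=> It; have [b0 d0] := col0E It; have [b3 d3] := col3E It.
have [b0' d0'] := col0E' It; have [b3' d3'] := col3E' It.
have e0213 : q 0 2 t - q 1 3 t = q 0 2 t0 - q 1 3 t0.
  apply: (constant_on_interval (g := fun t => q 0 2 t - q 1 3 t) iI _ It0 It) => s Is.
  by rewrite -(q0213 Is); apply: is_derive_sub; exact: dq.
rewrite /K1 /K2 /K3 -e0213 -(cst_q q01 It) -(cst_q q12 It) -(cst_q q23 It).
rewrite /q b0 d0 b3 d3 b0' d0' b3' d3' /G11 /G22 /G12.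
by split; [ring|ring|field].
Qed.

(** Lagrange's identity: the Gram determinant is the square of [p 1 2 = c]. *)
Let sg'_sqr t : I t -> sg' t ^+ 2 * c ^+ 2 = K1 * K2 - K3 ^+ 2.
Proof.
move=> It; have [<- <- <-] := gram It.
by rewrite -(p12E It) /G11 /G22 /G12 /p; ring.
Qed.

Let m := sg' t0.

Let G11_gt0 t : I t -> 0 < G11 t.
Proof.
move=> It; rewrite lt_def /G11 -!expr2 addr_ge0 ?sqr_ge0// andbT.
rewrite paddr_eq0 ?sqr_ge0// !sqrf_eq0; apply/negP => /andP[/eqP b1 /eqP d1].
by have := p12E It; rewrite /p b1 d1 mul0r mulr0 subr0 => e; move: c_neq0; rewrite -e eqxx.
Qed.

(** The square is constant, and the sign is fixed by [sg' * G11 = K1] with [G11 > 0]. *)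
Let sg'E t : I t -> sg' t = m.
Proof.
move=> It; have c2 : c ^+ 2 != 0 by rewrite sqrf_eq0.
have : sg' t ^+ 2 = m ^+ 2 by apply: (mulIf c2); rewrite !sg'_sqr.
move/eqP; rewrite eqf_sqr => /orP[/eqP//|/eqP sm].
have [e1 _ _] := gram It; have [e0 _ _] := gram It0.
have g1 := G11_gt0 It; have g0 := G11_gt0 It0.
have h : m * (G11 t0 + G11 t) = 0.
  transitivity (sg' t0 * G11 t0 - - m * G11 t); first by rewrite /m; ring.
  by rewrite -sm e0 e1 subrr.
have m0 : m = 0.
  by move/eqP: h; rewrite mulf_eq0 (gt_eqF (addr_gt0 g0 g1)) orbF => /eqP.
by rewrite sm m0 oppr0.
Qed.

(** With [sg] constant, column 0 would be a constant combination of columns 1 and 2. *)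
Let m_neq0 : m != 0.
Proof.
apply/eqP => m0; have sgc t : I t -> sg t = sg t0.
  move=> It; apply: (constant_on_interval iI _ It0 It) => s Is.
  by rewrite -m0 -(sg'E Is); exact: dsg.
have [|/eqP] := @indep 1 (- sg t0) mu 0; last by rewrite oner_eq0.
by move=> t It; have [-> ->] := col0E It; rewrite (sgc _ It); split; ring.
Qed.

Let n := sg t0 - m * t0.

Let sgE t : I t -> sg t = m * t + n.
Proof.
move=> It; have H s : I s -> is_derive s 1 (fun s => sg s - m * s) 0.
  move=> Is; apply: is_derive_eq (is_derive_sub (dsg Is) (is_derive_scal m (is_derive_idR s))) _.
  by rewrite (sg'E Is) mulr1 subrr.
by have := constant_on_interval iI H It0 It; rewrite /n; lra.
Qed.

Let gramE t : I t -> [/\ G11 t = G11 t0, G22 t = G22 t0 & G12 t = G12 t0].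
Proof.
move=> It; have [e1 e2 e3] := gram It; have [f1 f2 f3] := gram It0.
rewrite (sg'E It) in e1 e2 e3.
by split; apply: (mulfI m_neq0); [rewrite e1 f1|rewrite e2 f2|rewrite e3 f3].
Qed.

Let al := b 1 t0.
Let be := b 2 t0.
Let ga := d 1 t0.
Let de := d 2 t0.

(** The matrix with columns [(X, Y)] and [(V, Z)] is the frame [(A_1, A_2)] (indices from 0) times
    the adjugate of its value at [t0], that is, [c] times the transition matrix from the initial
    frame. *)
Let X t := b 1 t * de - b 2 t * ga.
Let Y t := d 1 t * de - d 2 t * ga.
Let Z t := d 2 t * al - d 1 t * be.
Let V t := b 2 t * al - b 1 t * be.

Let cE : c = al * de - be * ga. Proof. by []. Qed.

Let XY t : I t -> X t ^+ 2 + Y t ^+ 2 = c ^+ 2.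
Proof.
move=> It; have [e1 e2 e3] := gramE It.
transitivity (G11 t * de ^+ 2 - 2 * G12 t * (ga * de) + G22 t * ga ^+ 2).
  by rewrite /X /Y /G11 /G12 /G22; ring.
by rewrite e1 e2 e3 cE /G11 /G12 /G22 -/al -/be -/ga -/de; ring.
Qed.

(** The vectors [(X, Y)] and [(V, Z)] both have squared length [c ^+ 2] and span the area [c ^+ 2],
    so the second is the first turned by a right angle. *)
Let XZ t : I t -> Z t = X t /\ V t = - Y t.
Proof.
move=> It; have [e1 e2 e3] := gramE It.
have ZV : Z t ^+ 2 + V t ^+ 2 = c ^+ 2.
  transitivity (G11 t * be ^+ 2 - 2 * G12 t * (al * be) + G22 t * al ^+ 2).
    by rewrite /Z /V /G11 /G12 /G22; ring.
  by rewrite e1 e2 e3 cE /G11 /G12 /G22 -/al -/be -/ga -/de; ring.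
have dt : X t * Z t - Y t * V t = c ^+ 2.
  by rewrite expr2 -{1}(p12E It) cE /X /Y /Z /V /p; ring.
have h : (Z t - X t) ^+ 2 + (V t + Y t) ^+ 2 = 0.
  transitivity ((X t ^+ 2 + Y t ^+ 2) + (Z t ^+ 2 + V t ^+ 2) - 2 * (X t * Z t - Y t * V t)).
    by ring.
  by rewrite XY// ZV dt; ring.
move/eqP: h; rewrite paddr_eq0 ?sqr_ge0// !sqrf_eq0 subr_eq0 addr_eq0.
by move=> /andP[/eqP ? /eqP].
Qed.

Let frame t : I t -> [/\ c * b 1 t = X t * al - Y t * ga, c * b 2 t = X t * be - Y t * de,
  c * d 1 t = Y t * al + X t * ga & c * d 2 t = Y t * be + X t * de].
Proof.
move=> It; have [ZX VY] := XZ It; have YV : Y t = - V t by rewrite VY opprK.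
split.
- by rewrite YV cE /X /V; ring.
- by rewrite YV cE /X /V; ring.
- by rewrite -ZX cE /Z /Y; ring.
- by rewrite -ZX cE /Z /Y; ring.
Qed.

Let X' t := b' 1 t * de - b' 2 t * ga.
Let Y' t := d' 1 t * de - d' 2 t * ga.

Let dX t : I t -> is_derive t 1 X (X' t).
Proof.
move=> It; apply: is_derive_eq (is_derive_sub
  (is_derive_prod (db 1 It) (is_derive_cstR de t)) (is_derive_prod (db 2 It) (is_derive_cstR ga t))) _.
by rewrite /X'; ring.
Qed.

Let dY t : I t -> is_derive t 1 Y (Y' t).
Proof.
move=> It; apply: is_derive_eq (is_derive_sub
  (is_derive_prod (dd 1 It) (is_derive_cstR de t)) (is_derive_prod (dd 2 It) (is_derive_cstR ga t))) _.
by rewrite /Y'; ring.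
Qed.

Let lin (k l t : R) : I t -> is_derive t 1 (fun s => X s * k - Y s * l) (X' t * k - Y' t * l).
Proof.
move=> It; apply: is_derive_eq (is_derive_sub (is_derive_prod (dX It) (is_derive_cstR k t))
  (is_derive_prod (dY It) (is_derive_cstR l t))) _.
by ring.
Qed.

Let lin' (k l t : R) : I t -> is_derive t 1 (fun s => Y s * k + X s * l) (Y' t * k + X' t * l).
Proof.
move=> It; apply: is_derive_eq (is_derive_add (is_derive_prod (dY It) (is_derive_cstR k t))
  (is_derive_prod (dX It) (is_derive_cstR l t))) _.
by ring.
Qed.

Let frame' t : I t -> [/\ c * b' 1 t = X' t * al - Y' t * ga, c * b' 2 t = X' t * be - Y' t * de,
  c * d' 1 t = Y' t * al + X' t * ga & c * d' 2 t = Y' t * be + X' t * de].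
Proof.
move=> It; split.
- apply: (is_derive_unique_on oI It _ (is_derive_scal c (db 1 It)) (lin al ga It)).
  by move=> s Is; have [] := frame Is.
- apply: (is_derive_unique_on oI It _ (is_derive_scal c (db 2 It)) (lin be de It)).
  by move=> s Is; have [] := frame Is.
- apply: (is_derive_unique_on oI It _ (is_derive_scal c (dd 1 It)) (lin' al ga It)).
  by move=> s Is; have [] := frame Is.
- apply: (is_derive_unique_on oI It _ (is_derive_scal c (dd 2 It)) (lin' be de It)).
  by move=> s Is; have [] := frame Is.
Qed.

(** A frame of determinant [c] turning with angular velocity [w] has [q 1 2 = 2 c w]. *)
Let w := q 1 2 t0 / (2 * c).

Let angular t : I t -> X t * Y' t - Y t * X' t = c ^+ 2 * w.
Proof.
move=> It; have [b1 b2 d1 d2] := frame It; have [b1' b2' d1' d2'] := frame' It.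
have c20 : 2 * c != 0 by rewrite mulf_neq0// pnatr_eq0.
apply: (mulfI c20).
transitivity (c ^+ 2 * q 1 2 t); last by rewrite (cst_q q12 It) /w; field.
transitivity ((c * b' 1 t) * (c * b 2 t) + (c * d' 1 t) * (c * d 2 t)
  - (c * b' 2 t) * (c * b 1 t) - (c * d' 2 t) * (c * d 1 t)); last by rewrite /q; ring.
by rewrite b1 b2 d1 d2 b1' b2' d1' d2' cE; ring.
Qed.

Lemma time_part : exists al be ga de m n mu nu ka w : R, forall t, I t ->
  let C := cos (w * t - w * t0) in let S := sin (w * t - w * t0) in
  [/\ b 1 t = C * al - S * ga /\ b 2 t = C * be - S * de,
      d 1 t = S * al + C * ga /\ d 2 t = S * be + C * de,
      b 0 t = (m * t + n) * b 1 t - mu * b 2 t /\ d 0 t = (m * t + n) * d 1 t - mu * d 2 t &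
      b 3 t = (m * t + n - ka) * b 2 t - nu * b 1 t /\
      d 3 t = (m * t + n - ka) * d 2 t - nu * d 1 t].
Proof.
have dx t : I t -> is_derive t 1 (fun s => c^-1 * X s) (c^-1 * X' t).
  by move=> It; exact/is_derive_scal/dX.
have dy t : I t -> is_derive t 1 (fun s => c^-1 * Y s) (c^-1 * Y' t).
  by move=> It; exact/is_derive_scal/dY.
have xy t : I t -> (c^-1 * X t) ^+ 2 + (c^-1 * Y t) ^+ 2 = 1.
  move=> It; transitivity (c ^- 2 * (X t ^+ 2 + Y t ^+ 2)); first by field.
  by rewrite XY// mulVf// sqrf_eq0.
have xyw t : I t -> c^-1 * X t * (c^-1 * Y' t) - c^-1 * Y t * (c^-1 * X' t) = w.
  move=> It; transitivity (c ^- 2 * (X t * Y' t - Y t * X' t)); first by field.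
  by rewrite angular// mulKf// sqrf_eq0.
have x0 : c^-1 * X t0 = 1 by rewrite /X -/al -/be -cE mulVf.
have y0 : c^-1 * Y t0 = 0 by rewrite /Y -/ga -/de; ring.
exists al, be, ga, de, m, n, mu, nu, ka, w => t It C S.
have [xC yS] := rotation_solution oI iI It0 dx dy xy xyw x0 y0 It.
have [b1 b2 d1 d2] := frame It.
rewrite -(sgE It); split; [split|split|exact: col0E|exact: col3E];
  apply: (mulfI c_neq0); rewrite /C /S -xC -yS ?b1 ?b2 ?d1 ?d2; by field.
Qed.

End Time_part.

(** * Reduction to the normal form *)

Section Assembly.
Context {R : realType}.
Local Notation plane := 'cV[R]_2.

(* With [(al, ga)] and [(be, de)] the initial values of [A_2] and [A_3], this is
   the matrix for which
   [A_normal t *m _] has the columns [A_1, ..., A_4] turned back by the rotation,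
   where [A_1 = (m t + n) A_2 - mu A_3] and [A_4 = (m t + n - ka) A_3 - nu A_2]. *)
Definition normalizing_mx (al be ga de m n mu nu ka : R) : 'M[R]_4 := \matrix_(i < 4, j < 4)
  nth 0 (nth [::] [:: [:: m * al; 0; 0; m * be];
                      [:: n * al - mu * be; al; be; (n - ka) * be - nu * al];
                      [:: n * ga - mu * de; ga; de; (n - ka) * de - nu * ga];
                      [:: m * ga; 0; 0; m * de]] i) j.

(** With [c = al de - be ga], the form [g03] is multiplied by [m^2 c], and [g02 + g13] by [m c] up
    to the added multiple [m c (2 n - ka)] of [g03]. *)
Lemma normalizing_mx_preserves_constraint al be ga de m n mu nu ka :
  preserves_constraint (normalizing_mx al be ga de m n mu nu ka).
Proof.
move=> w z dw; rewrite /constraint !gdetE jac_mulmxf//; set J := jac w z.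
rewrite !(mxE mulmx_key) !sum_ord4 ![normalizing_mx _ _ _ _ _ _ _ _ _ _ _]mxE /= => -[c1 c2].
pose c := al * de - be * ga.
split.
  transitivity (m * c * (J 0 0 * J 2 1 - J 2 0 * J 0 1 + (J 1 0 * J 3 1 - J 3 0 * J 1 1))
    + m * c * (2 * n - ka) * (J 0 0 * J 3 1 - J 3 0 * J 0 1)); first by rewrite /c; ring.
  by rewrite c1 c2 !mulr0 addr0.
transitivity (m ^+ 2 * c * (J 0 0 * J 3 1 - J 3 0 * J 0 1)); first by rewrite /c; ring.
by rewrite c2 mulr0.
Qed.

Lemma motion_normalize (b d : 'I_4 -> R) (t C S al be ga de m n mu nu ka : R) (M : 'M[R]_(2, 4))
    (Q : 'M[R]_2) :
  [/\ Q 0 0 = C, Q 0 1 = - S, Q 1 0 = S & Q 1 1 = C] ->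
  (forall i, M 0 i = b i) -> (forall i, M 1 i = d i) ->
  [/\ b 1 = C * al - S * ga /\ b 2 = C * be - S * de,
      d 1 = S * al + C * ga /\ d 2 = S * be + C * de,
      b 0 = (m * t + n) * b 1 - mu * b 2 /\ d 0 = (m * t + n) * d 1 - mu * d 2 &
      b 3 = (m * t + n - ka) * b 2 - nu * b 1 /\
      d 3 = (m * t + n - ka) * d 2 - nu * d 1] ->
  M = Q *m A_normal t *m normalizing_mx al be ga de m n mu nu ka.
Proof.
move=> [Q00 Q01 Q10 Q11] Mb Md [[b1 b2] [d1 d2] [b0 d0] [b3 d3]].
apply/matrixP => i j; rewrite (mxE mulmx_key) sum_ord4 !(mxE mulmx_key) !sum_ord2 ![A_normal _ _ _]mxE.
rewrite ![normalizing_mx _ _ _ _ _ _ _ _ _ _ _]mxE; move: i j; apply: ord2P; apply: ord4P;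
  rewrite /= ?Mb ?Md ?Q00 ?Q01 ?Q10 ?Q11 ?b0 ?b3 ?d0 ?d3 ?b1 ?b2 ?d1 ?d2; by ring.
Qed.

Lemma rotrefl_entries (a : R) (Q := rotrefl false a) :
  [/\ Q 0 0 = cos a, Q 0 1 = - sin a, Q 1 0 = sin a & Q 1 1 = cos a].
Proof. by split; rewrite mxE /= ?expr0 ?mul1r. Qed.

Lemma det_motion (M : 'M[R]_(2, 4)) (v : plane -> 'cV[R]_4) z :
  let p i j := M 0 i * M 1 j - M 0 j * M 1 i in
  \det (M *m jac v z) = p 0 1 * gdet v 0 1 z + p 0 2 * gdet v 0 2 z + p 0 3 * gdet v 0 3 z
    + p 1 2 * gdet v 1 2 z + p 1 3 * gdet v 1 3 z + p 2 3 * gdet v 2 3 z.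
Proof. by rewrite /= det_mx22 !(mxE mulmx_key) !sum_ord4 !gdetE; ring. Qed.

Lemma jac_id n (x : 'cV[R]_n) : jac id x = 1%:M.
Proof.
apply/matrixP => i j; rewrite !mxE.
have [_ D1] := linear_diffE x (delta_mx j 0) (@coordf_continuous R n 1 i 0).
transitivity ('D_(delta_mx j 0) (coordf i 0) x) => //.
by rewrite D1; transitivity ((delta_mx j 0 : 'cV[R]_n) i 0) => //; rewrite mxE eqxx andbT.
Qed.

Lemma coordinate_change_det (W : set plane) Psi y : coordinate_change W Psi -> W y ->
  \det (jac Psi y) != 0.
Proof.
move=> [oW oPW CP [Th [CTh ThP]]] Wy; have nW : nbhs y W by exact: open_nbhs_nbhs.
have dP : differentiable Psi y by exact: CP.1.
have dT : differentiable Th (Psi y) by apply: CTh.1; exists y.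
have : jac (Th \o Psi) y = 1%:M.
  rewrite -(jac_id y); apply/matrixP => i j; rewrite !mxE; apply: near_eq_derive.
  by apply: filterS nW => x Wx; rewrite /= ThP.
rewrite jac_comp// => /(congr1 determinant); rewrite det_mulmx det1 => dd.
by apply/eqP => d0; move/eqP: dd; rewrite d0 mulr0 eq_sym oner_eq0.
Qed.

Lemma gdet_continuous (D : set plane) (v : plane -> 'cV[R]_4) i j z : open D ->
  Ck 2 D v -> D z -> {for z, continuous (gdet v i j)}.
Proof.
move=> oD Dv Dz.
have CJ a k : Ck 1 D (fun z => jac v z a k).
  have vC : Ck 1 D ('D_(delta_mx k 0) (fun y => v y a 0)).
    exact: (Ck_coord a 0 oD Dv).2.
  apply: (Ck_ext oD _ vC) => x _.
  by rewrite mxE.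
suff : Ck 1 D (gdet v i j) by move/Ck_continuous; exact.
apply: (Ck_ext oD _ (CkD oD (CkM oD (CJ i 0) (CJ j 1)) (CkN oD (CkM oD (CJ j 0) (CJ i 1))))) => x _.
by rewrite gdetE.
Qed.

Lemma normal_form_motion (I : set R) (D : set plane) (A : R -> 'M[R]_(2, 4))
    (v : plane -> 'cV[R]_4) :
  open D -> D !=set0 -> open I -> is_interval I -> I !=set0 ->
  Ck 2 I A -> Ck 2 D v -> (forall z, D z -> constraint v z) ->
  is_solution D I (motion A v) ->
  (forall z t, D z -> I t -> \det (jac (motion A v ^~ t) z) != 0) ->
  (forall U : set plane, open U -> U !=set0 -> U `<=` D -> ~ fewer_columns U I (motion A v)) ->
  exists (H : 'M[R]_4) c0 c1, preserves_constraint H /\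
    forall t, I t -> A t = rotrefl false (c1 * t + c0) *m A_normal t *m H.
Proof.
move=> oD D0 oI iI [t0 It0] IA Dv cD sol detn NF.
have ND := motion_nonaffine oI IA Dv NF.
have gD z : D z -> exists i j, gdet v i j z != 0.
  by move=> Dz; exact: (gdet_nonzero Dv Dz It0 (detn _ _ Dz It0)).
(* At each fixed time the Euler equations are linear relations between the forms on [D], so all four
   coefficients vanish. *)
have rel1 t (It : I t) := gdet_independent oD Dv cD ND gD D0
  (fun z Dz => euler_minor IA Dv cD sol Dz It).
have rel2 t (It : I t) := gdet_independent oD Dv cD ND gD D0
  (fun z Dz => euler_wronskian oD oI IA Dv cD sol Dz It).
have dA r i t : I t -> is_derive t 1 (fun t => A t r i) ('D_1 A t r i).
  move=> It; have dAt : differentiable A t by exact: IA.1.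
  by rewrite derive_entry//; apply: DeriveDef => //; exact/diff_derivable/differentiable_entry.
have dA' r i t : I t -> is_derive t 1 (fun t => 'D_1 A t r i) ('D_1 (fun t => 'D_1 A t) t r i).
  move=> It; have dAt : differentiable (fun t => 'D_1 A t) t by exact: (IA.2 1).1.
  by rewrite derive_entry//; apply: DeriveDef => //; exact/diff_derivable/differentiable_entry.
have indep k0 k1 k2 k3 : (forall t, I t ->
    A t 0 0 * k0 + A t 0 1 * k1 + A t 0 2 * k2 + A t 0 3 * k3 = 0 /\
    A t 1 0 * k0 + A t 1 1 * k1 + A t 1 2 * k2 + A t 1 3 * k3 = 0) ->
    [/\ k0 = 0, k1 = 0, k2 = 0 & k3 = 0].
  move=> Ak; pose k : 'cV[R]_4 := \col_i nth 0 [:: k0; k1; k2; k3] i.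
  have /colP k_0 : k = 0.
    apply: (columns_independent oI IA Dv NF oD D0) => t It; have [e0 e1] := Ak _ It.
    by apply/colP; apply: ord2P; rewrite !(mxE mulmx_key) sum_ord4 !(mxE matrix_key) /=
      ?e0 ?e1 mxE.
  have := k_0 0; have := k_0 1; have := k_0 2; have := k_0 3.
  by rewrite !mxE /= => -> -> -> ->.
pose p i j := A t0 0 i * A t0 1 j - A t0 0 j * A t0 1 i.
have nondeg : ~ [/\ p 0 1 = 0, p 0 2 = 0, p 1 2 = 0, p 1 3 = 0 & p 2 3 = 0].
  move=> [z01 z02 z12 z13 z23]; have [z Dz] := D0.
  have := detn _ _ Dz It0; rewrite (motion_dz A t0 (Dv.1 _ Dz)).2 det_motion.
  have [_ g03] := cD _ Dz.
  by rewrite -!/(p _ _) z01 z02 z12 z13 z23 g03 !mul0r mulr0 !addr0 eqxx.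
have [al [be [ga [de [m [n [mu [nu [ka [w HA]]]]]]]]]] := @time_part R I
  (fun i t => A t 0 i) (fun i t => A t 1 i) (fun i t => 'D_1 A t 0 i) (fun i t => 'D_1 A t 1 i)
  (fun i t => 'D_1 (fun t => 'D_1 A t) t 0 i) (fun i t => 'D_1 (fun t => 'D_1 A t) t 1 i) t0
  oI iI It0 (dA 0) (dA 1) (dA' 0) (dA' 1)
  (fun t It => let: And4 h _ _ _ := rel1 t It in h) (fun t It => let: And4 _ h _ _ := rel1 t It in h)
  (fun t It => let: And4 _ _ h _ := rel1 t It in h) (fun t It => let: And4 _ _ _ h := rel1 t It in h)
  (fun t It => let: And4 h _ _ _ := rel2 t It in h) (fun t It => let: And4 _ h _ _ := rel2 t It in h)
  (fun t It => let: And4 _ _ h _ := rel2 t It in h) (fun t It => let: And4 _ _ _ h := rel2 t It in h)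
  indep nondeg.
exists (normalizing_mx al be ga de m n mu nu ka), (- (w * t0)), w.
split; first exact: normalizing_mx_preserves_constraint.
by move=> t It; apply: motion_normalize (rotrefl_entries _) _ _ (HA t It).
Qed.

End Assembly.

Section Forward.
Context {R : realType}.
Local Notation plane := 'cV[R]_2.

Lemma nonaffine_mulmx (D : set plane) (v : plane -> 'cV[R]_4) (H : 'M[R]_4) :
  H \in unitmx -> nonaffine D v -> nonaffine D (fun z => H *m v z).
Proof.
move=> uH ND U k c oU U0 UD kc.
have kH : k *m H = 0 by apply: (ND U _ c oU U0 UD) => z Uz; rewrite -mulmxA kc.
by rewrite -[k](mulmxK uH) kH mul0mx.
Qed.

(** [det_normal] is the Jacobian determinant of the normal motion: the given nonzero determinant
    with the factor [\det Q] removed, times the Jacobian determinant of the chart. *)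
Lemma chart_admissible (D : set plane) (v : plane -> 'cV[R]_4) (t : R)
    (Q : 'M[R]_2) (y0 : plane) (e : R) (Psi : plane -> plane) (f1 f2 : R -> R)
    (W := ball y0 e) (E := [set z 0 0 | z in W]) :
  Ck 2 D v -> coordinate_change W Psi -> Psi @` W `<=` D ->
  Ck 2 E f1 /\ Ck 1 E f2 -> (forall y, W y -> v (Psi y) = v_normal f1 f2 y) ->
  (forall z, D z -> \det (Q *m A_normal t *m jac v z) != 0) ->
  admissible W f1 f2.
Proof.
move=> Dv cc PD reg vE dn; have [f1E f2E] := reg; split=> // y Wy.
have oW : open W by exact: ball_open.
have DP : D (Psi y) by apply: PD; exists y.
have dP := coordinate_change_det cc Wy; have [_ _ CP _] := cc.
have dPsi : differentiable Psi y by exact: CP.1.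
have dv : differentiable v (Psi y) by exact: Dv.1.
have := dn _ DP; rewrite -mulmxA det_mulmx mulf_eq0 negb_or => /andP[_ dA].
have -> : det_normal f1 f2 y = \det (A_normal t *m jac v (Psi y)) * \det (jac Psi y).
  rewrite -det_mulmx -mulmxA -jac_comp//.
  have -> : jac (v \o Psi) y = jac (v_normal f1 f2) y.
    apply/matrixP => i j; rewrite !mxE; apply: near_eq_derive.
    by apply: filterS (open_nbhs_nbhs (conj oW Wy)) => x Wx; rewrite /= vE.
  rewrite -(motion_dz _ t (differentiable_v_normal oW reg Wy)).2 (det_phi oW reg _ Wy).
  by rewrite /det_normal mulNr opprD.
by rewrite mulf_neq0.
Qed.

End Forward.

Theorem theorem5p4 (R : realType) :
  (* every solution has the normal form, up to the allowed equivalences *)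
  (forall (D : set 'cV[R]_2) (I : set R)
          (A : R -> 'M[R]_(2, 4)) (v : 'cV[R]_2 -> 'cV[R]_4),
     open D -> D !=set0 -> open I -> is_interval I ->
     Ck 2 I A -> Ck 2 D v ->
     (forall z, D z -> constraint v z) ->
     is_solution D I (motion A v) ->
     (forall z t, D z -> I t -> \det (jacmx (motion A v ^~ t) z) != 0) ->
     (forall U : set 'cV[R]_2, open U -> U !=set0 -> U `<=` D ->
        ~ fewer_columns U I (motion A v)) ->
     exists (H : 'M[R]_4) (b : bool) (c0 c1 : R),
       [/\ H \in unitmx,
           preserves_constraint H,
           (forall t, I t ->
              A t *m invmx H = rotrefl b (c1 * t + c0) *m A_normal t) &
           exists D' : set 'cV[R]_2,
             [/\ open D', D' `<=` D, D `<=` closure D' &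
                 forall z0, D' z0 ->
                   exists (W : set 'cV[R]_2) (Psi : 'cV[R]_2 -> 'cV[R]_2)
                          (f1 f2 : R -> R),
                     [/\ coordinate_change W Psi,
                         (Psi @` W) z0 /\ Psi @` W `<=` D,
                         admissible W f1 f2 &
                         forall y, W y ->
                           H *m v (Psi y) = v_normal f1 f2 y]]])
  /\
  (* every normal form is a solution, with the stated determinant and vorticity *)
  (forall (W : set 'cV[R]_2) (f1 f2 : R -> R),
     open W -> admissible W f1 f2 ->
     let phi := motion (@A_normal R) (v_normal f1 f2) in
     [/\ (forall z, W z -> constraint (v_normal f1 f2) z),
         is_solution W setT phi,
         (forall z t, W z ->
            \det (jacmx (phi ^~ t) z)
            = - z 1 0 * derive1 (derive1 f1) (z 0 0) - derive1 f2 (z 0 0)) &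
         (forall z t u, W z -> local_velocity phi z t u ->
            vorticity u (phi z t) t
            = - (1 + derive1 f1 (z 0 0) ^+ 2)
              / (z 1 0 * derive1 (derive1 f1) (z 0 0) + derive1 f2 (z 0 0)))]).
Proof.
split.
- move=> D I A v oD D0 oI iI IA Dv cD sol detn NF.
  (* Over an empty time interval every motion is vacuously of the form with a single column. *)
  have I0 : I !=set0.
    apply: contrapT => noI; apply: (NF D oD D0 (@subset_refl _ D)).
    exists 0%N; split=> //; exists (fun=> 0), (fun=> 0), (fun=> 0).
    split; [exact: Ck_cst|exact: Ck_cst|exact: Ck_cst|].
    by move=> z t _ It; case: noI; exists t.
  have [H [c0 [c1 [pH AE]]]] := normal_form_motion oD D0 oI iI I0 IA Dv cD sol detn NF.
  have uH : H \in unitmx.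
    apply: unitmx_inj => k Hk; apply: (columns_independent oI IA Dv NF oD D0) => t It.
    by rewrite AE// -mulmxA Hk mulmx0.
  exists H, false, c0, c1; split => //.
    by move=> t It; rewrite AE// mulmxK.
  have [t0 It0] := I0.
  pose v1 z := H *m v z.
  have Dv1 : Ck 2 D v1.
    exact: (Ck_linl (L := @mulmxf R _ _ 1 H) oD (@mulmxf_continuous _ _ _ _ _) Dv).
  have cD1 z : D z -> constraint v1 z.
    by move=> Dz; apply: pH; [exact: Dv.1|exact: cD].
  have ND1 : nonaffine D v1 by apply: nonaffine_mulmx => //; exact: motion_nonaffine IA Dv NF.
  pose Q := rotrefl false (c1 * t0 + c0).
  have dn1 z : D z -> \det (Q *m A_normal t0 *m jac v1 z) != 0.
    move=> Dz; rewrite jac_mulmxf; last exact: Dv.1.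
    by rewrite mulmxA -AE// -(motion_dz A t0 (Dv.1 _ Dz)).2; exact: detn.
  have gD1 z : D z -> exists i j, gdet v1 i j z != 0.
    (* The determinant for [v1] is known at time [t0], so the motion is frozen at that matrix; the
       time [0] is a dummy. *)
    move=> Dz; apply: (@gdet_nonzero R D setT (fun=> Q *m A_normal t0) v1 Dv1 z 0 Dz) => //.
    by rewrite (motion_dz (fun=> Q *m A_normal t0) 0 (Dv1.1 _ Dz)).2; exact: dn1.
  (* The points near which the first two components of [H *m v] are coordinates. *)
  exists (D `&` gdet v1 0 1 @^-1` [set x | x != 0]); split.
  + apply: open_setI_preimage; [by []| |exact: open_neq].
    by move=> z Dz; exact: gdet_continuous oD Dv1 Dz.
  + by move=> z [].
  + move=> z Dz B nB.
    have oU : open (D `&` B°) by apply: openI => //; exact: open_interior.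
    have [||z1 [Dz1 Bz1] g1] := gdet01_dense Dv1 cD1 ND1 gD1 oU.
    * by exists z; split.
    * by move=> x [].
    by exists z1; split; [split|exact: interior_subset Bz1].
  move=> z0 [Dz0 g0].
  have [y0 [e [Psi [f1 [f2 [e0 [Py0 PD] cc reg vE]]]]]] :=
    normal_coordinates oD Dv1 cD1 Dz0 g0.
  exists (ball y0 e), Psi, f1, f2; split => //.
    by split=> //; exists y0 => //; exact: ballxx.
  exact: chart_admissible Dv1 cc PD reg vE dn1.
- move=> W f1 f2 oW adm phi.
  have [f1E f2E nd] := adm; have reg := conj f1E f2E.
  split.
  + by move=> z Wz; exact: (v_normal_constraint oW reg Wz).
  + exact: (normal_is_solution oW reg nd).
  + by move=> z t Wz; rewrite (det_phi oW reg t Wz) mulNr opprD.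
  + by move=> z t u Wz lv; exact: (normal_vorticity oW reg nd Wz lv).
Qed.
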